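(* Let $d\ge 1$, let $E$ be a non-empty (Lebesgue) measurable subset of $\mathbb{R}^d$, and let $p,q,r$ be exponents with $1\leq p,q,r\leq\infty$, $\frac1p+\frac1q=\frac1r$, such that exactly one of the three numbers $p$, $q$, $r'=\frac{r}{r-1}$ is less than $2$. Suppose that $\chi_E(\xi-\eta)$ is a bi-linear multiplier symbol for the triplet $(p,q,r)$, where $\chi_E$ is the indicator function of $E$. Then $E$ is equivalent to an open subset of $\mathbb{R}^d$, i.e. there exists an open set $U\subseteq\mathbb{R}^d$ such that the symmetric difference $E\,\Delta\,U$ has Lebesgue measure zero.
   Context: Conventions: $1/\infty=0$; $r'=\frac{r}{r-1}$ is the conjugate exponent of $r$, with $r'=\infty$ if $r=1$ and $r'=1$ if $r=\infty$. $\hat f$ denotes the Fourier transform of $f$ on $\mathbb{R}^d$ (normalized as $\hat f(\xi)=\int_{\mathbb{R}^d} f(x)e^{-2\pi i x\cdot\xi}\,dx$). Bi-linear multiplier symbols: let $m$ be a bounded measurable function on $\mathbb{R}^d$. For functions $f,g$ in the Schwartz class $\mathcal{S}(\mathbb{R}^d)$ define $$T_m(f,g)(x)=\int_{\mathbb{R}^d}\int_{\mathbb{R}^d}\hat f(\xi)\,\hat g(\eta)\,m(\xi-\eta)\,e^{2\pi i x\cdot(\xi+\eta)}\,d\xi\,d\eta .$$ The function $m(\xi-\eta)$ (or simply $m$) is called a bi-linear multiplier symbol for the triplet $(p,q,r)$ if $T_m$ extends to a bounded operator from $L^p(\mathbb{R}^d)\times L^q(\mathbb{R}^d)$ into $L^r(\mathbb{R}^d)$,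 i.e. if there is a constant $C>0$, independent of $f$ and $g$, such that $\|T_m(f,g)\|_{L^r(\mathbb{R}^d)}\leq C\|f\|_{L^p(\mathbb{R}^d)}\|g\|_{L^q(\mathbb{R}^d)}$ for all such $f,g$. Two measurable sets $E,E'\subseteq\mathbb{R}^d$ are called equivalent if $E\,\Delta\,E'$ has Lebesgue measure zero. *)

(* Defs.v *)
From HB Require Import structures.
From mathcomp Require Import all_boot all_order all_algebra complex.
From mathcomp Require Import all_classical all_reals all_analysis measurable_realfun.

Set Implicit Arguments.
Unset Strict Implicit.
Unset Printing Implicit Defensive.

Import Order.TTheory GRing.Theory Num.Theory.
Import numFieldNormedType.Exports.

Local Open Scope classical_set_scope.
Local Open Scope complex_scope.
Local Open Scope ring_scope.

Definition rV_display : measure_display.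
Proof. exact: default_measure_display. Qed.

(* The product sigma-algebra on 'rV[R]_n, generated by the coordinates. It
   coincides with the Borel sigma-algebra of the topology of 'rV[R]_n because
   R is second countable. *)
Section measurable_rV.
Context (R : realType) (n : nat).

Definition rV_coord (i : 'I_n) (x : 'rV[R]_n) : measurableTypeR R := x 0 i.

Let rV_set0 : g_sigma_preimage rV_coord set0.
Proof. exact: sigma_algebra0. Qed.

Let rV_setC A : g_sigma_preimage rV_coord A -> g_sigma_preimage rV_coord (~` A).
Proof. exact: sigma_algebraC. Qed.

Let rV_bigcup (F : (set 'rV[R]_n)^nat) :
  (forall i, g_sigma_preimage rV_coord (F i)) ->
  g_sigma_preimage rV_coord (\bigcup_i (F i)).
Proof. exact: sigma_algebra_bigcup. Qed.

HB.instance Definition _ := @isMeasurable.Build rV_display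
  'rV[R]_n (g_sigma_preimage rV_coord) rV_set0 rV_setC rV_bigcup.

Lemma measurable_rV_coord i : measurable_fun [set: 'rV[R]_n] (rV_coord i).
Proof.
move=> _ Y mY; rewrite setTI; apply: sub_sigma_algebra => /=.
rewrite -bigcup_seq/=; exists i => /=; first by rewrite mem_index_enum.
by exists Y => //; rewrite setTI.
Qed.

Lemma measurable_fun_rVP d (T : measurableType d) (f : T -> 'rV[R]_n) :
  measurable_fun [set: T] f <->
  forall i, measurable_fun [set: T] (rV_coord i \o f).
Proof.
split=> [mf i|mf]; first exact: measurableT_comp (measurable_rV_coord i) mf.
suff H : g_sigma_preimage (fun i => rV_coord i \o f) `<=` measurable.
  move=> _ A mA; apply: H; rewrite g_sigma_preimage_comp.
  by exists A.
apply: smallest_sub; first exact: sigma_algebra_measurable.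
elim/big_ind : _ => //.
  by move=> A B HA HB C [/HA|/HB].
by move=> i _ A [B mB <-]; exact: mf.
Qed.

End measurable_rV.

Section lebesgue_rV.
Context (R : realType).
Local Open Scope ereal_scope.

Definition rV_cons n (x : measurableTypeR R * 'rV[R]_n) : 'rV[R]_n.+1 :=
  row_mx (x.1)%:M x.2.

Lemma rV_cons0 n x : @rV_cons n x 0%R 0%R = x.1.
Proof.
rewrite /rV_cons mxE; case: splitP => [j _|j] /=.
  by rewrite ord1 mxE eqxx mulr1n.
by move=> /eqP; rewrite eq_sym.
Qed.

Lemma rV_consS n x i : @rV_cons n x 0%R (lift ord0 i) = x.2 0%R i.
Proof.
rewrite /rV_cons mxE; case: splitP => [j|j] /=; first by rewrite ord1.
by rewrite /bump /= add1n => /eqP; rewrite eqSS => /eqP /val_inj ->.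
Qed.

Lemma measurable_rV_cons n : measurable_fun setT (@rV_cons n).
Proof.
apply/measurable_fun_rVP => i; have [j ->|->] := unliftP ord0 i.
- rewrite (_ : _ \o _ = @rV_coord R n j \o snd); last first.
    by apply/funext => x; exact: rV_consS.
  exact: measurableT_comp (measurable_rV_coord j) measurable_snd.
- by rewrite (_ : _ \o _ = fst)//; apply/funext => x; exact: rV_cons0.
Qed.

Definition rV_uncons n (x : 'rV[R]_n.+1) : measurableTypeR R * 'rV[R]_n :=
  (x 0%R 0%R, \row_i x 0%R (lift ord0 i)).

Lemma rV_consK n : cancel (@rV_cons n) (@rV_uncons n).
Proof.
move=> x; rewrite /rV_uncons rV_cons0 [RHS]surjective_pairing; congr pair.
by apply/rowP => i; rewrite mxE rV_consS.
Qed.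

Lemma measurable_rV_uncons n : measurable_fun setT (@rV_uncons n).
Proof.
apply: measurable_fun_pair; first exact: (measurable_rV_coord (ord0 : 'I_n.+1)).
apply/measurable_fun_rVP => i.
rewrite (_ : _ \o _ = @rV_coord R n.+1 (lift ord0 i)).
  exact: measurable_rV_coord.
by apply/funext => x; rewrite /rV_coord/= mxE.
Qed.

Section step.
Context (n : nat) (mu : {sigma_finite_measure set 'rV[R]_n -> \bar R}).

Definition lebesgue_rV_step : set 'rV[R]_n.+1 -> \bar R :=
  pushforward (@lebesgue_measure R \x mu) (@rV_cons n).

Let step0 : lebesgue_rV_step set0 = 0.
Proof. by rewrite /lebesgue_rV_step /pushforward preimage_set0 measure0. Qed.

Let step_ge0 A : 0 <= lebesgue_rV_step A.
Proof. exact: (measure_ge0 (@lebesgue_measure R \x mu)). Qed.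

Let step_sigma_additive : semi_sigma_additive lebesgue_rV_step.
Proof.
have mcons A : measurable A -> measurable (@rV_cons n @^-1` A).
  by move=> mA; rewrite -[X in measurable X]setTI; exact: measurable_rV_cons.
move=> F mF tF mUF; rewrite /lebesgue_rV_step /pushforward preimage_bigcup.
apply: measure_semi_sigma_additive.
- by move=> i; exact: mcons.
- apply/trivIsetP => /= i j _ _ ij; rewrite -preimage_setI.
  by move/trivIsetP : tF => /(_ _ _ _ _ ij) ->//; rewrite preimage_set0.
- by rewrite -preimage_bigcup; exact: mcons.
Qed.

HB.instance Definition _ := isMeasure.Build _ _ _ lebesgue_rV_step
  step0 step_ge0 step_sigma_additive.

Let step_sigma_finite : sigma_finite setT lebesgue_rV_step.
Proof.
have /sigma_finiteP[F [FT ndF Foo]] := sigma_finiteT (@lebesgue_measure R).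
have /sigma_finiteP[G [GT ndG Goo]] := sigma_finiteT mu.
exists (fun k => @rV_uncons n @^-1` (F k `*` G k)) => [|k].
  rewrite -preimage_bigcup -[LHS](preimage_setT (@rV_uncons n)).
  congr (_ @^-1` _); rewrite -setXTT FT GT predeqE => -[x y]; split.
    move=> [/= [i _ Fix] [j _ Gjy]]; exists (maxn i j) => //; split.
    - by move: x Fix; exact/subsetPset/ndF/leq_maxl.
    - by move: y Gjy; exact/subsetPset/ndG/leq_maxr.
  by move=> [i _ []/= ? ?]; split; exists i.
have [mFk Fkoo] := Foo k; have [mGk Gkoo] := Goo k; split.
  rewrite -[X in measurable X]setTI; apply: measurable_rV_uncons => //.
  exact: measurableX.
rewrite /lebesgue_rV_step /pushforward -comp_preimage.
rewrite (_ : _ \o _ = id) ?preimage_id; last exact/funext/rV_consK.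
by rewrite product_measure1E// lte_mul_pinfty// ge0_fin_numE.
Qed.

HB.instance Definition _ := Measure_isSigmaFinite.Build _ _ _ lebesgue_rV_step
  step_sigma_finite.

End step.

(* The n-fold product of the Lebesgue measure of R, transported along
   R * 'rV[R]_n -> 'rV[R]_n.+1; see lebesgue_rV_box. *)
Fixpoint lebesgue_rV n : {sigma_finite_measure set 'rV[R]_n -> \bar R} :=
  match n with
  | 0 => \d_(0%R : 'rV[R]_0)
  | n.+1 => lebesgue_rV_step (lebesgue_rV n)
  end.

Lemma measurable_rV_box n (A : 'I_n -> set (measurableTypeR R)) :
  (forall i, measurable (A i)) ->
  measurable [set x : 'rV[R]_n | forall i, A i (x 0%R i)].
Proof.
move=> mA; rewrite (_ : [set _ | _] = \bigcap_i (@rV_coord R n i @^-1` A i)).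
  apply: fin_bigcap_measurable => [|i _]; first exact: finite_finset.
  by rewrite -[X in measurable X]setTI; apply: (@measurable_rV_coord R n i).
by apply/seteqP; split => x /= Ax i; [move=> _|]; exact: Ax.
Qed.

Lemma lebesgue_rV_box n (A : 'I_n -> set (measurableTypeR R)) :
  (forall i, measurable (A i)) ->
  lebesgue_rV n [set x | forall i, A i (x 0%R i)] =
  \prod_(i < n) lebesgue_measure (A i).
Proof.
elim: n A => [|n IHn] A mA.
  by rewrite big_ord0 /= diracE mem_set// => -[].
rewrite big_ord_recl -IHn => [|i]; last exact: mA.
rewrite -product_measure1E//; last first.
  by apply: (@measurable_rV_box n (fun i => A (lift ord0 i))) => i; exact: mA.
rewrite /= /lebesgue_rV_step /pushforward; congr (_ _).
apply/seteqP; split => -[t x] /=.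
  move=> Atx; split=> [|i]; first by have := Atx 0%R; rewrite rV_cons0.
  by have := Atx (lift ord0 i); rewrite rV_consS.
move=> [At Ax] i; have [j ->|->] := unliftP ord0 i; first by rewrite rV_consS.
by rewrite rV_cons0.
Qed.

End lebesgue_rV.

Section bilinear_multiplier.
Context (R : realType) (d : nat).
Local Notation E := 'rV[R]_d.
Implicit Types (f g m : E -> R[i]) (x y xi eta : E) (p q r : \bar R).

(* The library integral of a nonnegative function is the supremum of the
   integrals of its simple measurable minorants, so it is insensitive to
   modifications on null sets: no completion of [lebesgue_rV d] is needed to
   integrate Lebesgue measurable functions that are not Borel. *)
Definition cintegral f : R[i] :=
  (\int[lebesgue_rV R d]_x complex.Re (f x)) +i*
  (\int[lebesgue_rV R d]_x complex.Im (f x)).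

Definition dotrV x y : R := \sum_(i < d) x 0 i * y 0 i.

(* cis t = e ^ (i t) *)
Definition cis (t : R) : R[i] := cos t +i* sin t.

Definition fourier f xi : R[i] :=
  cintegral (fun x => f x * cis (- (2 * pi * dotrV x xi))).

(* The iterated partial derivative along the coordinates listed in s. *)
Definition partials (s : seq 'I_d) (u : E -> R) : E -> R :=
  foldr (fun i v => 'D_(delta_mx 0 i) v) u s.

Definition smooth (u : E -> R) :=
  forall s : seq 'I_d, continuous (partials s u) /\
    forall (i : 'I_d) x, derivable (partials s u) x (delta_mx 0 i).

Definition schwartz_real (u : E -> R) :=
  smooth u /\
  forall (a : 'I_d -> nat) (s : seq 'I_d), exists M : R, forall x,
    `|(\prod_(i < d) x 0 i ^+ a i) * partials s u x| <= M.

Definition schwartz f :=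
  schwartz_real (fun x => complex.Re (f x)) /\
  schwartz_real (fun x => complex.Im (f x)).

Definition bilinear_op m f g x : R[i] :=
  cintegral (fun eta => cintegral (fun xi =>
    fourier f xi * fourier g eta * m (xi - eta) *
    cis (2 * pi * dotrV x (xi + eta)))).

Definition cLnorm p f : \bar R :=
  'N[lebesgue_rV R d]_p[EFin \o (fun x => Normc.normc (f x))].

(* Only meant for bounded Lebesgue measurable m. *)
Definition bilinear_multiplier_symbol p q r m :=
  exists C : R, 0 < C /\ forall f g, schwartz f -> schwartz g ->
    (cLnorm r (bilinear_op m f g) <= C%:E * (cLnorm p f * cLnorm q g))%E.

Definition cindic (A : set E) : E -> R[i] := fun x => (\1_A x)%:C.

(* Membership in the completed sigma-algebra: A is the union of a Borel set
   and of a subset of a Borel null set. *)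
Definition lebesgue_measurable (A : set E) :=
  completed_algebra_gen (lebesgue_rV R d) A.

Definition lebesgue_equiv (A B : set E) :=
  (lebesgue_rV R d).-negligible (A `+` B).

End bilinear_multiplier.

(* Main.v *)
Require Import Defs.
From HB Require Import structures.
From mathcomp Require Import all_boot all_order all_algebra complex.
From mathcomp Require Import all_classical all_reals all_analysis measurable_realfun.
From mathcomp Require Import ess_sup_inf ring lra zify.

Set Implicit Arguments.
Unset Strict Implicit.
Unset Printing Implicit Defensive.

Import Order.TTheory GRing.Theory Num.Theory.
Import numFieldNormedType.Exports.

Local Open Scope classical_set_scope.
Local Open Scope ring_scope.

(** Suppose that no open set is equivalent to E. Removing from E its essential
    interior leaves a set F of positive measure, and the complement of E has
    positive measure in every ball centred in F. Since translations are
    continuous in measure, the points of a progression a, a + t, a - t, a + 2t,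
    and so on, can be pushed one after the other to the prescribed side of E:
    for every finite set of integers i and every choice of in or out for each
    of them there are a step t and a set w of base points a, of positive
    measure, such that a + i t lies in E or not exactly as chosen
    ([prescribed_pattern], [not_open_pattern]).

    A bounded multiplier cannot tolerate arbitrary patterns. Let K be the
    Gaussian of width 1/e, and test the operator on K times trigonometric
    polynomials with frequencies a + n t for f and n t for g. The Fourier
    transforms are sums of Gaussians of width e, and for small e a suitable a
    in w sees the symbol as constant around each difference of frequencies
    ([good_point]), so that T(f, g) is uniformly close to
    [K ^ 2 * Sum_(k, l) al_k al_l m_(k, l) e ^ (2 pi i x . (a + (n_k + n_l) t))],
    where m is the prescribed 0-1 pattern ([bilinear_gauss_waves_approx]).
    The norm of K in L^p is at most a power e ^ (- d / p), and the relation
    between p, q and r makes all the powers of e cancel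
    ([gaussian_scale_bound]).

    It remains to find coefficients for which a pattern increases the size of
    a product by an arbitrary factor, and this is done by tensorization. Take
    [F = 1 + i cos], with [|F| <= sqrt 2], and [H = 1 + i cos - cos (2 .) / 4],
    with [|H| <= 5 / 4]. The mean of [F ^ 2 * conj H] is 25/16, but it becomes
    41/16 if in the square of F the products of the two opposite frequencies
    change sign. For the products of D copies of F and H, at the frequencies
    [10 ^ j], the pattern that keeps the terms with an even number of opposite
    digits is the average of the constant 1 and of a product of signs, and it
    gives a pairing of [((25/16) ^ D + (41/16) ^ D) / 2] ([diagonal_sum]). By
    duality a bounded T makes this at most a constant, independent of D,
    times [(sqrt 2) ^ (2 D) * (5/4) ^ D = (40/16) ^ D], which is absurd for
    large D ([growth_bound]). *)

(** * Translation invariance *)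

Section translation.
Context (R : realType).
Local Open Scope ereal_scope.

Lemma lebesgue_measure_translate (c : R) (A : set (measurableTypeR R)) :
  measurable A ->
  lebesgue_measure ((fun x : R => x + c)%R @^-1` A) = lebesgue_measure A.
Proof.
move=> mA.
have mt : measurable_fun setT
    (fun x : measurableTypeR R => (x + c)%R : measurableTypeR R).
  exact: measurable_funD.
rewrite -[LHS]/(pushforward (@lebesgue_measure R)
  (fun x : measurableTypeR R => (x + c)%R : measurableTypeR R) A).
apply/esym/lebesgue_measure_unique => //= _ [[a b]] _ <-.
rewrite /pushforward.
rewrite (_ : _ @^-1` _ = `](a - c)%R, (b - c)%R]%classic); last first.
  by apply/seteqP; split => x /=; rewrite !in_itv /= ltrBlDr lerBrDr.
rewrite !lebesgue_measure_itv/= !lte_fin ltrD2r; case: ifP => // _.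
by rewrite -!EFinB opprB addrA subrK.
Qed.

Variable n : nat.
Implicit Types v : 'rV[R]_n.

Lemma measurable_rV_pair d1 (T : measurableType d1) k
    (f : T -> 'rV[R]_k) (g : T -> 'rV[R]_k) :
  measurable_fun setT f -> measurable_fun setT g ->
  measurable_fun setT (fun x => f x + g x)%R.
Proof.
move=> mf mg; apply/measurable_fun_rVP => i.
rewrite (_ : _ \o _ = (fun x => @rV_coord R k i (f x) + @rV_coord R k i (g x))%R).
  apply: measurable_funD.
  - exact: (measurableT_comp (measurable_rV_coord i) mf).
  - exact: (measurableT_comp (measurable_rV_coord i) mg).
by apply/funext => x /=; rewrite /rV_coord mxE.
Qed.

End translation.

(** The measure is an iterated product, in which a translation acts on each
    factor; both factors of the recursion are handled by uniqueness of the
    product measure. *)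
Lemma lebesgue_rV_translate (R : realType) n (v : 'rV[R]_n)
    (A : set 'rV[R]_n) : measurable A ->
  lebesgue_rV R n ((fun x => x + v)%R @^-1` A) = lebesgue_rV R n A.
Proof.
elim: n v A => [|n IHn] v A mA.
  rewrite (_ : _ @^-1` _ = A)//; apply/seteqP; split => x /=;
    by rewrite (_ : (x + v)%R = x)//; apply/rowP => -[].
rewrite /= /lebesgue_rV_step /pushforward.
pose sh (z : measurableTypeR R * 'rV[R]_n) : measurableTypeR R * 'rV[R]_n :=
  (z.1 + v ord0 ord0, z.2 + \row_i v ord0 (lift ord0 i))%R.
have msh : measurable_fun setT sh.
  apply: measurable_fun_pair.
    by apply: measurable_funD => //; exact: measurable_fst.
  apply: measurable_rV_pair => //; exact: measurable_snd.
have mB : measurable (@rV_cons R n @^-1` A).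
  by rewrite -[X in measurable X]setTI; exact: measurable_rV_cons.
have -> : @rV_cons R n @^-1` ((fun x => x + v)%R @^-1` A) =
    sh @^-1` (@rV_cons R n @^-1` A).
  apply/seteqP; split => -[t x] /=; rewrite /sh/=;
    suff -> : (rV_cons (t, x) + v)%R =
      rV_cons (t + v ord0 ord0, x + \row_i v ord0 (lift ord0 i))%R by [].
    apply/rowP => i; rewrite mxE; have [j ->|->] := unliftP ord0 i.
      by rewrite !rV_consS /= !mxE.
    by rewrite !rV_cons0.
  apply/rowP => i; rewrite mxE; have [j ->|->] := unliftP ord0 i.
    by rewrite !rV_consS /= !mxE.
  by rewrite !rV_cons0.
rewrite -[LHS]/(pushforward (lebesgue_measure \x lebesgue_rV R n)%E sh _).
apply/esym; apply: product_measure_unique => // B C mB' mC.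
rewrite /= /pushforward.
rewrite (_ : sh @^-1` _ = ((fun x : R => x + v ord0 ord0)%R @^-1` B) `*`
  ((fun x => x + \row_i v ord0 (lift ord0 i))%R @^-1` C)); last by [].
rewrite product_measure1E.
- by congr (_ * _)%E; [exact: lebesgue_measure_translate|exact: IHn].
- rewrite -[X in measurable X]setTI.
  by apply: (measurable_funD (f := id) (g := cst (v ord0 ord0))).
- rewrite -[X in measurable X]setTI.
  by apply: (measurable_rV_pair (f := id) (g := cst _)).
Qed.

Lemma integrableZl_EFin d (T : measurableType d) (R : realType)
    (mu : {measure set T -> \bar R}) (k : R) (u : T -> R) :
  mu.-integrable setT (EFin \o u) ->
  mu.-integrable setT (EFin \o (fun x => k * u x)).
Proof.
move=> iu; rewrite (_ : _ \o _ = fun x => (k%:E * (EFin \o u) x)%E)//.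
exact: integrableZl.
Qed.

Lemma integrableD_EFin d (T : measurableType d) (R : realType)
    (mu : {measure set T -> \bar R}) (u v : T -> R) :
  mu.-integrable setT (EFin \o u) -> mu.-integrable setT (EFin \o v) ->
  mu.-integrable setT (EFin \o (fun x => u x + v x)).
Proof.
move=> iu iv; rewrite (_ : _ \o _ = ((EFin \o u) \+ (EFin \o v))%E)//.
exact: integrableD.
Qed.

(** * The Fourier transform of a Gaussian on the line *)

Section gauss1.
Context (R : realType).
Notation mu := (@lebesgue_measure R).
Implicit Types (b c x y v t : R).

Lemma measurable_gauss c b :
  measurable_fun [set: measurableTypeR R] (fun x => expR (- (c * (x - b) ^+ 2))).
Proof.
apply: measurableT_comp => //; apply: measurableT_comp => //.
apply: measurable_funM => //; apply: measurable_funX; exact: measurable_funB.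
Qed.

(** A multiple of the density of a normal law, whose total mass is 1. *)
Lemma integral_gauss c b : 0 < c ->
  (\int[mu]_x (expR (- (c * (x - b) ^+ 2)))%:E = (Num.sqrt (pi / c))%:E)%E.
Proof.
move=> c0; pose s := Num.sqrt (c^-1 / 2).
have s2 : s ^+ 2 = c^-1 / 2 by rewrite sqr_sqrtr// divr_ge0// invr_ge0 ltW.
have s0 : s != 0 by rewrite gt_eqF// sqrtr_gt0 divr_gt0// invr_gt0.
have p0 : normal_peak s != 0 by rewrite gt_eqF// normal_peak_gt0.
have e x : expR (- (c * (x - b) ^+ 2)) = (normal_peak s)^-1 * normal_pdf b s x.
  rewrite normal_pdfE//= mulKf// /normal_fun s2; congr expR.
  by field; rewrite gt_eqF.
under eq_integral do rewrite e EFinM.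
rewrite ge0_integralZl_EFin//=.
- rewrite integral_normal_pdf mule1 /normal_peak invrK s2.
  by congr ((Num.sqrt _)%:E); field; rewrite gt_eqF.
- by move=> x _; rewrite lee_fin normal_pdf_ge0.
- apply/measurable_EFinP; exact: measurable_normal_pdf.
- by rewrite invr_ge0 normal_peak_ge0.
Qed.

Lemma integrable_gauss c b : 0 < c ->
  mu.-integrable setT (EFin \o (fun x => expR (- (c * (x - b) ^+ 2)))).
Proof.
move=> c0; apply/integrableP; split.
  by apply/measurable_EFinP; exact: measurable_gauss.
under eq_integral do rewrite /= ger0_norm ?expR_ge0//.
by rewrite integral_gauss ?ltry.
Qed.

(** A factor of linear growth costs half of the exponent; this dominates the
    derivative of the Fourier integrand. *)
Lemma gauss_mul_le c y : 0 < c ->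
  (1 + `|y|) * expR (- (c * y ^+ 2)) <= (2 + 2 / c) * expR (- (c / 2 * y ^+ 2)).
Proof.
move=> c0.
have -> : expR (- (c * y ^+ 2)) =
    expR (- (c / 2 * y ^+ 2)) * expR (- (c / 2 * y ^+ 2)).
  by rewrite -expRD; congr expR; field.
rewrite mulrA ler_pM2r ?expR_gt0// expRN ler_pdivrMr ?expR_gt0//.
have h := expR_ge1Dx (c / 2 * y ^+ 2).
have c20 : 0 < 2 / c by rewrite divr_gt0.
apply: (@le_trans _ _ ((2 + 2 / c) * (1 + c / 2 * y ^+ 2))); last first.
  by rewrite ler_pM2l// addr_gt0.
have -> : (2 + 2 / c) * (1 + c / 2 * y ^+ 2) = 2 + 2 / c + c * y ^+ 2 + y ^+ 2.
  by field; rewrite gt_eqF.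
have : 0 <= (`|y| - 1) ^+ 2 by exact: sqr_ge0.
have : 0 <= c * y ^+ 2 by rewrite mulr_ge0 ?sqr_ge0// ltW.
have : `|y| ^+ 2 = y ^+ 2 by rewrite real_normK// num_real.
move: (`|y|) => w <-; nra.
Qed.

Lemma integrable_gauss_dom c b (f : R -> R) (M : R) : 0 < c ->
  measurable_fun [set: measurableTypeR R] f ->
  (forall x, `|f x| <= M * (1 + `|x - b|) * expR (- (c * (x - b) ^+ 2))) ->
  mu.-integrable setT (EFin \o f).
Proof.
move=> c0 mf fM.
have M0 : 0 <= M.
  have := le_trans (normr_ge0 _) (fM b).
  by rewrite subrr normr0 addr0 mulr1 expr0n/= mulr0 oppr0 expR0 mulr1.
have c20 : 0 < c / 2 by rewrite divr_gt0.
have := integrableZl measurableT (M * (2 + 2 / c)) (integrable_gauss b c20).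
apply: le_integrable => //; first exact/measurable_EFinP.
move=> x _ /=; rewrite lee_fin (le_trans (fM x))//.
rewrite (le_trans _ (ler_norm _))// -!mulrA ler_wpM2l//.
by rewrite (le_trans (gauss_mul_le _ c0))// mulrA.
Qed.

Lemma measurable_gauss_trig c b v t :
  measurable_fun [set: measurableTypeR R]
    (fun x => expR (- (c * (x - b) ^+ 2)) * cos ((x - b) * v + t)).
Proof.
apply: measurable_funM; first exact: measurable_gauss.
apply: continuous_measurable_fun => x.
apply: (@continuous_comp _ _ _ (fun x : R => (x - b) * v + t) cos).
  apply: cvgD; last exact: cvg_cst.
  by apply: cvgMl; apply: cvgB; [exact: cvg_id|exact: cvg_cst].
exact: continuous_cos.
Qed.

(** The fundamental theorem of calculus on [- n, n], letting n tend to
    infinity by dominated convergence. *)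
Lemma integral_derive_eq0 (h h' : R -> R) :
  (forall x, is_derive x 1 h (h' x)) -> continuous h' ->
  mu.-integrable setT (EFin \o h') ->
  h n%:R @[n --> \oo] --> (0 : R) -> h (- n%:R) @[n --> \oo] --> (0 : R) ->
  (\int[mu]_x (h' x)%:E = 0)%E.
Proof.
move=> dh ch' ih' hp hm.
pose f_ (n : nat) : R -> \bar R := (EFin \o h') \_ `[- n.+1%:R, n.+1%:R].
have mh' : measurable_fun setT (EFin \o h') by exact: measurable_int ih'.
have fcvg x : f_ ^~ x @ \oo --> (h' x)%:E.
  apply: cvg_near_cst; near=> n.
  rewrite /f_ patchE ifT// inE/= in_itv/= -ler_norml.
  apply: (@le_trans _ _ n%:R); last by rewrite ler_nat.
  near: n; exact: nbhs_infty_ger.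
have mf_ n : measurable_fun setT (f_ n).
  apply: (measurable_restrictT _ (measurable_itv `[- n.+1%:R, n.+1%:R])).1.
  exact: measurable_funTS.
have aecvg : {ae mu, forall x, setT x -> f_ ^~ x @ \oo --> (EFin \o h') x}.
  by apply: aeW => x _; exact: fcvg.
have aele : {ae mu, forall x (n : nat), setT x ->
    (`|f_ n x| <= (abse \o (EFin \o h')) x)%E}.
  apply: aeW => x n _; rewrite /f_ patchE; case: ifPn => //= _.
  by rewrite normr0 lee_fin normr_ge0.
have [_ _ cv] := @dominated_convergence _ _ _ mu setT measurableT _ _ _ mf_ mh' aecvg
  (integrable_abse ih') aele.
have e n : (\int[mu]_x f_ n x = (h n.+1%:R - h (- n.+1%:R))%:E)%E.
  rewrite /f_ -integral_mkcond EFinB.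
  apply: (@continuous_FTC2 _ h' h).
  - by rewrite gtrN.
  - by apply: continuous_subspaceT.
  - have ch x : {for x, continuous h}.
      by apply: differentiable_continuous; apply/derivable1_diffP.
    split.
    + by move=> x _; have [] := dh x.
    + apply: cvg_at_right_filter; exact: ch.
    + apply: cvg_at_left_filter; exact: ch.
  - by move=> x _; rewrite derive1E; exact: derive_val.
apply/esym; apply: cvg_unique cv => //=.
rewrite (_ : (fun n => _) = (fun n => (h n.+1%:R - h (- n.+1%:R))%:E)); last first.
  by apply/funext.
apply: cvg_EFin; first exact: nearW.
rewrite -[X in _ --> X]subr0.
apply: cvgB.
  by rewrite (cvg_shiftS (fun n => h n%:R)).
by rewrite (cvg_shiftS (fun n => h (- n%:R))).
Unshelve. all: by end_near. Qed.

Lemma gauss_decay c b (h : R -> R) : 0 < c ->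
  (forall x, `|h x| <= expR (- (c * (x - b) ^+ 2))) ->
  h n%:R @[n --> \oo] --> (0 : R) /\ h (- n%:R) @[n --> \oo] --> (0 : R).
Proof.
move=> c0 hb.
have hb' x : `|h x| <= (2 + 2 / c) / (1 + `|x - b|).
  rewrite (le_trans (hb x))// ler_pdivlMr ?ltr_pwDl// mulrC.
  rewrite (le_trans (gauss_mul_le _ c0))// ler_piMr//.
    by rewrite addr_ge0// divr_ge0// ltW.
  rewrite -[leRHS]expR0 ler_expR oppr_le0 mulr_ge0 ?sqr_ge0// divr_ge0//.
  exact: ltW.
have aux e x : 0 < e -> `|b| + (2 + 2 / c) / e < `|x| -> `|h x| < e.
  move=> e0 xl; rewrite (le_lt_trans (hb' x))// ltr_pdivrMr ?ltr_pwDl//.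
  rewrite -ltr_pdivrMl// mulrC.
  have := lerB_normD x (- b); rewrite normrN => tri.
  by move: xl tri; set w := _ / e; lra.
split; apply/cvgrPdist_lt => e e0; near=> n; rewrite sub0r normrN; apply: aux => //;
  rewrite ?normrN (ger0_norm (ler0n _ n)); near: n; exact: nbhs_infty_gtr.
Unshelve. all: by end_near. Qed.

Lemma is_derive_affine (f : R -> R) a s x l :
  is_derive (x * a + s) 1 f l ->
  is_derive x 1 (fun x => f (x * a + s)) (l * a).
Proof.
move=> df; apply: (@is_derive1_comp _ f (fun x => x * a + s)).
apply: is_derive_eq; rewrite addr0 /GRing.scale/= mulr1.
by rewrite mulr0 add0r.
Qed.

(** Real form of the Fourier transform of a Gaussian; the phase t gives both
    the real and the imaginary part. *)
Definition gauss_cos c b t v := \int[mu]_x (expR (- (c * (x - b) ^+ 2)) * cos ((x - b) * v + t)).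

Lemma integrable_gauss_cos c b t v : 0 < c -> mu.-integrable setT
  (EFin \o (fun x => expR (- (c * (x - b) ^+ 2)) * cos ((x - b) * v + t))).
Proof.
move=> c0; apply: (@integrable_gauss_dom c b _ 1) => //.
  exact: measurable_gauss_trig.
move=> x; rewrite normrM (ger0_norm (expR_ge0 _)) mul1r mulrC ler_pM2r ?expR_gt0//.
by rewrite (le_trans (cos_max _))// lerDl.
Qed.

(** Differentiating under the integral produces a factor x - b, which an
    integration by parts turns into the frequency v: the transform of a
    Gaussian solves a linear differential equation of order one. *)
Lemma is_derive_gauss_cos c b t v : 0 < c ->
  is_derive v 1 (gauss_cos c b t) (- (v / (2 * c)) * gauss_cos c b t v).
Proof.
move=> c0.
pose g x := expR (- (c * (x - b) ^+ 2)).
pose f v x := g x * cos ((x - b) * v + t).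
have df (w x : R) : is_derive w 1 (f ^~ x) (- ((x - b) * g x * sin ((x - b) * w + t))).
  rewrite /f.
  have := @is_derive_affine cos (x - b) t w _ (is_derive_cos _).
  under eq_fun do rewrite (mulrC _ (x - b)).
  rewrite mulrC => dc.
  apply: is_derive_eq; rewrite /GRing.scale/= (mulrC w); ring.
have dfE (w x : R) : partial1of2 f w x = - ((x - b) * g x * sin ((x - b) * w + t)).
  by rewrite partial1of2E; exact: derive_val.
have Ia : `]v - 1, v + 1[%classic v by rewrite /= in_itv/= ltrDl gtrBl ltr01.
have if_ w : mu.-integrable setT (EFin \o f w) by exact: integrable_gauss_cos.
have mG : measurable_fun [set: measurableTypeR R] (fun x => `|x - b| * g x).
  apply: measurable_funM; last exact: measurable_gauss.
  by apply: measurableT_comp => //; exact: measurable_funB.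
have G0 x : 0 <= `|x - b| * g x by rewrite mulr_ge0 ?expR_ge0.
have iG : mu.-integrable setT (EFin \o (fun x => `|x - b| * g x)).
  apply: (@integrable_gauss_dom c b _ 1) => // x.
  by rewrite ger0_norm// mul1r ler_wpM2r ?expR_ge0// lerDr.
have Gub w x : `|partial1of2 f w x| <= `|x - b| * g x.
  rewrite dfE normrN 2!normrM (ger0_norm (expR_ge0 _)) ler_piMr ?sin_max//.
apply: DeriveDef.
  exact: (@derivable_under_integral _ _ _ mu f setT measurableT v (v - 1) (v + 1)
    Ia (fun w _ => if_ w) (fun w x _ _ => @ex_derive _ _ _ _ _ _ _ (df w x))
    _ G0 iG (fun w x _ _ => Gub w x)).
rewrite -derive1E.
rewrite (@differentiation_under_integral _ _ _ mu f setT measurableT v (v - 1)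
    (v + 1) Ia (fun w _ => if_ w) (fun w x _ _ => @ex_derive _ _ _ _ _ _ _ (df w x))
    _ G0 iG (fun w x _ _ => Gub w x)).
under eq_Rintegral do rewrite /= dfE.
(* The derivative of h is a multiple of the integrand plus v times the integrand
   of the transform, and its integral vanishes. *)
pose h x := g x * sin ((x - b) * v + t).
pose h' x := (- (2 * c)) * ((x - b) * g x * sin ((x - b) * v + t)) + v * f v x.
have dg (x : R) : is_derive x 1 g (g x * - (2 * c * (x - b))).
  apply: (@is_derive1_comp _ expR (fun x => - (c * (x - b) ^+ 2))).
  apply: is_derive_eq; rewrite /GRing.scale/=. ring.
have dh (x : R) : is_derive x 1 h (h' x).
  have ds := @is_derive_affine sin v (t - b * v) x _ (is_derive_sin _).
  have se y : y * v + (t - b * v) = (y - b) * v + t by ring.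
  rewrite se in ds.
  rewrite (_ : (fun _ => _) = fun x => sin ((x - b) * v + t)) in ds; last first.
    by apply/funext => y; rewrite se.
  apply: (is_derive_eq (is_deriveM (dg x) ds)).
  rewrite /h' /f /GRing.scale/=; ring.
have ih1 : mu.-integrable setT
    (EFin \o (fun x => (x - b) * g x * sin ((x - b) * v + t))).
  apply: (@integrable_gauss_dom c b _ 1) => //.
    apply: measurable_funM.
      apply: measurable_funM; last exact: measurable_gauss.
      exact: measurable_funB.
    apply: continuous_measurable_fun => x.
    apply: (@continuous_comp _ _ _ (fun x : R => (x - b) * v + t) sin).
      apply: cvgD; last exact: cvg_cst.
      by apply: cvgMl; apply: cvgB; [exact: cvg_id|exact: cvg_cst].
    exact: continuous_sin.
  move=> x; rewrite mul1r 2!normrM (ger0_norm (expR_ge0 _)).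
  rewrite (@le_trans _ _ (`|x - b| * g x))//.
    by rewrite ler_piMr ?sin_max// mulr_ge0 ?expR_ge0.
  by rewrite ler_wpM2r ?expR_ge0// lerDr.
have ih' : mu.-integrable setT (EFin \o h').
  by apply: integrableD_EFin; apply: integrableZl_EFin => //; exact: if_.
have ch' : continuous h'.
  move=> x.
  have cder (u : R -> R) l : is_derive x 1 u l -> u y @[y --> x] --> u x.
    move=> du; apply: differentiable_continuous; apply/derivable1_diffP.
    exact: (@ex_derive _ _ _ _ _ _ _ du).
  have ds := @is_derive_affine sin v (t - b * v) x _ (is_derive_sin _).
  have dc := @is_derive_affine cos v (t - b * v) x _ (is_derive_cos _).
  have se y : y * v + (t - b * v) = (y - b) * v + t by ring.
  rewrite (_ : (fun _ => _) = fun x => sin ((x - b) * v + t)) in ds; last first.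
    by apply/funext => y; rewrite se.
  rewrite (_ : (fun _ => _) = fun x => cos ((x - b) * v + t)) in dc; last first.
    by apply/funext => y; rewrite se.
  have cg := cder _ _ (dg x); have cs := cder _ _ ds; have cc := cder _ _ dc.
  rewrite /h' /f; apply: cvgD.
    apply: cvgM; first exact: cvg_cst.
    apply: cvgM => //; apply: cvgM => //.
    by apply: cvgB; [exact: cvg_id|exact: cvg_cst].
  by apply: cvgM; [exact: cvg_cst|exact: cvgM].
have hb x : `|h x| <= expR (- (c * (x - b) ^+ 2)).
  by rewrite normrM (ger0_norm (expR_ge0 _)) ler_piMr ?sin_max// expR_ge0.
have [hp hm] := gauss_decay c0 hb.
have /(congr1 fine)/= := integral_derive_eq0 dh ch' ih' hp hm.
rewrite -[LHS]/(\int[mu]_x h' x) /h' RintegralD//; last 2 first.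
- exact: integrableZl_EFin.
- by apply: integrableZl_EFin; exact: if_.
rewrite RintegralZl// RintegralZl//.
move=> /eqP; rewrite mulNr addrC subr_eq0 => /eqP e.
rewrite (_ : \int[mu]_x (- ((x - b) * g x * sin ((x - b) * v + t))) =
  - \int[mu]_x ((x - b) * g x * sin ((x - b) * v + t))); last first.
  under eq_Rintegral do rewrite -mulN1r.
  by rewrite RintegralZl// mulN1r.
rewrite -[gauss_cos _ _ _ _]/(\int[mu]_x (f v x)).
apply: (mulfI (lt0r_neq0 (mulr_gt0 (ltr0n _ 2) c0))).
rewrite mulrN -e; field; exact: lt0r_neq0.
Qed.

(** The quotient of the two sides has zero derivative in v, by the
    differential equation above. *)
Lemma fourier_gauss_line c b t v : 0 < c ->
  gauss_cos c b t v = Num.sqrt (pi / c) * expR (- (v ^+ 2 / (4 * c))) * cos t.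
Proof.
move=> c0.
pose psi (v : R) := expR (v ^+ 2 / (4 * c)) * gauss_cos c b t v.
have dpsi (w : R) : is_derive w 1 psi 0.
  have := is_derive_gauss_cos b t w c0 => dgauss_cos.
  have de : is_derive w 1 (fun v => expR (v ^+ 2 / (4 * c)))
      (expR (w ^+ 2 / (4 * c)) * (w / (2 * c))).
    apply: (@is_derive1_comp _ expR (fun v => v ^+ 2 / (4 * c))).
    by apply: is_derive_eq; rewrite /GRing.scale/=; field;
      exact: lt0r_neq0.
  by apply: is_derive_eq; rewrite /GRing.scale/=; ring.
have := is_derive_0_is_cst v 0 dpsi.
rewrite /psi expr0n/= mul0r expR0 mul1r {2}/gauss_cos.
under eq_Rintegral do rewrite mulr0 add0r.
rewrite RintegralZr//; last exact: integrable_gauss.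
rewrite /Rintegral integral_gauss//= => e.
have eA0 := lt0r_neq0 (expR_gt0 (v ^+ 2 / (4 * c))).
by apply: (mulfI eA0); rewrite e expRN; field.
Qed.

End gauss1.

Local Open Scope complex_scope.

Notation cRe := complex.Re.
Notation cIm := complex.Im.
Notation cnorm := Normc.normc.

(** * Complex-valued functions: measurability and integration *)

Section complex_facts.
Context (R : realType).
Implicit Types (x y z : R[i]) (t : R).

Lemma cReD x y : cRe (x + y) = cRe x + cRe y. Proof. by case: x y => [a b] []. Qed.
Lemma cImD x y : cIm (x + y) = cIm x + cIm y. Proof. by case: x y => [a b] []. Qed.
Lemma cReM x y : cRe (x * y) = cRe x * cRe y - cIm x * cIm y.
Proof. by case: x y => [a b] []. Qed.
Lemma cImM x y : cIm (x * y) = cRe x * cIm y + cIm x * cRe y.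
Proof. by case: x y => [a b] []. Qed.

Lemma cnorm_ge0 z : 0 <= cnorm z.
Proof. by case: z => a b; exact: sqrtr_ge0. Qed.

Lemma cnormN z : cnorm (- z) = cnorm z.
Proof. by case: z => a b /=; rewrite !sqrrN. Qed.

Lemma cnorm_real t : cnorm t%:C = `|t|.
Proof. by rewrite /= expr0n addr0 sqrtr_sqr. Qed.

Lemma cnorm_sqr z : cnorm z ^+ 2 = cRe z ^+ 2 + cIm z ^+ 2.
Proof. by case: z => a b; rewrite sqr_sqrtr// addr_ge0// sqr_ge0. Qed.

Lemma norm_cRe_le z : `|cRe z| <= cnorm z.
Proof.
by case: z => a b /=; rewrite -sqrtr_sqr ler_wsqrtr// lerDl sqr_ge0.
Qed.

Lemma norm_cIm_le z : `|cIm z| <= cnorm z.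
Proof.
by case: z => a b /=; rewrite -sqrtr_sqr ler_wsqrtr// lerDr sqr_ge0.
Qed.

Lemma cnorm_le z : cnorm z <= `|cRe z| + `|cIm z|.
Proof.
rewrite -(@ler_pXn2r _ 2)// ?nnegrE ?cnorm_ge0 ?addr_ge0//.
rewrite cnorm_sqr -(real_normK (num_real (cRe z))) -(real_normK (num_real (cIm z))).
by rewrite sqrrD lerD2r lerDl mulrn_wge0// mulr_ge0.
Qed.

Lemma cnorm_sum (I : Type) (s : seq I) (P : pred I) (F : I -> R[i]) :
  cnorm (\sum_(i <- s | P i) F i) <= \sum_(i <- s | P i) cnorm (F i).
Proof.
elim/big_rec2: _ => [|i x y _ h]; first by rewrite Normc.normc0.
by rewrite (le_trans (le_normcD _ _))// lerD2l.
Qed.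

Lemma cnorm_prod (I : Type) (s : seq I) (P : pred I) (F : I -> R[i]) :
  cnorm (\prod_(i <- s | P i) F i) = \prod_(i <- s | P i) cnorm (F i).
Proof.
elim/big_rec2: _ => [|i x y _ <-]; first exact: Normc.normc1.
by rewrite Normc.normcM.
Qed.

Lemma cRe_sum (I : Type) (s : seq I) (P : pred I) (F : I -> R[i]) :
  cRe (\sum_(i <- s | P i) F i) = \sum_(i <- s | P i) cRe (F i).
Proof. by elim/big_rec2: _ => // i x y _ <-; rewrite cReD. Qed.

Lemma cIm_sum (I : Type) (s : seq I) (P : pred I) (F : I -> R[i]) :
  cIm (\sum_(i <- s | P i) F i) = \sum_(i <- s | P i) cIm (F i).
Proof. by elim/big_rec2: _ => // i x y _ <-; rewrite cImD. Qed.

Lemma cnorm_cis t : cnorm (cis t) = 1.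
Proof. by rewrite /= cos2Dsin2 sqrtr1. Qed.

Lemma cis0 : cis (0 : R) = 1.
Proof. by rewrite /cis cos0 sin0. Qed.

Lemma cisD t u : cis (t + u) = cis t * cis u.
Proof.
rewrite /cis cosD sinD; apply/eqP; rewrite eq_complex /=.
by rewrite (addrC (sin t * cos u)) !eqxx.
Qed.

Lemma cis_sum (I : Type) (s : seq I) (P : pred I) (F : I -> R) :
  cis (\sum_(i <- s | P i) F i) = \prod_(i <- s | P i) cis (F i).
Proof. by elim/big_rec2: _ => [|i x y _ <-]; rewrite ?cis0 ?cisD. Qed.

End complex_facts.

Section complex_integral.
Context d (T : measurableType d) (R : realType).
Implicit Types (f g : T -> R[i]) (mu : {measure set T -> \bar R}).

Definition cmeasurable f :=
  measurable_fun setT (fun x => cRe (f x)) /\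
  measurable_fun setT (fun x => cIm (f x)).

Lemma cmeasurable_cst z : cmeasurable (fun _ => z).
Proof. by split; exact: measurable_cst. Qed.

Lemma cmeasurableD f g : cmeasurable f -> cmeasurable g ->
  cmeasurable (fun x => f x + g x).
Proof.
move=> [f1 f2] [g1 g2]; split.
  by under eq_fun do rewrite cReD; exact: measurable_funD.
by under eq_fun do rewrite cImD; exact: measurable_funD.
Qed.

Lemma cmeasurableM f g : cmeasurable f -> cmeasurable g ->
  cmeasurable (fun x => f x * g x).
Proof.
move=> [f1 f2] [g1 g2]; split.
  under eq_fun do rewrite cReM.
  by apply: measurable_funB; exact: measurable_funM.
under eq_fun do rewrite cImM.
by apply: measurable_funD; exact: measurable_funM.
Qed.

Lemma cmeasurable_sum (I : Type) (s : seq I) (P : pred I) (F : I -> T -> R[i]) :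
  (forall i, P i -> cmeasurable (F i)) ->
  cmeasurable (fun x => \sum_(i <- s | P i) F i x).
Proof.
move=> mF; elim: s => [|i s ih].
  by under eq_fun do rewrite big_nil; exact: cmeasurable_cst.
under eq_fun do rewrite big_cons.
by case Pi: (P i); [apply: cmeasurableD => //; exact: mF|].
Qed.

Lemma cmeasurable_real (u : T -> R) : measurable_fun setT u ->
  cmeasurable (fun x => (u x)%:C).
Proof. by move=> mu_; split => //; exact: measurable_cst. Qed.

Lemma cmeasurable_cis (u : T -> R) : measurable_fun setT u ->
  cmeasurable (fun x => cis (u x)).
Proof.
move=> mu_; split => /=.
- apply: (measurableT_comp (f := @cos R)) => //.
  by apply: continuous_measurable_fun; exact: continuous_cos.
- apply: (measurableT_comp (f := @sin R)) => //.
  by apply: continuous_measurable_fun; exact: continuous_sin.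
Qed.

Lemma measurable_cnorm f : cmeasurable f -> measurable_fun setT (fun x => cnorm (f x)).
Proof.
move=> [f1 f2].
rewrite (_ : (fun _ => _) =
  (fun x => Num.sqrt ((cRe (f x)) ^+ 2 + (cIm (f x)) ^+ 2))); last first.
  by apply/funext => x; case: (f x).
apply: (measurableT_comp (f := @Num.sqrt R)); first last.
  by apply: measurable_funD; exact: measurable_funX.
by apply: continuous_measurable_fun; exact: sqrt_continuous.
Qed.

Definition cintegrable mu f :=
  mu.-integrable setT (EFin \o (fun x => cRe (f x))) /\
  mu.-integrable setT (EFin \o (fun x => cIm (f x))).

Definition cint mu f : R[i] :=
  Rintegral mu setT (fun x => cRe (f x)) +i* Rintegral mu setT (fun x => cIm (f x)).

Lemma le_cintegrable mu f (u : T -> R) : cmeasurable f ->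
  (forall x, cnorm (f x) <= u x) -> mu.-integrable setT (EFin \o u) ->
  cintegrable mu f.
Proof.
move=> [f1 f2] fu iu; split; apply: le_integrable iu => //;
  try exact/measurable_EFinP; move=> x _ /=; rewrite lee_fin;
  apply: le_trans (le_trans (fu x) (ler_norm _)).
- exact: norm_cRe_le.
- exact: norm_cIm_le.
Qed.

Variable mu : {measure set T -> \bar R}.

Lemma cintegrable_measurable f : cintegrable mu f -> cmeasurable f.
Proof.
by case=> i1 i2; split; apply/measurable_EFinP; [exact: measurable_int i1|
  exact: measurable_int i2].
Qed.

Lemma eq_cint f g : f =1 g -> cint mu f = cint mu g.
Proof. by move=> /funext ->. Qed.

Lemma cintegrableD f g : cintegrable mu f -> cintegrable mu g ->
  cintegrable mu (fun x => f x + g x).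
Proof.
move=> [f1 f2] [g1 g2]; split.
  by under [X in EFin \o X]eq_fun do rewrite cReD; exact: integrableD_EFin.
by under [X in EFin \o X]eq_fun do rewrite cImD; exact: integrableD_EFin.
Qed.

Lemma cintD f g : cintegrable mu f -> cintegrable mu g ->
  cint mu (fun x => f x + g x) = cint mu f + cint mu g.
Proof.
move=> [f1 f2] [g1 g2]; rewrite /cint.
rewrite -[RHS]/((_ + _) +i* (_ + _)).
congr (_ +i* _); rewrite -RintegralD//; apply: eq_Rintegral => x _.
- exact: cReD.
- exact: cImD.
Qed.

Lemma cintegrableZ (z : R[i]) f : cintegrable mu f -> cintegrable mu (fun x => z * f x).
Proof.
move=> [f1 f2]; split.
  under [X in EFin \o X]eq_fun do rewrite cReM -mulNr.
  by apply: integrableD_EFin; exact: integrableZl_EFin.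
under [X in EFin \o X]eq_fun do rewrite cImM.
by apply: integrableD_EFin; exact: integrableZl_EFin.
Qed.

Lemma cintZ (z : R[i]) f : cintegrable mu f -> cint mu (fun x => z * f x) = z * cint mu f.
Proof.
move=> [f1 f2]; case: z => a b; rewrite /cint.
rewrite -[RHS]/((a * _ - b * _) +i* (a * _ + b * _)).
congr (_ +i* _).
  under eq_Rintegral do rewrite cReM.
  by rewrite RintegralB ?RintegralZl//; exact: integrableZl_EFin.
under eq_Rintegral do rewrite cImM.
by rewrite RintegralD ?RintegralZl//; exact: integrableZl_EFin.
Qed.

Lemma cintegrable0 : cintegrable mu (fun _ => 0).
Proof. by split; exact: integrable0. Qed.

Lemma cint0 : cint mu (fun _ => 0) = 0.
Proof. by rewrite /cint !Rintegral_cst//= !mul0r. Qed.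

Lemma cintegrable_sum (I : Type) (s : seq I) (F : I -> T -> R[i]) :
  (forall i, cintegrable mu (F i)) ->
  cintegrable mu (fun x => \sum_(i <- s) F i x).
Proof.
move=> iF; elim: s => [|i s ih].
  by under eq_fun do rewrite big_nil; exact: cintegrable0.
by under eq_fun do rewrite big_cons; exact: cintegrableD.
Qed.

Lemma cint_sum (I : Type) (s : seq I) (F : I -> T -> R[i]) :
  (forall i, cintegrable mu (F i)) ->
  cint mu (fun x => \sum_(i <- s) F i x) = \sum_(i <- s) cint mu (F i).
Proof.
move=> iF; elim: s => [|i s ih].
  by rewrite big_nil (eq_cint (g := fun _ => 0)) ?cint0// => x; rewrite big_nil.
rewrite big_cons -ih -cintD//; last exact: cintegrable_sum.
by apply: eq_cint => x; rewrite big_cons.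
Qed.

(** The factor 2 replaces the rotation argument for the sharp inequality; only
    the order of magnitude matters below. *)
Lemma cnorm_cint_le f (u : T -> R) : cintegrable mu f ->
  mu.-integrable setT (EFin \o u) -> (forall x, cnorm (f x) <= u x) ->
  cnorm (cint mu f) <= 2 * Rintegral mu setT u.
Proof.
move=> [f1 f2] iu fu; rewrite (le_trans (cnorm_le _))//= mulr_natl mulr2n.
have h (v : T -> R) : mu.-integrable setT (EFin \o v) ->
    (forall x, `|v x| <= u x) -> `|Rintegral mu setT v| <= Rintegral mu setT u.
  move=> iv vu; rewrite (le_trans (le_normr_Rintegral _ iv))//.
  apply: le_Rintegral => //.
  by rewrite (_ : _ \o _ = abse \o (EFin \o v))//; exact: integrable_abse.
apply: lerD; apply: h => // x; apply: le_trans (fu x).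
- exact: norm_cRe_le.
- exact: norm_cIm_le.
Qed.

End complex_integral.

Arguments cintegrable {d T R} mu f.
Arguments cint {d T R} mu f.

(** * Fubini, products and Gaussians in several variables *)

Section fubini.
Context d1 d2 (T1 : measurableType d1) (T2 : measurableType d2) (R : realType).
Variable m1 : {sigma_finite_measure set T1 -> \bar R}.
Variable m2 : {sigma_finite_measure set T2 -> \bar R}.
Local Notation m12 := (m1 \x m2)%E.

Lemma Rintegral_fubini (f : T1 * T2 -> R) : m12.-integrable setT (EFin \o f) ->
  (forall y, m1.-integrable setT (EFin \o (fun x => f (x, y)))) ->
  Rintegral m2 setT (fun y => Rintegral m1 setT (fun x => f (x, y))) =
  Rintegral m12 setT f.
Proof.
move=> iF iy; congr fine; rewrite -(integral21_prod_meas1 iF).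
apply: eq_integral => y _; rewrite /Rintegral fineK//.
by apply: integrable_fin_num; [exact: measurableT|exact: iy].
Qed.

(** The section hypothesis makes the inner integral finite everywhere, so
    that taking real values under the outer integral loses nothing. *)
Lemma cint_fubini (f : T1 * T2 -> R[i]) : cintegrable m12 f ->
  (forall y, cintegrable m1 (fun x => f (x, y))) ->
  cint m2 (fun y => cint m1 (fun x => f (x, y))) = cint m12 f.
Proof.
move=> [f1 f2] fy; rewrite /cint/=; congr (_ +i* _).
- by apply: (Rintegral_fubini f1) => y; have [] := fy y.
- by apply: (Rintegral_fubini f2) => y; have [] := fy y.
Qed.

Lemma integrable_prodM (u : T1 -> R) (v : T2 -> R) :
  m1.-integrable setT (EFin \o u) -> m2.-integrable setT (EFin \o v) ->
  m12.-integrable setT (EFin \o (fun z => u z.1 * v z.2)).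
Proof.
move=> iu iv.
have mu_ : measurable_fun setT u by apply/measurable_EFinP; exact: measurable_int iu.
have mv_ : measurable_fun setT v by apply/measurable_EFinP; exact: measurable_int iv.
have mf : measurable_fun setT (EFin \o (fun z : T1 * T2 => u z.1 * v z.2)).
  apply/measurable_EFinP; apply: measurable_funM.
  - exact: (measurableT_comp mu_ measurable_fst).
  - exact: (measurableT_comp mv_ measurable_snd).
apply/(integrable12ltyP m1 m2 mf) => /=.
under eq_integral do under eq_integral do rewrite normrM EFinM.
under eq_integral => x _.
  rewrite ge0_integralZl_EFin//; last first.
    by apply/measurable_EFinP; exact: measurableT_comp.
  over.
rewrite ge0_integralZr//.
- case/integrableP : iu => _ iu; case/integrableP : iv => _ iv.
  by apply: lte_mul_pinfty => //; [exact: integral_ge0|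
    rewrite ge0_fin_numE//; exact: integral_ge0].
- by apply/measurable_EFinP; exact: measurableT_comp.
- exact: integral_ge0.
Qed.

Lemma cintegrable_prodM (u : T1 -> R[i]) (v : T2 -> R[i]) :
  cintegrable m1 u -> cintegrable m2 v ->
  cintegrable m12 (fun z => u z.1 * v z.2).
Proof.
move=> [u1 u2] [v1 v2]; split.
- under [X in EFin \o X]eq_fun do rewrite cReM -mulN1r.
  by apply: integrableD_EFin; [|apply: integrableZl_EFin];
    exact: (@integrable_prodM (fun x => _ (u x)) (fun x => _ (v x))).
- under [X in EFin \o X]eq_fun do rewrite cImM.
  by apply: integrableD_EFin;
    exact: (@integrable_prodM (fun x => _ (u x)) (fun x => _ (v x))).
Qed.

Lemma cint_prodM (u : T1 -> R[i]) (v : T2 -> R[i]) :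
  cintegrable m1 u -> cintegrable m2 v ->
  cint m12 (fun z => u z.1 * v z.2) = cint m1 u * cint m2 v.
Proof.
move=> iu iv; rewrite -cint_fubini/=; first last.
- move=> y; under eq_fun do rewrite mulrC; exact: cintegrableZ.
- exact: cintegrable_prodM.
rewrite -cintZ//; apply: eq_cint => y; rewrite mulrC -cintZ//.
by apply: eq_cint => x; rewrite mulrC.
Qed.

End fubini.

Section pushforward.
Context d1 d2 (T1 : measurableType d1) (T2 : measurableType d2) (R : realType).
Variables (mu : {measure set T1 -> \bar R}) (nu : {measure set T2 -> \bar R}).
Variable phi : T1 -> T2.
Hypothesis mphi : measurable_fun setT phi.
Hypothesis nuE : forall A, measurable A -> nu A = mu (phi @^-1` A).

Lemma ge0_integral_image (f : T2 -> \bar R) : measurable_fun setT f ->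
  (forall y, (0 <= f y)%E) -> (\int[nu]_y f y = \int[mu]_x f (phi x))%E.
Proof.
move=> mf f0; rewrite (eq_measure_integral (pushforward mu phi)); last first.
  by move=> A mA _; exact: nuE.
by rewrite ge0_integral_pushforward.
Qed.

Lemma integrable_image (f : T2 -> \bar R) : measurable_fun setT f ->
  nu.-integrable setT f <-> mu.-integrable setT (f \o phi).
Proof.
move=> mf; split => /integrableP[_ h]; apply/integrableP; split => //.
- exact: measurableT_comp.
- by move: h; rewrite ge0_integral_image//; exact: measurableT_comp.
- by rewrite ge0_integral_image//; exact: measurableT_comp.
Qed.

Lemma Rintegral_image (f : T2 -> R) : measurable_fun setT f ->
  Rintegral nu setT f = Rintegral mu setT (f \o phi).
Proof.
move=> /measurable_EFinP mf; rewrite /Rintegral integralE [in RHS]integralE.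
congr (fine (_ - _)).
- rewrite ge0_integral_image//; last exact: measurable_funepos.
  by apply: eq_integral => x _; rewrite !funeposE.
- rewrite ge0_integral_image//; last exact: measurable_funeneg.
  by apply: eq_integral => x _; rewrite !funenegE.
Qed.

Lemma cintegrable_image (f : T2 -> R[i]) : cmeasurable f ->
  cintegrable nu f <-> cintegrable mu (f \o phi).
Proof.
move=> [/measurable_EFinP f1 /measurable_EFinP f2].
split=> -[i1 i2]; split.
- exact: ((integrable_image f1).1 i1).
- exact: ((integrable_image f2).1 i2).
- exact: ((integrable_image f1).2 i1).
- exact: ((integrable_image f2).2 i2).
Qed.

Lemma cint_image (f : T2 -> R[i]) : cmeasurable f ->
  cint nu f = cint mu (f \o phi).
Proof. by move=> [f1 f2]; rewrite /cint !Rintegral_image. Qed.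

End pushforward.

Lemma lebesgue_rVS (R : realType) n (A : set 'rV[R]_n.+1) : measurable A ->
  lebesgue_rV R n.+1 A =
  (@lebesgue_measure R \x lebesgue_rV R n)%E (@rV_cons R n @^-1` A).
Proof. by []. Qed.

Lemma cmeasurable_comp d1 d2 (T1 : measurableType d1) (T2 : measurableType d2)
    (R : realType) (f : T2 -> R[i]) (phi : T1 -> T2) :
  cmeasurable f -> measurable_fun setT phi -> cmeasurable (f \o phi).
Proof.
move=> [f1 f2] mphi; split.
- exact: (measurableT_comp f1 mphi).
- exact: (measurableT_comp f2 mphi).
Qed.

Lemma cmeasurable_prod d1 (T1 : measurableType d1) (R : realType) (I : Type)
    (s : seq I) (P : pred I) (F : I -> T1 -> R[i]) :
  (forall i, P i -> cmeasurable (F i)) ->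
  cmeasurable (fun x => \prod_(i <- s | P i) F i x).
Proof.
move=> mF; elim: s => [|i s ih].
  by under eq_fun do rewrite big_nil; exact: cmeasurable_cst.
under eq_fun do rewrite big_cons.
by case Pi: (P i); [apply: cmeasurableM => //; exact: mF|].
Qed.

(** Integrals of products of functions of one coordinate each factor; this
    reduces Gaussians on the space to Gaussians on the line. *)
Lemma cint_rV_prod (R : realType) n (u : 'I_n -> measurableTypeR R -> R[i]) :
  (forall i, cintegrable (@lebesgue_measure R) (u i)) ->
  cintegrable (lebesgue_rV R n) (fun x => \prod_(i < n) u i (x 0 i)) /\
  cint (lebesgue_rV R n) (fun x => \prod_(i < n) u i (x 0 i)) =
  \prod_(i < n) cint (@lebesgue_measure R) (u i).
Proof.
elim: n u => [|n IHn] u iu.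
  have -> : (fun x : 'rV[R]_0 => \prod_(i < 0) u i (x 0 i)) = fun _ => 1.
    by apply/funext => x; rewrite big_ord0.
  have i1 : (lebesgue_rV R 0).-integrable setT (EFin \o cst (1 : R)).
    apply/integrableP; split; first exact/measurable_EFinP/measurable_cst.
    by rewrite /= integral_dirac//= diracE mem_set// mul1e normr1 ltry.
  split.
    by split => //; exact: integrable0.
  rewrite big_ord0 /cint /Rintegral /= !integral_dirac//=. 
  by rewrite indicE mem_set// mul1r mulr0.
have mu_ : cmeasurable (fun x : 'rV[R]_n.+1 => \prod_(i < n.+1) u i (x 0 i)).
  apply: cmeasurable_prod => i _.
  apply: (cmeasurable_comp (cintegrable_measurable (iu i))).
  exact: measurable_rV_coord.
have [iv ev] := IHn (fun i => u (lift ord0 i)) (fun i => iu _).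
have fE : (fun x : 'rV[R]_n.+1 => \prod_(i < n.+1) u i (x 0 i)) \o @rV_cons R n =
    fun z => u ord0 z.1 * \prod_(i < n) u (lift ord0 i) (z.2 0 i).
  apply/funext => z; rewrite /= big_ord_recl rV_cons0; congr (_ * _).
  by apply: eq_bigr => i _; rewrite rV_consS.
split.
  apply/(cintegrable_image (measurable_rV_cons (n := n)) (@lebesgue_rVS R n)) => //.
  rewrite fE; exact: (cintegrable_prodM (iu _) iv).
rewrite (cint_image (measurable_rV_cons (n := n)) (@lebesgue_rVS R n))// fE.
by rewrite (cint_prodM (iu _) iv) ev big_ord_recl.
Qed.

Section gaussian_rV.
Context (R : realType).

Lemma fourier_gauss_line_cis (c b v : R) : 0 < c ->
  let f (x : measurableTypeR R) :=
    (expR (- (c * (x - b) ^+ 2)))%:C * cis (x * v) in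
  cintegrable (@lebesgue_measure R) f /\
  cint (@lebesgue_measure R) f =
  (Num.sqrt (pi / c) * expR (- (v ^+ 2 / (4 * c))))%:C * cis (b * v).
Proof.
move=> c0 f.
have fRe x : cRe (f x) =
    expR (- (c * (x - b) ^+ 2)) * cos ((x - b) * v + b * v).
  by rewrite cReM /= mul0r subr0 -mulrDl subrK.
have fIm x : cIm (f x) =
    expR (- (c * (x - b) ^+ 2)) * cos ((x - b) * v + (b * v - pi / 2)).
  rewrite cImM /= mul0r addr0 addrA -mulrDl subrK; congr (_ * _).
  by rewrite cosB cos_pihalf sin_pihalf mulr0 add0r mulr1.
split.
  split.
    by under [X in EFin \o X]eq_fun do rewrite fRe; exact: integrable_gauss_cos.
  by under [X in EFin \o X]eq_fun do rewrite fIm; exact: integrable_gauss_cos.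
apply/eqP; rewrite eq_complex; apply/andP; split; apply/eqP.
  rewrite cReM /= mul0r subr0 -(fourier_gauss_line b _ _ c0).
  by apply: eq_Rintegral => x _; exact: fRe.
rewrite cImM /= mul0r addr0.
have -> : sin (b * v) = cos (b * v - pi / 2).
  by rewrite cosB cos_pihalf sin_pihalf mulr0 add0r mulr1.
rewrite -(fourier_gauss_line b _ _ c0).
by apply: eq_Rintegral => x _; exact: fIm.
Qed.

Context (n : nat).
Implicit Types (b x w : 'rV[R]_n) (s : R).

Definition gaussian s b x := expR (- (pi * s ^+ 2 * \sum_(i < n) (x 0 i - b 0 i) ^+ 2)).

Lemma gaussian_ge0 s b x : 0 <= gaussian s b x. Proof. exact: expR_ge0. Qed.

Lemma gaussian_le1 s b x : gaussian s b x <= 1.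
Proof.
rewrite -[leRHS]expR0 ler_expR oppr_le0; apply: mulr_ge0.
  by apply: mulr_ge0; [exact: pi_ge0|exact: sqr_ge0].
by apply: sumr_ge0 => i _; exact: sqr_ge0.
Qed.

Lemma measurable_dotrV w : measurable_fun setT (fun x : 'rV[R]_n => dotrV x w).
Proof.
rewrite /dotrV; apply: measurable_sum => i.
by apply: measurable_funM => //; exact: measurable_rV_coord.
Qed.

Lemma measurable_gaussian s b : measurable_fun setT (gaussian s b).
Proof.
apply: measurableT_comp => //; apply: measurableT_comp => //.
apply: measurable_funM => //; apply: measurable_sum => i.
by apply: measurable_funX; apply: measurable_funB => //; exact: measurable_rV_coord.
Qed.

Lemma dotrVDl x y w : dotrV (x + y) w = dotrV x w + dotrV y w.
Proof. by rewrite -big_split; apply: eq_bigr => i _; rewrite mxE mulrDl. Qed.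

Lemma dotrVDr x y w : dotrV w (x + y) = dotrV w x + dotrV w y.
Proof. by rewrite -big_split; apply: eq_bigr => i _; rewrite mxE mulrDr. Qed.

Lemma dotrVZr (k : R) x w : dotrV x (k *: w) = k * dotrV x w.
Proof. by rewrite /dotrV mulr_sumr; apply: eq_bigr => i _; rewrite mxE mulrCA. Qed.

Lemma dotrVZl (k : R) x w : dotrV (k *: x) w = k * dotrV x w.
Proof. by rewrite /dotrV mulr_sumr; apply: eq_bigr => i _; rewrite mxE mulrA. Qed.

Lemma dotrVC x w : dotrV x w = dotrV w x.
Proof. by apply: eq_bigr => i _; rewrite mulrC. Qed.

Lemma dotrVNl x w : dotrV (- x) w = - dotrV x w.
Proof. by rewrite -scaleN1r dotrVZl mulN1r. Qed.

(** A Gaussian wave is a product of waves on the line, coordinate by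
    coordinate. *)
Lemma fourier_gaussian s b w : 0 < s ->
  let f x := (gaussian s b x)%:C * cis (2 * pi * dotrV x w) in
  cintegrable (lebesgue_rV R n) f /\
  cint (lebesgue_rV R n) f =
  (s ^- n * gaussian s^-1 0 w)%:C * cis (2 * pi * dotrV b w).
Proof.
move=> s0 f.
have pi0 : (pi : R) != 0 by rewrite gt_eqF// pi_gt0.
have sn0 : s != 0 by rewrite gt_eqF.
have c0 : 0 < pi * s ^+ 2 by rewrite mulr_gt0 ?pi_gt0// exprn_gt0.
pose u i (t : measurableTypeR R) : R[i] :=
  (expR (- (pi * s ^+ 2 * (t - b 0 i) ^+ 2)))%:C * cis (t * (2 * pi * w 0 i)).
have uP i := fourier_gauss_line_cis (b 0 i) (2 * pi * w 0 i) c0.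
have -> : f = fun x => \prod_(i < n) u i (x 0 i).
  apply/funext => x; rewrite /f /u big_split /= -cis_sum; congr (_ * cis _).
    by rewrite /gaussian mulr_sumr -sumrN expR_sum rmorph_prod.
  by rewrite mulr_sumr; apply: eq_bigr => i _; ring.
have [iu ->] := cint_rV_prod (fun i => (uP i).1).
split => //.
rewrite (eq_bigr _ (fun i _ => (uP i).2)) big_split /= -cis_sum; congr (_ * cis _).
  rewrite -rmorph_prod/= big_split/= prodr_const card_ord; congr ((_ * _)%:C).
    rewrite (_ : pi / _ = s^-1 ^+ 2); last first.
      by move: (pi : R) pi0 => P P0; field; rewrite ?P0 ?sn0.
    by rewrite sqrtr_sqr ger0_norm ?invr_ge0 ?ltW// exprVn.
  rewrite -expR_sum /gaussian; congr expR.
  rewrite mulr_sumr -sumrN; apply: eq_bigr => i _; rewrite mxE subr0.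
  by move: (pi : R) pi0 => P P0; field; rewrite ?P0 ?sn0.
by rewrite mulr_sumr; apply: eq_bigr => i _; ring.
Qed.

End gaussian_rV.

(** * Schwartz functions of Gaussian type *)

Section gauss_trig.
Context (R : realType) (d : nat).
Local Notation E := 'rV[R]_d.
Implicit Types (u : E -> R) (x v w : E) (i : 'I_d).

(** A directional derivative depends only on the restriction to a line. *)
Lemma is_derive_line u x v l :
  is_derive (0 : R) 1 (fun h => u (h *: v + x)) l -> is_derive x v u l.
Proof.
have e : (fun h : R => h^-1 *: ((u \o shift x) (h *: v) - u x)) =
    (fun h => h^-1 *: (((fun h => u (h *: v + x)) \o shift 0) (h *: (1 : R)) -
      u (0 *: v + x))).
  by apply/funext => h /=; rewrite (_ : h%:A = h) ?addr0 ?scale0r ?add0r//; exact: mulr1.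
by move=> [d1 d2]; split; rewrite /derivable /derive e.
Qed.

(** Polynomials times a fixed Gaussian times plane waves: a class of functions
    stable under partial derivatives, which makes it a class of Schwartz
    functions. *)
Inductive gauss_trig (s : R) : (E -> R) -> Prop :=
| gauss_trig_wave v t : gauss_trig s (fun x => gaussian s 0 x * cos (dotrV x v + t))
| gauss_trig_coord i u : gauss_trig s u -> gauss_trig s (fun x => x 0 i * u x)
| gauss_trig_add u1 u2 : gauss_trig s u1 -> gauss_trig s u2 ->
    gauss_trig s (fun x => u1 x + u2 x)
| gauss_trig_scale (k : R) u : gauss_trig s u -> gauss_trig s (fun x => k * u x).

Lemma continuous_sum_ord n (F : 'I_n -> E -> R) : (forall k, continuous (F k)) ->
  continuous (fun x => \sum_(k < n) F k x).
Proof.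
move=> cF; elim: n F cF => [|n ih] F cF.
  have -> : (fun x => \sum_(k < 0) F k x) = cst 0.
    by apply/funext => y; rewrite big_ord0.
  exact: cst_continuous.
have -> : (fun x => \sum_(k < n.+1) F k x) =
    fun x => F ord0 x + \sum_(k < n) F (lift ord0 k) x.
  by apply/funext => y; rewrite big_ord_recl.
by move=> x; apply: continuousD; [exact: cF|apply: ih => i; exact: cF].
Qed.

Lemma continuous_gaussian s (b : E) : continuous (gaussian s b).
Proof.
move=> x; apply: (@continuous_comp _ _ _
  (fun x : E => - (pi * s ^+ 2 * \sum_(i < d) (x 0 i - b 0 i) ^+ 2)) expR);
  last exact: continuous_expR.
apply: continuousN; apply: continuousM; first exact: cst_continuous.
apply: continuous_sum_ord => i y.
have cy : {for y, continuous (fun z : E => z 0 i - b 0 i)}.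
  by apply: continuousB; [exact: coord_continuous|exact: cst_continuous].
have -> : (fun z : E => (z 0 i - b 0 i) ^+ 2) =
  (fun z : E => (z 0 i - b 0 i) * (z 0 i - b 0 i)) by [].
exact: (continuousM cy cy).
Qed.

Lemma continuous_dotrV v : continuous (fun x : E => dotrV x v).
Proof.
apply: continuous_sum_ord => i x; apply: continuousM; last exact: cst_continuous.
exact: coord_continuous.
Qed.

Lemma gauss_trig_continuous s u : gauss_trig s u -> continuous u.
Proof.
elim=> [v t|i {}u _ cu|u1 u2 _ c1 _ c2|k {}u _ cu] x.
- apply: continuousM; first exact: continuous_gaussian.
  apply: (@continuous_comp _ _ _ (fun x => dotrV x v + t) cos);
    last exact: continuous_cos.
  by apply: continuousD; [exact: continuous_dotrV|exact: cst_continuous].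
- by apply: continuousM; [exact: coord_continuous|exact: cu].
- by apply: continuousD; [exact: c1|exact: c2].
- by apply: continuousM; [exact: cst_continuous|exact: cu].
Qed.

Lemma is_derive_coord i j x : is_derive x (delta_mx 0 i) (fun x : E => x 0 j) (j == i)%:R.
Proof.
apply: is_derive_line; rewrite (_ : (fun _ => _) = fun h : R => h * (j == i)%:R + x 0 j).
  have := @is_derive_affine R id (j == i)%:R (x 0 j) 0 1 (is_derive_id _ _).
  by rewrite mul1r.
by apply/funext => h; rewrite !mxE eqxx.
Qed.

(** The derivative of the cosine is again a cosine with a shifted phase, which
    keeps the class of functions above closed under derivation. *)
Lemma is_derive_wave s v t i x :
  is_derive x (delta_mx 0 i) (fun x => gaussian s 0 x * cos (dotrV x v + t))
    (- (2 * pi * s ^+ 2) * (x 0 i * (gaussian s 0 x * cos (dotrV x v + t)))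
     + v 0 i * (gaussian s 0 x * cos (dotrV x v + (t + pi / 2)))).
Proof.
apply: is_derive_line.
set c := pi * s ^+ 2.
have dE (h : R) : dotrV (h *: delta_mx 0 i + x) v + t = h * v 0 i + (dotrV x v + t).
  rewrite dotrVDl dotrVZl addrA; congr (h * _ + _ + _).
  rewrite /dotrV (bigD1 i)//= big1 ?addr0 => [|j ji].
    by rewrite mxE !eqxx mul1r.
  by rewrite mxE (negbTE ji) andbF mul0r.
have gE (h : R) : gaussian s 0 (h *: delta_mx 0 i + x) =
    expR (- (c * (h + x 0 i) ^+ 2)) * expR (- (c * \sum_(j < d | j != i) x 0 j ^+ 2)).
  rewrite -expRD /gaussian -/c (bigD1 i)//= !mxE !eqxx/= mulr1 subr0.
  rewrite mulrDr opprD; congr (expR (_ - c * _)).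
  by apply: eq_bigr => j ji; rewrite !mxE (negbTE ji) andbF mulr0 add0r subr0.
have g0 : gaussian s 0 x =
    expR (- (c * (x 0 i) ^+ 2)) * expR (- (c * \sum_(j < d | j != i) x 0 j ^+ 2)).
  by have := gE 0; rewrite scale0r !add0r.
rewrite (_ : (fun _ => _) = ((fun h : R => expR (- (c * (h + x 0 i) ^+ 2)) *
    expR (- (c * \sum_(j < d | j != i) x 0 j ^+ 2))) *
    (fun h : R => cos (h * v 0 i + (dotrV x v + t))))); last first.
  by apply/funext => h; rewrite gE dE.
set K := expR (- (c * \sum_(j < d | j != i) _)).
have dc := @is_derive_affine R cos (v 0 i) (dotrV x v + t) 0 _ (is_derive_cos _).
have dg : is_derive (0 : R) 1 (fun h : R => expR (- (c * (h + x 0 i) ^+ 2)) * K)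
    (expR (- (c * (x 0 i) ^+ 2)) * - (c * (2 * x 0 i)) * K).
  have d1 : is_derive (0 : R) 1 (fun h : R => expR (- (c * (h + x 0 i) ^+ 2)))
      (expR (- (c * (0 + x 0 i) ^+ 2)) * - (c * (2 * x 0 i))).
    apply: (@is_derive1_comp _ expR (fun h => - (c * (h + x 0 i) ^+ 2))).
    by apply: is_derive_eq; rewrite /GRing.scale/=; ring.
  rewrite add0r in d1.
  apply: (is_derive_eq (is_deriveM d1 (is_derive_cst K _ _))).
  by rewrite /GRing.scale/= mulr0 add0r mulrC.
apply: (is_derive_eq (is_deriveM dg dc)).
rewrite /GRing.scale/= !add0r mul0r add0r (addrA (dotrV x v)) [cos (_ + pi / 2)]cosD cos_pihalf sin_pihalf g0 -/K.
by rewrite /c; ring.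
Qed.

Lemma gauss_trig_derive s i u : gauss_trig s u ->
  exists u', gauss_trig s u' /\ forall x, is_derive x (delta_mx 0 i) u (u' x).
Proof.
elim=> [v t|j {}u gu [u' [gu' du]]|u1 u2 _ [u1' [g1 d1]] _ [u2' [g2 d2]]|
  k {}u _ [u' [gu' du]]].
- exists (fun x => - (2 * pi * s ^+ 2) * (x 0 i * (gaussian s 0 x * cos (dotrV x v + t)))
     + v 0 i * (gaussian s 0 x * cos (dotrV x v + (t + pi / 2)))).
  split; last exact: is_derive_wave.
  apply: gauss_trig_add; apply: gauss_trig_scale; last exact: gauss_trig_wave.
  by apply: gauss_trig_coord; exact: gauss_trig_wave.
- exists (fun x => x 0 j * u' x + (j == i)%:R * u x); split.
    apply: gauss_trig_add; first exact: gauss_trig_coord.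
    exact: gauss_trig_scale.
  move=> x; apply: (is_derive_eq (is_deriveM (is_derive_coord i j x) (du x))).
  by rewrite /GRing.scale/= (mulrC (u x)).
- exists (fun x => u1' x + u2' x); split; first exact: gauss_trig_add.
  by move=> x; exact: is_deriveD.
- exists (fun x => k * u' x); split; first exact: gauss_trig_scale.
  by move=> x; exact: (is_deriveZ k (du x)).
Qed.

(** One term of the exponential series already dominates the power. *)
Lemma expXn_gauss_le (c : R) (k : nat) : 0 < c ->
  exists M : R, forall y : R, `|y ^+ k * expR (- (c * y ^+ 2))| <= M.
Proof.
move=> c0; exists (1 + k`!%:R / c ^+ k) => y.
rewrite normrM (ger0_norm (expR_ge0 _)) expRN ler_pdivrMr ?expR_gt0//.
rewrite normrX.
have yk : `|y| ^+ k <= 1 + (y ^+ 2) ^+ k.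
  have -> : (y ^+ 2) ^+ k = (`|y| ^+ k) ^+ 2.
    by rewrite -exprM mulnC exprM -normrX real_normK ?num_real// -!exprM mulnC.
  by move: (`|y| ^+ k) => w; have := sqr_ge0 (w - 1); nra.
apply: (le_trans yk).
have y2 : 0 <= c * y ^+ 2 by rewrite mulr_ge0 ?sqr_ge0// ltW.
have e1 : 1 <= expR (c * y ^+ 2) by rewrite -expR0 ler_expR.
have e2 : (c * y ^+ 2) ^+ k / k`!%:R <= expR (c * y ^+ 2).
  case: k yk => [|k _]; first by rewrite expr0 fact0 divr1.
  by rewrite (le_trans _ (expR_ge1Dxn k y2))// lerDr.
rewrite mulrDl mul1r; apply: lerD => //.
rewrite -(@ler_pM2l _ (c ^+ k / k`!%:R)); last first.
  by rewrite divr_gt0// ?exprn_gt0// ltr0n fact_gt0.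
have f0 : (k`!%:R : R) != 0 by rewrite pnatr_eq0 -lt0n fact_gt0.
have ck0 : c ^+ k != 0 by rewrite expf_neq0// gt_eqF.
have -> : c ^+ k / k`!%:R * (k`!%:R / c ^+ k * expR (c * y ^+ 2)) = expR (c * y ^+ 2).
  by field; rewrite f0 ck0.
by rewrite mulrAC -exprMn.
Qed.

Lemma gauss_trig_bounded s u : 0 < s -> gauss_trig s u ->
  forall a : 'I_d -> nat,
  exists M : R, forall x, `|(\prod_(i < d) x 0 i ^+ a i) * u x| <= M.
Proof.
move=> s0; elim=> [v t|j {}u _ bu|u1 u2 _ b1 _ b2|k {}u _ bu] a.
- have c0 : 0 < pi * s ^+ 2 by rewrite mulr_gt0 ?pi_gt0// exprn_gt0.
  have /choice[M MP] := fun i => expXn_gauss_le (a i) c0.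
  exists (\prod_(i < d) M i) => x.
  rewrite mulrA normrM.
  apply: (@le_trans _ _ (`|(\prod_(i < d) x 0 i ^+ a i) * gaussian s 0 x|)).
    by rewrite ler_piMr// cos_max.
  rewrite /gaussian mulr_sumr -sumrN expR_sum -big_split/= normr_prod.
  apply: ler_prod => i _; rewrite normr_ge0/= mxE subr0; exact: MP.
- have [M MP] := bu (fun i => (a i + (i == j))%N); exists M => x.
  apply: le_trans (MP x); rewrite mulrA le_eqVlt; apply/orP; left; apply/eqP.
  congr (`|_ * _|).
  rewrite [in RHS](bigD1 j)//= eqxx addn1 exprSr.
  rewrite [in LHS](bigD1 j)//= -!mulrA; congr (_ * _); rewrite mulrC; congr (_ * _).
  by apply: eq_bigr => i /negbTE ->; rewrite addn0.
- have [M1 M1P] := b1 a; have [M2 M2P] := b2 a; exists (M1 + M2) => x.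
  by rewrite mulrDr (le_trans (ler_normD _ _))// lerD.
- have [M MP] := bu a; exists (`|k| * M) => x.
  by rewrite mulrCA normrM ler_wpM2l.
Qed.

Lemma gauss_trig_partials s u (l : seq 'I_d) : gauss_trig s u ->
  gauss_trig s (partials l u).
Proof.
move=> gu; elim: l => //= i l ih.
have [u' [gu' du']] := gauss_trig_derive i ih.
by rewrite (_ : (fun _ => _) = u')//; apply/funext => x; exact: derive_val.
Qed.

Lemma gauss_trig_schwartz s u : 0 < s -> gauss_trig s u -> schwartz_real u.
Proof.
move=> s0 gu; split.
  move=> l; split; first exact: gauss_trig_continuous (gauss_trig_partials l gu).
  move=> i x; have [u' [_ du']] := gauss_trig_derive i (gauss_trig_partials l gu).
  exact: ex_derive.
move=> a l; exact: gauss_trig_bounded s0 (gauss_trig_partials l gu) a.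
Qed.

Lemma gauss_trig_sum s (I : Type) (r : seq I) (F : I -> E -> R) :
  (forall k, gauss_trig s (F k)) -> gauss_trig s (fun x => \sum_(k <- r) F k x).
Proof.
move=> gF; elim: r => [|k r ih].
  rewrite (_ : (fun _ => _) = fun x => 0 * (gaussian s 0 x * cos (dotrV x 0 + 0))).
    by apply: gauss_trig_scale; exact: gauss_trig_wave.
  by apply/funext => x; rewrite big_nil mul0r.
rewrite (_ : (fun _ => _) = fun x => F k x + \sum_(k <- r) F k x).
  exact: gauss_trig_add.
by apply/funext => x; rewrite big_cons.
Qed.

Lemma schwartz_gauss_trig s (I : Type) (r : seq I) (a : I -> R[i]) (w : I -> E) :
  0 < s ->
  schwartz (fun x => (gaussian s 0 x)%:C *
    \sum_(k <- r) a k * cis (2 * pi * dotrV x (w k))).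
Proof.
move=> s0.
have wave k (p : R) : gauss_trig s (fun x =>
    gaussian s 0 x * cos (2 * pi * dotrV x (w k) + p)).
  under eq_fun do rewrite -dotrVZr; exact: gauss_trig_wave.
split; apply: (gauss_trig_schwartz s0).
- rewrite (_ : (fun _ => _) = fun x => \sum_(k <- r)
    (cRe (a k) * (gaussian s 0 x * cos (2 * pi * dotrV x (w k) + 0)) +
     cIm (a k) * (gaussian s 0 x * cos (2 * pi * dotrV x (w k) + pi / 2)))).
    by apply: gauss_trig_sum => k; apply: gauss_trig_add; apply: gauss_trig_scale;
      exact: wave.
  apply/funext => x; rewrite cReM /= mul0r subr0 cRe_sum mulr_sumr.
  apply: eq_bigr => k _; rewrite cReM /= addr0 cosD cos_pihalf sin_pihalf.
  by ring.
- rewrite (_ : (fun _ => _) = fun x => \sum_(k <- r)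
    (cIm (a k) * (gaussian s 0 x * cos (2 * pi * dotrV x (w k) + 0)) +
     (- cRe (a k)) * (gaussian s 0 x * cos (2 * pi * dotrV x (w k) + pi / 2)))).
    by apply: gauss_trig_sum => k; apply: gauss_trig_add; apply: gauss_trig_scale;
      exact: wave.
  apply/funext => x; rewrite cImM /= mul0r addr0 cIm_sum mulr_sumr.
  apply: eq_bigr => k _; rewrite cImM /= addr0 cosD cos_pihalf sin_pihalf.
  by ring.
Qed.

End gauss_trig.

(** * Continuity of translations in measure *)

Section translation_continuity.
Context (R : realType) (d : nat).
Local Notation E := 'rV[R]_d.
Local Notation mu := (lebesgue_rV R d).
Implicit Types (x y s t : E) (A B : set E).
Local Open Scope ereal_scope.

Definition cube (r : R) : set E := [set x | forall i, (`|x 0 i| <= r)%R].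

Lemma measurable_cube r : measurable (cube r).
Proof.
rewrite (_ : cube r = [set x | forall i, `[(- r)%R, r]%classic (x 0%R i)]).
  apply: (@measurable_rV_box _ _ (fun=> `[(- r)%R, r]%classic)) => i.
  exact: measurable_itv.
by apply/seteqP; split => x /= h i; have := h i; rewrite in_itv/= ler_norml.
Qed.

Lemma measurable_slab (i : 'I_d) (a w : R) :
  measurable [set x : E | (`|x 0%R i - a| <= w)%R].
Proof.
rewrite (_ : [set _ | _] = @rV_coord R d i @^-1` `[(a - w)%R, (a + w)%R]).
  rewrite -[X in measurable X]setTI; apply: measurable_rV_coord; first exact: measurableT.
  exact: measurable_itv.
by apply/seteqP; split => x /=; rewrite in_itv/= -ler_distl.
Qed.

Lemma lebesgue_rV_slab (r a w : R) (i : 'I_d) : (0 < r)%R -> (0 <= w)%R ->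
  mu (cube r `&` [set x | (`|x 0 i - a| <= w)%R]) <=
  (2 * w * (2 * r) ^+ d.-1)%:E.
Proof.
move=> r0 w0.
pose A (j : 'I_d) : set (measurableTypeR R) :=
  if j == i then `[(a - w)%R, (a + w)%R]%classic else `[(- r)%R, r]%classic.
have mA j : measurable (A j) by rewrite /A; case: ifP => _; exact: measurable_itv.
apply: (@le_trans _ _ (mu [set x | forall j, A j (x 0%R j)])).
  apply: le_measure; rewrite ?inE.
  - by apply: measurableI; [exact: measurable_cube|exact: measurable_slab].
  - exact: measurable_rV_box.
  - move=> x [/= h1 h2] j; rewrite /A; case: eqP => [->|_] /=; rewrite in_itv/=.
      by rewrite -ler_distl.
    by rewrite -ler_norml.
rewrite lebesgue_rV_box// (bigD1 i)//= {1}/A eqxx lebesgue_measure_itv/= lte_fin.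
have -> : (if (a - w < a + w)%R then (a + w)%:E - (a - w)%:E else 0) = (2 * w)%:E.
  case: ifPn => h; first by rewrite -EFinB; congr EFin; ring.
  by congr EFin; move: h; rewrite -leNgt; lra.
rewrite (eq_bigr (fun=> (2 * r)%:E)); last first.
  move=> j ji; rewrite /A (negbTE ji) lebesgue_measure_itv/= lte_fin gtrN// -EFinB.
  by congr EFin; ring.
rewrite prodEFin prodr_const -EFinM lee_fin.
by rewrite (_ : #|[pred j | j != i]| = d.-1)// (cardC1 i) card_ord.
Qed.

Lemma cubeS r r' : (r <= r')%R -> cube r `<=` cube r'.
Proof. by move=> rr x xr i; exact: le_trans (xr i) rr. Qed.

Lemma lebesgue_rV_cube (r : R) : (0 < r)%R -> mu (cube r) = ((2 * r) ^+ d)%:E.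
Proof.
move=> r0; rewrite (_ : cube r = [set x | forall i, `[(- r)%R, r]%classic (x 0%R i)]).
  rewrite (@lebesgue_rV_box _ _ (fun=> `[(- r)%R, r]%classic)) => [|i]; last first.
    exact: measurable_itv.
  rewrite (eq_bigr (fun=> (2 * r)%:E)) => [|i _].
    by rewrite prodEFin prodr_const card_ord.
  rewrite lebesgue_measure_itv/= lte_fin gtrN// -EFinB.
  by congr EFin; ring.
by apply/seteqP; split => x /= h i; have := h i; rewrite in_itv/= ler_norml.
Qed.

Variables (y : E) (c : R).
Hypothesis c0 : c != 0%R.

(** The affine parametrization by c and t makes a single statement serve for
    every term of a progression, with the step t as the variable. *)
Definition flips A s : set E :=
  [set t | ~ (A (y + c *: t)%R <-> A (y + s + c *: t)%R)].

Lemma measurable_affine (b : E) A : measurable A ->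
  measurable [set t | A (b + c *: t)%R].
Proof.
move=> mA; rewrite -[X in measurable X]setTI.
apply: (@measurable_rV_pair _ _ _ d (cst b) (fun t => c *: t)%R) => //.
apply/measurable_fun_rVP => i.
rewrite (_ : _ \o _ = fun t : E => (c * rV_coord i t)%R); last first.
  by apply/funext => t; rewrite /rV_coord/= mxE.
by apply: measurable_funM => //; exact: measurable_rV_coord.
Qed.

Lemma measurable_flips A s : measurable A -> measurable (flips A s).
Proof.
move=> mA.
have m1 := measurable_affine y mA; have m2 := measurable_affine (y + s) mA.
rewrite (_ : flips A s =
  ([set t | A (y + c *: t)%R] `\` [set t | A (y + s + c *: t)%R]) `|`
  ([set t | A (y + s + c *: t)%R] `\` [set t | A (y + c *: t)%R])).
  by apply: measurableU; exact: measurableD.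
apply/seteqP; split => t /=; rewrite /flips/=; last by tauto.
by move=> h; have [] := pselect (A (y + c *: t)%R);
  have [] := pselect (A (y + s + c *: t)%R); tauto.
Qed.

Let good A := measurable A /\ forall r e : R, (0 < r)%R -> (0 < e)%R ->
  exists2 w : R, (0 < w)%R & forall s, cube w s -> mu (cube r `&` flips A s) <= e%:E.

Let mcf r A s : measurable A -> measurable (cube r `&` flips A s).
Proof. by move=> mA; apply: measurableI; [exact: measurable_cube|exact: measurable_flips]. Qed.

Let goodC A : good A -> good (~` A).
Proof.
move=> [mA gA]; split; first exact: measurableC.
move=> r e r0 e0; have [w w0 h] := gA r e r0 e0; exists w => // s sw.
rewrite (_ : flips (~` A) s = flips A s); first exact: h.
apply/seteqP; split => t; rewrite /flips/=; first by tauto.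
by have [] := pselect (A (y + c *: t)%R);
  have [] := pselect (A (y + s + c *: t)%R); tauto.
Qed.

Let goodU A B : good A -> good B -> good (A `|` B).
Proof.
move=> [mA gA] [mB gB]; split; first exact: measurableU.
move=> r e r0 e0.
have e20 : (0 < e / 2)%R by rewrite divr_gt0.
have [w1 w10 h1] := gA r _ r0 e20; have [w2 w20 h2] := gB r _ r0 e20.
exists (Num.min w1 w2); first by rewrite lt_min w10.
move=> s sw.
have sw1 : cube w1 s by apply: cubeS sw; rewrite ge_min lexx.
have sw2 : cube w2 s by apply: cubeS sw; rewrite ge_min lexx orbT.
rewrite [leRHS](_ : _ = (e / 2)%:E + (e / 2)%:E); last by rewrite -EFinD -splitr.
apply: le_trans (leeD (h1 s sw1) (h2 s sw2)).
apply: le_trans (measureU2 _ (mcf r s mA) (mcf r s mB)).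
apply: le_measure; rewrite ?inE; [apply: mcf; exact: measurableU|
  by apply: measurableU; exact: mcf|].
move=> t [rt h].
have [fA|nfA] := pselect (flips A s t); first by left.
have [fB|nfB] := pselect (flips B s t); first by right.
exfalso; apply: h => /=; rewrite /setU/=.
have eA := contrapT nfA; have eB := contrapT nfB.
by tauto.
Qed.

Let good0 : good set0.
Proof.
split => // r e r0 e0; exists 1%R => // s _.
rewrite (_ : flips _ _ = set0) ?setI0 ?measure0 ?lee_fin ?ltW//.
by apply/seteqP; split => t //=; rewrite /flips/=; tauto.
Qed.

Let good_bigcup (A : nat -> set E) : (forall k, good (A k)) -> good (\bigcup_k A k).
Proof.
move=> gA.
have mA k : measurable (A k) by have [] := gA k.
have mU : measurable (\bigcup_k A k) by exact: bigcupT_measurable.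
split => // r e r0 e0.
pose B n := \big[setU/set0]_(k < n) A k.
have gB n : good (B n) 
  by apply: (big_ind good) => [|A1 A2|k _]; [exact: good0|exact: goodU|exact: gA].
pose D n := (\bigcup_k A k) `\` B n.
have mB n : measurable (B n) by case: (gB n).
have mD n : measurable (D n) by exact: measurableD.
pose D' n := cube (r + 1) `&` [set t | D n (y + c *: t)%R].
have mD' n : measurable (D' n).
  by apply: measurableI; [exact: measurable_cube|exact: measurable_affine].
have r10 : (0 < r + 1)%R by rewrite addr_gt0.
have e40 : (0 < e / 4)%R by rewrite divr_gt0.
have [n Dn] : exists n, mu (D' n) <= (e / 4)%:E.
  have cD : mu (D' n) @[n --> \oo] --> mu (\bigcap_n D' n).
    apply: nonincreasing_cvg_mu => //.
    - apply: (@le_lt_trans _ _ (mu (cube (r + 1)))).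
        apply: le_measure; rewrite ?inE//; first exact: measurable_cube.
        exact: subIsetl.
      by rewrite lebesgue_rV_cube// ltry.
    - exact: bigcapT_measurable.
    - move=> m n mn; apply/subsetPset; apply: setIS => t [/= h nB]; split => //.
      by apply: contra_not nB; exact: subset_bigsetU.
  have cap0 : \bigcap_n D' n = set0.
    apply/seteqP; split => t // h.
    have [_ [[k _ Ak] _]] := h 0%N I; have [_ [_ nB]] := h k.+1 I.
    by apply: nB; rewrite /B big_ord_recr/=; right.
  rewrite cap0 measure0 in cD.
  have /fine_cvgP[_ /cvgrPdist_le /(_ _ e40)] := cD.
  have := cD => /fine_cvgP[[N1 _ fN]] _ [N2 _ hN].
  exists (maxn N1 N2).
  have := hN _ (leq_maxr N1 N2); rewrite /= sub0r normrN ger0_norm ?fine_ge0// => h.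
  by rewrite -[leLHS]fineK ?lee_fin//; apply: fN; exact: leq_maxl.
have [w w0 hw] := (gB n).2 r (e / 2)%R r0 (divr_gt0 e0 (ltr0n _ 2)).
exists (Num.min w `|c|%R); first by rewrite lt_min w0 normr_gt0.
move=> s sw.
have sw1 : cube w s by apply: cubeS sw; rewrite ge_min lexx.
have sc : cube `|c| s by apply: cubeS sw; rewrite ge_min lexx orbT.
pose sh t := (t + c^-1 *: s)%R.
have msh : measurable (sh @^-1` D' n).
  rewrite -[X in measurable X]setTI.
  exact: (@measurable_rV_pair _ _ _ d id (cst (c^-1 *: s)%R)).
have -> : e%:E = (e / 2)%:E + ((e / 4)%:E + (e / 4)%:E).
  by rewrite -!EFinD; congr EFin; field.
have h3 : mu (sh @^-1` D' n) <= (e / 4)%:E by rewrite lebesgue_rV_translate.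
apply: le_trans (leeD (hw s sw1) (leeD Dn h3)).
apply: le_trans (leeD (lexx _) (measureU2 _ (mD' n) msh)).
apply: le_trans (measureU2 _ (mcf r s (mB n)) (measurableU _ _ (mD' n) msh)).
apply: le_measure; rewrite ?inE; [exact: mcf|
  by apply: measurableU; [exact: mcf|exact: measurableU]|].
move=> t [rt ft].
have sBA : B n `<=` \bigcup_k A k.
  by rewrite /B => z; rewrite -bigcup_mkord => -[k _ Ak]; exists k.
have rt1 : cube (r + 1) t by apply: cubeS rt; rewrite lerDl.
have rt2 : cube (r + 1) (sh t).
  move=> i; rewrite !mxE (le_trans (ler_normD _ _))// lerD//.
  by rewrite normrM normfV ler_pdivrMl ?normr_gt0// mulr1.
have shE : (y + c *: sh t = y + s + c *: t)%R.
  by rewrite /sh scalerDr scalerA divff// scale1r (addrC (c *: t)%R) addrA.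
have [fB|nfB] := pselect (flips (B n) s t); [by left|right].
have [A1|nA1] := pselect ((\bigcup_k A k) (y + c *: t)%R);
  have [A2|nA2] := pselect ((\bigcup_k A k) (y + s + c *: t)%R).
- by exfalso; apply: ft.
- left; split => //; split => // B1; apply: nA2; apply: sBA.
  by apply: contrapT => nB2; apply: nfB; rewrite /flips/=; tauto.
- right; split => //=; rewrite /D/= shE; split => // B2; apply: nA1; apply: sBA.
  by apply: contrapT => nB1; apply: nfB; rewrite /flips/=; tauto.
- by exfalso; apply: ft.
Qed.

Let good_coord (i : 'I_d) (Y : set (measurableTypeR R)) : measurable Y ->
  good (@rV_coord R d i @^-1` Y).
Proof.
have mcoord (Z : set (measurableTypeR R)) : measurable Z ->
    measurable (@rV_coord R d i @^-1` Z).
  by move=> mZ; rewrite -[X in measurable X]setTI; exact: measurable_rV_coord.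
suff h : (measurable : set (set (measurableTypeR R))) `<=`
    [set Y | good (@rV_coord R d i @^-1` Y)] by exact: h.
apply: smallest_sub.
  split => /=.
  - by rewrite preimage_set0.
  - by move=> Z gZ; rewrite setTD preimage_setC; exact: goodC.
  - by move=> F gF; rewrite preimage_bigcup; exact: good_bigcup.
move=> _ [[a b] _ <-] /=; split; first by apply: mcoord; exact: measurable_itv.
move=> r e r0 e0.
pose K := ((2 * r) ^+ d.-1)%R.
have K0 : (0 < K)%R by rewrite exprn_gt0// mulr_gt0.
pose w := (e * `|c| / (4 * K))%R.
have w0 : (0 < w)%R by rewrite divr_gt0// mulr_gt0// normr_gt0.
exists w => // s sw.
have wc0 : (0 <= w / `|c|)%R by rewrite divr_ge0// ltW.
pose S u := cube r `&` [set t : E | (`|t 0 i - (u - y 0 i) / c| <= w / `|c|)%R].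
have mS u : measurable (S u).
  by apply: measurableI; [exact: measurable_cube|exact: measurable_slab].
have eE : e%:E = (2 * (w / `|c|) * K)%:E + (2 * (w / `|c|) * K)%:E.
  rewrite -EFinD; congr EFin; rewrite /w; field.
  by rewrite normr_eq0 c0 gt_eqF.
rewrite eE.
apply: le_trans (leeD (lebesgue_rV_slab ((a - y 0 i) / c)%R i r0 wc0)
  (lebesgue_rV_slab ((b - y 0 i) / c)%R i r0 wc0)).
apply: le_trans (measureU2 _ (mS a) (mS b)).
apply: le_measure; rewrite ?inE; [apply: mcf; apply: mcoord; exact: measurable_itv|
  exact: measurableU|].
move=> t [rt]; rewrite /flips /= /rV_coord !in_itv/= !mxE => ft.
have cut u : ((u < y 0 i + c * t 0 i)%R = (u < y 0 i + s 0 i + c * t 0 i)%R) \/ S u t.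
  have [h|h] := boolP (`|u - (y 0 i + c * t 0 i)| <= w)%R.
    right; split => //=; rewrite -(@ler_pM2l _ `|c|%R) ?normr_gt0//.
    rewrite -normrM mulrCA divff ?normr_eq0// mulr1.
    rewrite (_ : c * _ = - (u - (y 0 i + c * t 0 i)))%R ?normrN//.
    by field.
  left; move: h; rewrite -ltNge lter_normr => /orP h.
  have := sw i; rewrite ler_norml => /andP[h1 h2].
  by case: h => h; apply/idP/idP => h'; lra.
have [ea|] := cut a; last by left.
have [eb|] := cut b; last by right.
exfalso; apply: ft; rewrite ea !leNgt eb; tauto.
Qed.

(** The sets with this property form a sigma-algebra. A countable union is
    approximated on a larger cube by finite ones, and an interval in one
    coordinate changes only on two thin slabs. *)
Lemma translation_continuity A r e : measurable A -> (0 < r)%R -> (0 < e)%R ->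
  exists2 w : R, (0 < w)%R & forall s, cube w s -> mu (cube r `&` flips A s) <= e%:E.
Proof.
move=> mA; suff : good A by case=> _; exact.
have h : (measurable : set (set E)) `<=` good.
  apply: smallest_sub.
    split; [exact: good0|by move=> B gB; rewrite setTD; exact: goodC|].
    exact: good_bigcup.
  rewrite -bigcup_seq/= => _ [i _ [Y mY <-]]; rewrite setTI; exact: good_coord.
exact: h.
Qed.

End translation_continuity.

(** * Prescribed patterns on arithmetic progressions *)

Section product_positivity.
Context d1 d2 (T1 : measurableType d1) (T2 : measurableType d2) (R : realType).
Variable m1 : {sigma_finite_measure set T1 -> \bar R}.
Variable m2 : {sigma_finite_measure set T2 -> \bar R}.
Local Open Scope ereal_scope.

Lemma product_measure_ysection (W : set (T1 * T2)) : measurable W ->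
  (m1 \x m2) W = \int[m2]_y m1 [set x | W (x, y)].
Proof.
move=> mW.
rewrite (@product_measure_unique _ _ _ _ _ m1 m2 (m1 \x^ m2)%E)//; last first.
  by move=> A B mA mB; exact: product_measure2E.
apply: eq_integral => y _ /=; congr (m1 _).
by apply/seteqP; split => x; rewrite /ysection/= inE.
Qed.

Lemma product_measure_xsection (W : set (T1 * T2)) : measurable W ->
  (m1 \x m2) W = \int[m1]_x m2 [set y | W (x, y)].
Proof.
move=> mW; apply: eq_integral => x _ /=; congr (m2 _).
by apply/seteqP; split => y; rewrite /xsection/= inE.
Qed.

Lemma measurable_ysec (W : set (T1 * T2)) (y : T2) : measurable W ->
  measurable [set x | W (x, y)].
Proof.
move=> /(measurable_ysection y); congr (measurable _).
by apply/seteqP; split => x; rewrite /ysection/= inE.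
Qed.

Lemma measurable_xsec (W : set (T1 * T2)) (x : T1) : measurable W ->
  measurable [set y | W (x, y)].
Proof.
move=> /(measurable_xsection x); congr (measurable _).
by apply/seteqP; split => y; rewrite /xsection/= inE.
Qed.

Lemma measurable_fun_ysec (W : set (T1 * T2)) : measurable W ->
  measurable_fun setT (fun y => m1 [set x | W (x, y)]).
Proof.
move=> mW; have := measurable_fun_ysection m1 mW; congr (measurable_fun _ _).
apply/funext => y /=; congr (m1 _).
by apply/seteqP; split => x; rewrite /ysection/= inE.
Qed.

Lemma measurable_fun_xsec (W : set (T1 * T2)) : measurable W ->
  measurable_fun setT (fun x => m2 [set y | W (x, y)]).
Proof.
move=> mW; have := measurable_fun_xsection m2 mW; congr (measurable_fun _ _).
apply/funext => x /=; congr (m2 _).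
by apply/seteqP; split => y; rewrite /xsection/= inE.
Qed.

End product_positivity.

Lemma integral_gt0_set d (T : measurableType d) (R : realType)
    (m : {measure set T -> \bar R}) (f : T -> \bar R) (B : set T) :
  measurable B -> (0 < m B)%E -> measurable_fun setT f ->
  (forall x, (0 <= f x)%E) -> (forall x, B x -> (0 < f x)%E) ->
  (0 < \int[m]_x f x)%E.
Proof.
move=> mB mB0 mf f0 fB; rewrite lt0e integral_ge0// andbT.
apply/eqP => h.
have : (\int[m]_x `|f x|)%E = 0%E.
  by rewrite -h; apply: eq_integral => x _; rewrite gee0_abs.
move/(ae_eq_integral_abs m measurableT mf) => [N [mN N0 hN]].
have BN : B `<=` N.
  by move=> x Bx; apply: hN => /= /(_ I) fx0; have := fB _ Bx; rewrite fx0 ltxx.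
have : (m B <= m N)%E by apply: le_measure; rewrite ?inE.
by rewrite N0 leNgt mB0.
Qed.

Lemma integral_gt0_ex d (T : measurableType d) (R : realType)
    (m : {measure set T -> \bar R}) (f : T -> \bar R) :
  (0 < \int[m]_x f x)%E -> (forall x, (0 <= f x)%E) ->
  exists x, (0 < f x)%E.
Proof.
move=> h f0; apply: contrapT => nex.
suff e : (\int[m]_x f x)%E = 0%E by rewrite e ltxx in h.
rewrite -[RHS](integral0 m setT); apply: eq_integral => x _.
apply/eqP; rewrite eq_le f0 andbT leNgt; apply/negP => fx; apply: nex.
by exists x.
Qed.

Section pattern.
Context (R : realType) (d : nat).
Local Notation E := 'rV[R]_d.
Local Notation mu := (lebesgue_rV R d).
Implicit Types (a x y s t : E) (A B : set E) (I J : seq int) (S : int -> set E).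
Local Open Scope ereal_scope.

Lemma measure_gt0_cube A : measurable A -> 0 < mu A ->
  exists2 r : R, (0 < r)%R & 0 < mu (cube r `&` A).
Proof.
move=> mA A0; apply: contrapT => h.
have h0 n : mu (cube n.+1%:R `&` A) = 0.
  apply/eqP; rewrite eq_le measure_ge0 andbT leNgt; apply/negP => h1; apply: h.
  by exists n.+1%:R.
suff : mu.-negligible A by move/measure_negligible => /(_ mA) e; rewrite e ltxx in A0.
rewrite (_ : A = \bigcup_n (cube n.+1%:R `&` A)).
  apply: negligible_bigcup => n; apply/negligibleP; last exact: h0.
  by apply: measurableI => //; exact: measurable_cube.
apply/seteqP; split => [x Ax|x [n _ []]//].
exists (Num.truncn (\sum_(i < d) `|x 0%R i|)%R) => //; split => // i.
apply: (@le_trans _ _ (\sum_(i < d) `|x 0%R i|)%R); last first.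
  by apply/ltW; rewrite truncnS_gt.
by rewrite (bigD1 i)//= lerDl sumr_ge0.
Qed.

Lemma measurable_pat d1 (T : measurableType d1) J (A : int -> set T) :
  (forall i, measurable (A i)) -> measurable [set t | forall i, i \in J -> A i t].
Proof.
move=> mA; elim: J => [|j J ih].
  by rewrite (_ : [set _ | _] = setT)//; apply/seteqP; split.
rewrite (_ : [set _ | _] = A j `&` [set t | forall i, i \in J -> A i t]).
  exact: measurableI.
apply/seteqP; split => [t h|t [h1 h2] i].
  by split; [apply: h; rewrite mem_head|move=> i iJ; apply: h; rewrite inE iJ orbT].
by rewrite inE => /predU1P[->//|]; exact: h2.
Qed.

(** Translation continuity at all the terms of the progression at once; the
    exceptional sets add up. *)
Lemma small_flips J S (c v : int -> R) (y : E) (r e : R) :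
  (forall i, measurable (S i)) -> (forall i, i \in J -> c i != 0%R) ->
  (0 < r)%R -> (0 < e)%R ->
  exists2 w : R, (0 < w)%R & forall s, cube w s ->
    exists N : set E, [/\ measurable N, mu (cube r `&` N) <= e%:E &
      forall i t, i \in J -> ~ N t ->
        (S i (y + c i *: t)%R <-> S i (y + v i *: s + c i *: t)%R)].
Proof.
move=> mS c0 r0; elim: J c0 e => [|j J ih] c0 e e0.
  exists 1%R => // s _; exists set0; split => //.
  by rewrite setI0 measure0 lee_fin ltW.
have e20 : (0 < e / 2)%R by rewrite divr_gt0.
have cJ i : i \in J -> c i != 0%R by move=> iJ; apply: c0; rewrite inE iJ orbT.
have cj : c j != 0%R by apply: c0; rewrite mem_head.
have [w1 w10 h1] := ih cJ _ e20.
have [w2 w20 h2] := translation_continuity y cj (mS j) r0 e20.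
have v0 : (0 < 1 + `|v j|)%R by rewrite ltr_pwDl.
exists (Num.min w1 (w2 / (1 + `|v j|)))%R.
  by rewrite lt_min w10 divr_gt0.
move=> s sw.
have sw1 : cube w1 s by apply: cubeS sw; rewrite ge_min lexx.
have sw2 : cube (w2 / (1 + `|v j|)) s by apply: cubeS sw; rewrite ge_min lexx orbT.
have sw2' : cube w2 (v j *: s).
  move=> i; rewrite mxE normrM.
  have := sw2 i; rewrite ler_pdivlMr// mulrC; apply: le_trans.
  by rewrite ler_wpM2r// lerDr.
have [N [mN N1 hN]] := h1 s sw1.
have mf : measurable (flips y (c j) (S j) (v j *: s)).
  exact: measurable_flips.
exists (N `|` flips y (c j) (S j) (v j *: s)); split.
- exact: measurableU.
- rewrite setIUr [leRHS](_ : _ = (e / 2)%:E + (e / 2)%:E); last by rewrite -EFinD -splitr.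
  apply: le_trans (leeD N1 (h2 _ sw2')).
  by apply: measureU2; apply: measurableI => //; exact: measurable_cube.
- move=> i t; rewrite inE => /predU1P[->|iJ] nt.
    by apply: contrapT => nf; apply: nt; right.
  by apply: hN => // Nt; apply: nt; left.
Qed.

(** Positivity of the measure of a finite pattern is an open condition on the
    base point, since translations are continuous in measure. *)
Lemma pat_stable J S (c v : int -> R) (y : E) :
  (forall i, measurable (S i)) -> (forall i, i \in J -> c i != 0%R) ->
  0 < mu [set t | forall i, i \in J -> S i (y + c i *: t)%R] ->
  exists2 w : R, (0 < w)%R & forall s, cube w s ->
    0 < mu [set t | forall i, i \in J -> S i (y + v i *: s + c i *: t)%R].
Proof.
move=> mS c0 V0.
have mV s : measurable [set t | forall i, i \in J -> S i (y + v i *: s + c i *: t)%R].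
  by apply: (@measurable_pat _ _ J (fun i => [set t | S i (y + v i *: s + c i *: t)%R]))
    => i; exact: measurable_affine.
have mV0 : measurable [set t | forall i, i \in J -> S i (y + c i *: t)%R].
  by apply: (@measurable_pat _ _ J (fun i => [set t | S i (y + c i *: t)%R]))
    => i; exact: measurable_affine.
have [r r0 rV0] := measure_gt0_cube mV0 V0.
set V := [set t | _] in V0 mV0 rV0 *.
have finV : mu (cube r `&` V) \is a fin_num.
  rewrite ge0_fin_numE//; apply: (@le_lt_trans _ _ (mu (cube r))).
    apply: le_measure; rewrite ?inE; last exact: subIsetl.
      by apply: measurableI => //; exact: measurable_cube.
    exact: measurable_cube.
  by rewrite lebesgue_rV_cube// ltry.
pose m := fine (mu (cube r `&` V)).
have m0 : (0 < m)%R by rewrite fine_gt0// rV0 ltey_eq finV.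
have [w w0 hw] := @small_flips J S c v y r (m / 2)%R mS c0 r0 (divr_gt0 m0 (ltr0n _ 2)).
exists w => // s sw; have [N [mN Ne hN]] := hw s sw.
rewrite lt0e measure_ge0 andbT; apply/eqP => V's0.
set V' := [set t | _] in V's0.
have mcN : measurable (cube r `&` N) by apply: measurableI => //; exact: measurable_cube.
have : mu (cube r `&` V) <= mu (V' `|` (cube r `&` N)).
  apply: le_measure; rewrite ?inE.
  - by apply: measurableI => //; exact: measurable_cube.
  - by apply: measurableU => //; exact: mV.
  - move=> t [rt Vt]; have [Nt|nNt] := pselect (N t); first by right.
    by left => i iJ; apply/(hN i t iJ nNt); exact: Vt.
rewrite leNgt => /negP; apply.
have h2 : mu (V' `|` (cube r `&` N)) <= mu V' + mu (cube r `&` N).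
  exact: (measureU2 _ (mV s) mcN).
rewrite V's0 add0e in h2; apply: (le_lt_trans h2); apply: (le_lt_trans Ne).
by rewrite -(fineK finV) lte_fin -/m ltr_pdivrMr// ltr_pMr// ltr1n.
Qed.

Definition pat I S (c : int -> R) : set (E * E) :=
  [set z | forall i, i \in I -> S i (z.1 + c i *: z.2)%R].

Lemma eq_pat I S S' c : (forall i, i \in I -> S i = S' i) -> pat I S c = pat I S' c.
Proof.
by move=> SS; apply/seteqP; split => z h i iI; have := h i iI; rewrite SS.
Qed.

Lemma measurable_patset I S c : (forall i, measurable (S i)) -> measurable (pat I S c).
Proof.
move=> mS.
apply: (@measurable_pat _ _ I (fun i => [set z : E * E | S i (z.1 + c i *: z.2)%R])) => i.
rewrite -[X in measurable X]setTI.
apply: (@measurable_rV_pair _ _ _ d fst (fun z : E * E => c i *: z.2)%R) => //.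
apply/measurable_fun_rVP => k.
rewrite (_ : _ \o _ = fun z : E * E => (c i * rV_coord k z.2)%R); last first.
  by apply/funext => t; rewrite /rV_coord/= mxE.
apply: measurable_funM => //.
exact: (measurableT_comp (measurable_rV_coord k) measurable_snd).
Qed.

(** Moving the base point of a progression along its step is a measure
    preserving shear. *)
Lemma pat_shear I S (k : R) c : (forall i, measurable (S i)) ->
  (mu \x mu) (pat I S (fun i => c i - k)%R) = (mu \x mu) (pat I S c).
Proof.
move=> mS.
rewrite !product_measure_ysection; try exact: measurable_patset.
apply: eq_integral => t _.
rewrite -[RHS](@lebesgue_rV_translate R d (- (k *: t))%R); last first.
  by apply: (measurable_ysec t (measurable_patset I c mS)).
congr (mu _); apply/seteqP; split => y /= h i iI; have := h i iI;
  by rewrite /= scalerBl addrA addrAC.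
Qed.

(** Induction on the holes hs. When the pattern has positive measure, the term y0
    that has to leave F can be fixed so that a set of steps t of positive measure
    remains; moving y0 slightly into H keeps the rest of the pattern for a set
    of steps of positive measure. *)
Lemma prescribed_pattern (F H : set E) (I hs : seq int) :
  measurable F -> measurable H -> 0 < mu F ->
  (forall y, F y -> forall w : R, (0 < w)%R ->
     0 < mu ([set x | cube w (x - y)%R] `&` H)) ->
  0 < (mu \x mu) (pat I (fun i => if i \in hs then H else F) intr).
Proof.
move=> mF mH F0 FH.
have mS (hs' : seq int) (i : int) : measurable (if i \in hs' then H else F) by case: ifP.
have mcube (y : E) (w : R) : measurable [set x | cube w (x - y)%R].
  rewrite -[X in measurable X]setTI.
  by apply: (@measurable_rV_pair _ _ _ d id (cst (- y)%R)) => //; exact: measurable_cube.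
elim: hs => [|j hs ih].
  have [|w w0 hw] := @pat_stable I (fun i => F) (fun=> 1%R) intr 0%R (fun=> mF)
    (fun i _ => oner_neq0 _).
    apply: (lt_le_trans F0); apply: le_measure; rewrite ?inE//.
      apply: (@measurable_pat _ _ I (fun i => [set t | F (0 + 1 *: t)%R])) => i.
      exact: measurable_affine.
    by move=> x Fx i _; rewrite add0r scale1r.
  have cw0 : 0 < mu (cube w).
    by rewrite lebesgue_rV_cube// lte_fin exprn_gt0// mulr_gt0.
  rewrite product_measure_ysection; last exact: measurable_patset.
  apply: (@integral_gt0_set _ _ _ _ _ (cube w)) => //.
  - exact: measurable_cube.
  - by apply: measurable_fun_ysec; exact: measurable_patset.
  - move=> t wt; have := hw t wt; congr (0 < mu _).
    apply/seteqP; split => x h i iI; have := h i iI => /=;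
      by rewrite ?in_nil add0r scale1r addrC.
have [jI|jI] := boolP (j \in I); last first.
  rewrite (@eq_pat I _ (fun i => if i \in hs then H else F))// => i iI.
  by rewrite inE; case: eqP => // ij; rewrite -ij iI in jI.
have [jhs|jhs] := boolP (j \in hs).
  rewrite (@eq_pat I _ (fun i => if i \in hs then H else F))// => i iI.
  by rewrite inE; case: eqP => // ->; rewrite jhs.
(* Seen from its j-th term y0 the progression keeps y0 fixed while t varies; the
   point y0 can then be traded for the nearby points of H. *)
move: ih; rewrite -(pat_shear I j%:~R _ (mS hs)) product_measure_xsection;
  last exact: measurable_patset.
move=> /integral_gt0_ex[//|y0 y0P].
have Fy0 : F y0.
  have [t0 ht0] : [set t | pat I (fun i => if i \in hs then H else F)
      (fun i => i%:~R - j%:~R)%R (y0, t)] !=set0.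
    by apply/set0P/eqP => e; rewrite e measure0 ltxx in y0P.
  by have := ht0 j jI; rewrite /= (negbTE jhs) subrr scale0r addr0.
pose J := [seq i <- I | i != j].
have JI i : i \in J = (i != j) && (i \in I) by rewrite mem_filter.
have cJ i : i \in J -> (i%:~R - j%:~R : R)%R != 0%R.
  by rewrite JI => /andP[ij _]; rewrite -rmorphB/= intr_eq0 subr_eq0.
have [|w w0 hw] := @pat_stable J _ (fun i => i%:~R - j%:~R)%R (fun=> 1%R) y0 (mS hs) cJ.
  apply: (lt_le_trans y0P); apply: le_measure; rewrite ?inE.
  - exact: (measurable_xsec y0 (measurable_patset I _ (mS hs))).
  - apply: (@measurable_pat _ _ J (fun i => [set t | (if i \in hs then H else F)
      (y0 + (i%:~R - j%:~R) *: t)%R])) => i.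
    exact: measurable_affine.
  - by move=> t ht i; rewrite JI => /andP[_ iI]; exact: ht.
rewrite -(pat_shear I j%:~R _ (mS (j :: hs))) product_measure_xsection;
  last exact: measurable_patset.
apply: (@integral_gt0_set _ _ _ _ _ ([set x | cube w (x - y0)%R] `&` H)) => //.
- exact: measurableI.
- exact: FH.
- by apply: measurable_fun_xsec; exact: measurable_patset.
- move=> y [yw Hy]; apply: (lt_le_trans (hw _ yw)).
  apply: le_measure; rewrite ?inE.
  - apply: (@measurable_pat _ _ J (fun i => [set t | (if i \in hs then H else F)
      (y0 + 1 *: (y - y0) + (i%:~R - j%:~R) *: t)%R])) => i.
    exact: measurable_affine.
  - exact: (measurable_xsec y (measurable_patset I _ (mS (j :: hs)))).
  - move=> t ht i iI /=; rewrite inE; case: eqP => [->|/eqP ij] /=.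
      by rewrite subrr scale0r addr0.
    have := ht i; rewrite JI ij iI => /(_ isT).
    by rewrite scale1r (addrC y0) subrK.
Qed.

End pattern.

(** * Gaussian averages at a generic point of a set *)

Section lebesgue_pair.
Context (R : realType) (d : nat).
Local Notation mu := (lebesgue_rV R d).

(** A name for the product measure, under which it is registered as
    sigma-finite, so that it can itself be a factor of a product measure. *)
Definition lebesgue_pair := (mu \x mu)%E.

Let lebesgue_pair_sigma_finite : sigma_finite setT lebesgue_pair.
Proof.
exists (fun n => cube n.+1%:R `*` cube n.+1%:R).
  apply/seteqP; split => // -[x y] _.
  exists (Num.truncn (\sum_(i < d) `|x 0 i| + \sum_(i < d) `|y 0 i|)) => //.
  have le (z : 'rV[R]_d) : (forall i, `|z 0 i| <= \sum_(i < d) `|z 0 i|).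
    by move=> i; rewrite (bigD1 i)//= lerDl sumr_ge0.
  split => i /=; apply/ltW; apply: le_lt_trans (truncnS_gt _).
    by rewrite (le_trans (le x i))// lerDl sumr_ge0.
  by rewrite (le_trans (le y i))// lerDr sumr_ge0.
move=> n; split; first by apply: measurableX; exact: measurable_cube.
rewrite /lebesgue_pair product_measure1E; [|exact: measurable_cube..].
by rewrite -[X in (X * X)%E]/(mu _) lebesgue_rV_cube// -EFinM ltry.
Qed.

HB.instance Definition _ := Measure.on lebesgue_pair.
HB.instance Definition _ := Measure_isSigmaFinite.Build _ _ _ lebesgue_pair
  lebesgue_pair_sigma_finite.

Lemma integral_lebesgue_pair (F : 'rV[R]_d * 'rV[R]_d -> \bar R) :
  (\int[lebesgue_pair]_z F z = \int[(mu \x mu)%E]_z F z)%E.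
Proof. by []. Qed.

End lebesgue_pair.
Arguments lebesgue_pair : clear implicits.

Section heat_kernel.
Context (R : realType) (d : nat).
Local Notation E := 'rV[R]_d.
Local Notation mu := (lebesgue_rV R d).
Local Notation mu2 := (lebesgue_pair R d).
Implicit Types (a b x y s t : E) (e v : R).

(** Gaussian of total mass 1 concentrated at scale e: the Fourier transform of
    a Gaussian of width 1/e. *)
Definition heat e b x := e ^- d * gaussian e^-1 b x.

Lemma heat_ge0 e b x : 0 < e -> 0 <= heat e b x.
Proof. by move=> e0; rewrite mulr_ge0 ?gaussian_ge0// invr_ge0 exprn_ge0// ltW. Qed.

Lemma measurable_heat e b : measurable_fun setT (heat e b).
Proof. by apply: measurable_funM => //; exact: measurable_gaussian. Qed.

Lemma integrable_gaussian v b : 0 < v ->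
  mu.-integrable setT (EFin \o gaussian v b).
Proof.
move=> v0; have [[i1 _] _] := fourier_gaussian b 0 v0.
move: i1; congr (_.-integrable _ _); apply/funext => x /=.
congr EFin; rewrite mul0r subr0 dotrVC.
by rewrite (_ : dotrV 0 x = 0) ?mulr0 ?cos0 ?mulr1// /dotrV big1// => i _; rewrite mxE mul0r.
Qed.

Lemma Rintegral_gaussian v b : 0 < v -> Rintegral mu setT (gaussian v b) = v ^- d.
Proof.
move=> v0; have [_ /(congr1 (@complex.Re R))] := fourier_gaussian b 0 v0.
have dv0 x : dotrV x (0 : E) = 0.
  by rewrite dotrVC /dotrV big1// => i _; rewrite mxE mul0r.
have g0 : gaussian v^-1 (0 : E) 0 = 1.
  rewrite /gaussian big1 ?mulr0 ?oppr0 ?expR0// => i _.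
  by rewrite mxE subr0 expr0n.
rewrite g0 dv0 mulr0 cReM /= cos0 sin0 !mulr1 mulr0 subr0 => <-.
apply: eq_Rintegral => x _.
by rewrite /= dv0 mulr0 cos0 mulr1 mul0r subr0.
Qed.

Lemma integral_heat e b : 0 < e -> (\int[mu]_x (heat e b x)%:E = 1)%E.
Proof.
move=> e0; have e10 : 0 < e^-1 by rewrite invr_gt0.
rewrite -(@fineK _ (\int[mu]_x _)); last first.
  by apply: integrable_fin_num => //; apply: integrableZl_EFin; exact: integrable_gaussian.
rewrite -[fine _]/(Rintegral mu setT (heat e b)) RintegralZl//.
  rewrite Rintegral_gaussian// exprVn invrK mulVf//.
  by rewrite gt_eqF// exprn_gt0.
exact: integrable_gaussian.
Qed.

Lemma gaussian_shift v b x : gaussian v 0 (x - b) = gaussian v b x.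
Proof.
by rewrite /gaussian; congr expR; congr (- (_ * _)); apply: eq_bigr => i _;
  rewrite !mxE subr0.
Qed.

Lemma gaussianC v b x : gaussian v b x = gaussian v x b.
Proof.
by rewrite /gaussian; congr expR; congr (- (_ * _)); apply: eq_bigr => i _;
  rewrite -sqrrN opprB.
Qed.

Lemma heat_shift e b c x : heat e (b + c) (x + c) = heat e b x.
Proof.
by rewrite /heat -gaussian_shift opprD addrACA subrr addr0 gaussian_shift.
Qed.

(** Away from the origin, the ratio of a heat kernel to the one of double
    width decays; a quadratic decay in e is all that is used. *)
Lemma heat_tail e r x : 0 < e -> 0 < r -> ~ cube r x ->
  heat e 0 x <= 2 ^+ d * (e / r) ^+ 2 * heat (2 * e) 0 x.
Proof.
move=> e0 r0 nx.
have [i xi] : exists i, r < `|x 0 i|.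
  apply: contrapT => h; apply: nx => i; rewrite leNgt; apply/negP => hi; apply: h.
  by exists i.
pose Q := \sum_(j < d) (x 0 j - (0 : E) 0 j) ^+ 2.
have Qr : r ^+ 2 <= Q.
  rewrite /Q (bigD1 i)//= mxE subr0 -(real_normK (num_real (x 0 i))).
  apply: (@le_trans _ _ (`|x 0 i| ^+ 2)).
    by rewrite ler_pXn2r ?nnegrE ?normr_ge0// ltW.
  by rewrite lerDl; apply: sumr_ge0 => j _; exact: sqr_ge0.
have gE : gaussian e^-1 0 x =
    gaussian (2 * e)^-1 0 x * expR (- (3 / 4 * pi * e^-1 ^+ 2 * Q)).
  rewrite /gaussian -/Q -expRD; congr expR; rewrite -/Q.
  by field; rewrite gt_eqF.
rewrite /heat gE; set G := gaussian (2 * e)^-1 0 x.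
have G0 : 0 <= G by exact: gaussian_ge0.
rewrite !exprMn invfM.
have -> : 2 ^+ d * (e ^+ 2 * r^-1 ^+ 2) * (2 ^- d * e ^- d * G) =
    e ^- d * (G * (e ^+ 2 * r^-1 ^+ 2)).
  have d0 : (2 : R) ^+ d != 0 by rewrite expf_neq0// pnatr_eq0.
  have e0' : e ^+ d != 0 by rewrite expf_neq0// gt_eqF.
  by field; rewrite d0 e0' gt_eqF.
rewrite -mulrA; apply: ler_wpM2l; first by rewrite invr_ge0 exprn_ge0// ltW.
apply: ler_wpM2l => //.
rewrite expRN -[leRHS]invrK lef_pV2 ?posrE ?expR_gt0 ?invr_gt0 ?mulr_gt0 ?exprn_gt0 ?invr_gt0//.
apply: le_trans (expR_ge1Dx _).
have -> : (e ^+ 2 * r^-1 ^+ 2)^-1 = e^-1 ^+ 2 * r ^+ 2.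
  by field; rewrite !gt_eqF.
rewrite (@le_trans _ _ (3 / 4 * pi * (e^-1 ^+ 2 * Q)))//; last first.
  by rewrite -!mulrA lerDr.
have eQ : e^-1 ^+ 2 * r ^+ 2 <= e^-1 ^+ 2 * Q by rewrite ler_wpM2l// sqr_ge0.
have e2 : 0 <= e^-1 ^+ 2 * r ^+ 2 by rewrite mulr_ge0 ?sqr_ge0.
have := @pi_ge2 R; move: (pi : R) => P P2.
apply: (le_trans eQ); have := le_trans e2 eQ; move: (_ * Q) => W W0.
by nra.
Qed.

Lemma measurable_shift_preimage (b : E) (A : set E) : measurable A ->
  measurable [set x | A (x + b)].
Proof.
move=> mA; rewrite -[X in measurable X]setTI.
by apply: (@measurable_rV_pair _ _ _ d id (cst b)).
Qed.

Lemma measurable_fun_shift (b : E) : measurable_fun setT (fun x : E => x + b).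
Proof. exact: (@measurable_rV_pair _ _ _ d id (cst b)). Qed.

Lemma ge0_integral_translate (f : E -> \bar R) (b : E) : measurable_fun setT f ->
  (forall x, (0 <= f x)%E) -> (\int[mu]_x f (x + b)%R = \int[mu]_x f x)%E.
Proof.
move=> mf f0; apply/esym; apply: (ge0_integral_image (measurable_fun_shift b)) => //.
by move=> A mA; exact/esym/lebesgue_rV_translate.
Qed.

Lemma measurable_shear (a : E) : measurable_fun setT (fun z : E * E => a + z.1 - z.2).
Proof.
apply: measurable_rV_pair.
  apply: measurable_rV_pair; first exact: measurable_cst.
  exact: measurable_fst.
apply/measurable_fun_rVP => k.
rewrite (_ : _ \o _ = fun z : E * E => - rV_coord k z.2); last first.
  by apply/funext => t; rewrite /rV_coord/= mxE.
apply: measurableT_comp => //.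
exact: (measurableT_comp (measurable_rV_coord k) measurable_snd).
Qed.

Lemma measurable_shear3 : measurable_fun setT (fun z : E * (E * E) => z.1 + z.2.1 - z.2.2).
Proof.
have m2 : measurable_fun setT (fun z : E * (E * E) => z.2) by exact: measurable_snd.
apply: measurable_rV_pair.
  apply: measurable_rV_pair; first exact: measurable_fst.
  exact: (measurableT_comp measurable_fst m2).
apply/measurable_fun_rVP => k.
rewrite (_ : _ \o _ = fun z : E * (E * E) => - rV_coord k z.2.2); last first.
  by apply/funext => t; rewrite /rV_coord/= mxE.
apply: measurableT_comp => //.
have m22 := measurableT_comp (@measurable_snd _ _ E E) m2.
exact: (measurableT_comp (measurable_rV_coord k) m22).
Qed.

Lemma measurable_heat2 (e1 e2 : R) (u v : E) :
  measurable_fun setT (fun z : E * E => heat e1 u z.1 * heat e2 v z.2).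
Proof.
apply: measurable_funM.
- exact: (measurableT_comp (measurable_heat e1 u) measurable_fst).
- exact: (measurableT_comp (measurable_heat e2 v) measurable_snd).
Qed.

Lemma integral_heat2 (e1 e2 : R) : 0 < e1 -> 0 < e2 ->
  (\int[mu2]_z (heat e1 0 z.1 * heat e2 0 z.2)%:E = 1)%E.
Proof.
move=> e10 e20; rewrite integral_lebesgue_pair fubini_tonelli1/=; last 2 first.
- by apply/measurable_EFinP; exact: measurable_heat2.
- by move=> z; rewrite lee_fin mulr_ge0// heat_ge0.
rewrite -[RHS](integral_heat 0 e10); apply: eq_integral => x _ /=.
rewrite /fubini_F/=; under eq_integral do rewrite EFinM.
rewrite ge0_integralZl_EFin//.
- by rewrite integral_heat// mule1.
- by move=> y _; rewrite lee_fin heat_ge0.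
- by apply/measurable_EFinP; exact: measurable_heat.
- by rewrite heat_ge0.
Qed.

(** Mass of the difference of two independent Gaussian steps of size e that
    leaves w when started from a. *)
Definition leak (w : set E) e a : \bar R :=
  (\int[mu2]_z
    (heat e 0 z.1 * heat e 0 z.2 * \1_(~` w) (a + z.1 - z.2))%:E)%E.

(** If a difference is large, then so is one of its two terms. *)
Lemma heat_pair_tail e r (z : E * E) : 0 < e -> 0 < r -> ~ cube r (z.1 - z.2) ->
  heat e 0 z.1 * heat e 0 z.2 <= 2 ^+ d * (e / (r / 2)) ^+ 2 *
    (heat (2 * e) 0 z.1 * heat e 0 z.2 + heat e 0 z.1 * heat (2 * e) 0 z.2).
Proof.
move=> e0 r0 nz; have r20 : 0 < r / 2 by rewrite divr_gt0.
have e20 : 0 < 2 * e by rewrite mulr_gt0.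
set K := 2 ^+ d * _ ^+ 2.
have K0 : 0 <= K by rewrite mulr_ge0 ?sqr_ge0// exprn_ge0.
have h x := heat_ge0 0 x e0; have H x := heat_ge0 0 x e20.
have [z1|z1] := pselect (cube (r / 2) z.1).
  have nz2 : ~ cube (r / 2) z.2.
    move=> z2; apply: nz => i; rewrite !mxE (le_trans (ler_normB _ _))//.
    by rewrite [leRHS]splitr lerD.
  rewrite mulrDr [K * (heat e _ _ * _)]mulrCA (le_trans (ler_wpM2l (h z.1) (heat_tail e0 r20 nz2)))//.
  by rewrite lerDr mulr_ge0// mulr_ge0.
rewrite mulrDr [K * (heat (2 * e) _ _ * _)]mulrA.
rewrite (le_trans (ler_wpM2r (h z.2) (heat_tail e0 r20 z1)))//.
by rewrite lerDl mulr_ge0// mulr_ge0.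
Qed.

Lemma measurable_inner_pair (F : E * (E * E) -> \bar R) : measurable_fun setT F ->
  (forall z, (0 <= F z)%E) ->
  measurable_fun setT (fun a => (\int[mu2]_z F (a, z))%E).
Proof. by move=> mF F0; exact: (measurable_fun_fubini_tonelli_F (m2 := mu2) F mF F0). Qed.

Lemma measurable_outer_pair (F : E * (E * E) -> \bar R) : measurable_fun setT F ->
  (forall z, (0 <= F z)%E) ->
  measurable_fun setT (fun z => (\int[mu]_a F (a, z))%E).
Proof. by move=> mF F0; exact: (measurable_fun_fubini_tonelli_G F mF F0). Qed.

Lemma tonelli_pair (F : E * (E * E) -> \bar R) : measurable_fun setT F ->
  (forall z, (0 <= F z)%E) ->
  (\int[mu]_a \int[mu2]_z F (a, z) = \int[mu2]_z \int[mu]_a F (a, z))%E.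
Proof. by move=> mF F0; exact: (fubini_tonelli (m2 := mu2) F mF F0). Qed.

(** Most points of a set of positive measure leak little mass out of it under
    short Gaussian averages, because translations are continuous in measure. *)
Lemma good_point (w : set E) (r0 dl : R) : measurable w -> 0 < r0 -> w `<=` cube r0 ->
  (0 < mu w)%E -> 0 < dl ->
  exists2 e0 : R, 0 < e0 & forall e, 0 < e -> e <= e0 ->
    exists2 a, w a & (leak w e a <= dl%:E)%E.
Proof.
move=> mw r00 wr w0 dl0.
have fw : mu w \is a fin_num.
  rewrite ge0_fin_numE//; apply: (@le_lt_trans _ _ (mu (cube r0))).
    by apply: le_measure; rewrite ?inE//; exact: measurable_cube.
  by rewrite lebesgue_rV_cube// ltry.
pose M := fine (mu w).
have ME : mu w = M%:E by rewrite fineK.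
have M0 : 0 < M by rewrite fine_gt0// w0 ltey_eq fw.
have dM0 : 0 < M * (dl / 4) by rewrite mulr_gt0// divr_gt0.
have [rho rho0 hrho] := translation_continuity 0 (oner_neq0 R) mw r00 dM0.
pose q := (rho / 2) ^+ 2 * dl / (8 * 2 ^+ d).
have d20 : 0 < (2 : R) ^+ d by rewrite exprn_gt0.
have q0 : 0 < q by rewrite divr_gt0 ?mulr_gt0 ?exprn_gt0// divr_gt0.
exists (Num.min 1 q); first by rewrite lt_min ltr01.
move=> e e0; rewrite le_min => /andP[e1 eq].
have e20 : 0 < 2 * e by rewrite mulr_gt0.
pose K := 2 ^+ d * (e / (rho / 2)) ^+ 2.
have K0 : 0 <= K by rewrite mulr_ge0 ?sqr_ge0// exprn_ge0.
have Kdl : K <= dl / 8.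
  rewrite /K exprMn exprVn mulrA ler_pdivrMr ?exprn_gt0 ?divr_gt0//.
  have : e ^+ 2 <= q by rewrite (le_trans _ eq)// expr2 ler_piMl// ltW.
  rewrite /q ler_pdivlMr; last by rewrite mulr_gt0.
  by lra.
apply: contrapT => h.
have lk a : w a -> (dl%:E < leak w e a)%E.
  by move=> wa; rewrite ltNge; apply/negP => ?; apply: h; exists a.
pose hh (z : E * E) := heat e 0 z.1 * heat e 0 z.2.
have hh0 z : 0 <= hh z by rewrite mulr_ge0// heat_ge0.
have mhh : measurable_fun setT hh by exact: measurable_heat2.
pose F (z : E * (E * E)) : \bar R :=
  (\1_w z.1 * (hh z.2 * \1_(~` w) (z.1 + z.2.1 - z.2.2)))%:E.
have F0 z : (0 <= F z)%E.
  by rewrite lee_fin; apply: mulr_ge0; rewrite ?indicE//; apply: mulr_ge0.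
have mF : measurable_fun setT F.
  apply/measurable_EFinP; apply: measurable_funM.
    exact: (measurableT_comp (measurable_indic mw) measurable_fst).
  apply: measurable_funM.
    exact: (measurableT_comp mhh measurable_snd).
  exact: (measurableT_comp (measurable_indic (measurableC mw)) measurable_shear3).
have mleak a : measurable_fun setT (fun z : E * E =>
    (hh z * \1_(~` w) (a + z.1 - z.2))%:E).
  apply/measurable_EFinP; apply: measurable_funM => //.
  exact: (measurableT_comp (measurable_indic (measurableC mw)) (measurable_shear a)).
have lower : ((dl * M)%:E <= \int[mu]_a \int[mu2]_z F (a, z))%E.
  have -> : (dl * M)%:E = (\int[mu]_a (dl * \1_w a)%:E)%E.
    under eq_integral do rewrite EFinM.
    rewrite ge0_integralZl_EFin//.
    - by rewrite integral_indic// setIT EFinM; congr (_ * _)%E; exact/esym/ME.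
    - exact/measurable_EFinP/measurable_indic.
    - exact: ltW.
  apply: ge0_le_integral => //.
  - by move=> a _; rewrite lee_fin mulr_ge0// ltW.
  - by apply/measurable_EFinP; apply: measurable_funM => //; exact: measurable_indic.
  - exact: (measurable_inner_pair mF F0).
  - move=> a _; have [wa|nwa] := pselect (w a).
      have w1 : \1_w a = 1 :> R by rewrite indicE mem_set.
      rewrite w1 mulr1; apply: (le_trans (ltW (lk a wa))).
      rewrite le_eqVlt; apply/orP; left; apply/eqP.
      by apply: eq_integral => z _; rewrite /F w1 mul1r.
    have -> : \1_w a = 0 :> R by rewrite indicE memNset.
    by rewrite mulr0; apply: integral_ge0 => z _; exact: F0.
(* A short displacement z moves few points of w out of w, by continuity of the
   translations; the long ones have small mass under the Gaussians. *)
have upper : (\int[mu]_a \int[mu2]_z F (a, z) <= (M * (dl / 2))%:E)%E.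
  rewrite (tonelli_pair mF F0).
  pose G (z : E * E) := M * (dl / 4) * hh z +
    M * K * (heat (2 * e) 0 z.1 * heat e 0 z.2 + heat e 0 z.1 * heat (2 * e) 0 z.2).
  have H0 (s1 s2 : R) (z : E * E) : 0 < s1 -> 0 < s2 -> 0 <= heat s1 0 z.1 * heat s2 0 z.2.
    by move=> ? ?; rewrite mulr_ge0// heat_ge0.
  have MK0 : 0 <= M * K by rewrite mulr_ge0// ltW.
  apply: (@le_trans _ _ (\int[mu2]_z (G z)%:E)%E).
    apply: ge0_le_integral => //.
    - by move=> z _; exact: integral_ge0.
    - exact: (measurable_outer_pair mF F0).
    - apply/measurable_EFinP; apply: measurable_funD; apply: measurable_funM => //.
      by apply: measurable_funD; exact: measurable_heat2.
    - move=> z _.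
      pose A := w `&` ~` [set a | w (a + (z.1 - z.2))].
      have mA : measurable A.
        by apply: measurableI => //; apply: measurableC; exact: measurable_shift_preimage.
      have -> : (\int[mu]_a F (a, z) = (hh z)%:E * mu A)%E.
        transitivity (\int[mu]_a ((hh z)%:E * (\1_A a)%:E))%E.
          apply: eq_integral => a _; rewrite /F /= -EFinM; congr EFin.
          rewrite mulrCA; congr (_ * _).
          rewrite /A !indicE in_setI !in_setC -natrM mulnb.
          congr ((_ && ~~ _)%:R).
          by apply/idP/idP; rewrite !inE/= addrA.
        rewrite ge0_integralZl_EFin//; last exact/measurable_EFinP/measurable_indic.
        by rewrite integral_indic// setIT.
      have AM : (mu A <= M%:E)%E.
        by rewrite -ME; apply: le_measure; rewrite ?inE//; exact: subIsetl.
      have [cz|ncz] := pselect (cube rho (z.1 - z.2)).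
        have Asm : (mu A <= (M * (dl / 4))%:E)%E.
          apply: le_trans (hrho _ cz); apply: le_measure; rewrite ?inE//.
            apply: measurableI; first exact: measurable_cube.
            by apply: measurable_flips => //; exact: oner_neq0.
          move=> a [wa nwa]; split; first exact: wr.
          rewrite /flips /= !scale1r !add0r => -[/(_ wa) h1 _]; apply: nwa.
          by rewrite /= addrC.
        apply: (le_trans (lee_wpmul2l _ Asm)); first by rewrite lee_fin.
        by rewrite -EFinM lee_fin /G mulrC lerDl mulr_ge0// addr_ge0//; exact: H0.
      have hz0 : (0 <= (hh z)%:E)%E by rewrite lee_fin.
      apply: (le_trans (lee_wpmul2l hz0 AM)).
      rewrite -EFinM lee_fin /G mulrC.
      apply: (@le_trans _ _ (M * K * (heat (2 * e) 0 z.1 * heat e 0 z.2 + heat e 0 z.1 * heat (2 * e) 0 z.2))).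
        by rewrite -mulrA ler_pM2l//; exact: heat_pair_tail.
      by rewrite lerDr mulr_ge0// ltW.
  rewrite /G; under eq_integral do rewrite EFinD.
  rewrite ge0_integralD//; last 4 first.
  - by move=> z _; rewrite lee_fin mulr_ge0// ltW.
  - by apply/measurable_EFinP; apply: measurable_funM.
  - by move=> z _; rewrite lee_fin mulr_ge0// addr_ge0//; exact: H0.
  - apply/measurable_EFinP; apply: measurable_funM => //.
    by apply: measurable_funD; exact: measurable_heat2.
  under eq_integral do rewrite EFinM.
  rewrite ge0_integralZl_EFin//; last 3 first.
  - by move=> z _; rewrite lee_fin.
  - exact/measurable_EFinP.
  - exact: ltW.
  rewrite integral_heat2// mule1.
  under eq_integral do rewrite EFinM EFinD.
  rewrite ge0_integralZl_EFin//; last 2 first.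
  - by move=> z _; rewrite -EFinD lee_fin addr_ge0//; exact: H0.
  - by apply: emeasurable_funD; apply/measurable_EFinP; exact: measurable_heat2.
  rewrite ge0_integralD//; last 4 first.
  - by move=> z _; rewrite lee_fin; exact: H0.
  - by apply/measurable_EFinP; exact: measurable_heat2.
  - by move=> z _; rewrite lee_fin; exact: H0.
  - by apply/measurable_EFinP; exact: measurable_heat2.
  rewrite !integral_heat2// (_ : 1 + 1 = 2%:E)%E//.
  rewrite -EFinM -EFinD lee_fin.
  by nra.
have := le_trans lower upper; rewrite lee_fin.
by nra.
Qed.

End heat_kernel.

(** * Sets that are not equivalent to an open set *)

Section not_open.
Context (R : realType) (d : nat).
Local Notation E := 'rV[R]_d.
Local Notation mu := (lebesgue_rV R d).
Implicit Types (a x y s t : E) (A B : set E).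

Definition open_box (c : E) (k : nat) : set E :=
  [set x | forall i, `|x 0 i - c 0 i| < k.+1%:R^-1].

Lemma open_open_box c k : open (open_box c k).
Proof.
rewrite openE => x hx.
suff : \forall z \near x, forall i, `|(z : E) 0 i - c 0 i| < k.+1%:R^-1 by [].
apply: (@filter_forall E 'I_d (fun i => [set z : E | `|z 0 i - c 0 i| < k.+1%:R^-1])
  (nbhs x) (nbhs_filter x)) => i.
have ci : {for x, continuous (fun x : E => `|x 0 i - c 0 i|)}.
  apply: (@continuous_comp _ _ _ (fun x : E => x 0 i - c 0 i) Num.norm).
    by apply: continuousB; [exact: coord_continuous|exact: cst_continuous].
  exact: norm_continuous.
exact: (@cvgr_lt _ _ _ (nbhs_filter x) _ _ ci _ (hx i)).
Qed.

Lemma measurable_open_box c k : measurable (open_box c k).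
Proof.
pose A (i : 'I_d) : set (measurableTypeR R) :=
  `](c 0 i - k.+1%:R^-1), (c 0 i + k.+1%:R^-1)[%classic.
rewrite (_ : open_box c k = [set x | forall i, A i (x 0 i)]).
  by apply: (@measurable_rV_box _ _ A) => i; exact: measurable_itv.
by apply/seteqP; split => x h i; have := h i; rewrite /A/= in_itv/= ltr_distl.
Qed.

(** Boxes with rational centres form a countable base, which keeps the
    essential interior a countable union. *)
Lemma rational_box y (w : R) : 0 < w -> exists (c : 'rV[rat]_d) k,
  open_box (map_mx ratr c) k y /\
  open_box (map_mx ratr c) k `<=` [set x | cube w (x - y)].
Proof.
move=> w0.
have [k kw] : exists k : nat, k.+1%:R^-1 < w / 2.
  have w20 : 0 < w / 2 by rewrite divr_gt0.
  exists (Num.truncn (w / 2)^-1).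
  by rewrite -[ltRHS]invrK ltf_pV2 ?posrE ?invr_gt0// truncnS_gt.
have /choice[c cP] : forall i : 'I_d, exists q : rat, `|y 0 i - ratr q| < k.+1%:R^-1.
  move=> i; have h : y 0 i - k.+1%:R^-1 < y 0 i + k.+1%:R^-1.
    by rewrite ltrD2l gtrN.
  have [q] := rat_in_itvoo h; rewrite in_itv/= => hq.
  by exists q; rewrite distrC ltr_distl.
exists (\row_i c i), k; split => [i|x h i]; first by rewrite !mxE; exact: cP.
rewrite !mxE; have := h i; rewrite !mxE => hx.
have -> : x 0 i - y 0 i = (x 0 i - ratr (c i)) - (y 0 i - ratr (c i)) by ring.
rewrite (le_trans (ler_normB _ _))// (le_trans (lerD (ltW hx) (ltW (cP i))))//.
by rewrite [leRHS]splitr lerD ?ltW.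
Qed.

(** The largest open set that is almost contained in A. *)
Definition essential_interior A : set E :=
  \bigcup_(n in [set: nat]) (if unpickle n is Some (c, k) then
    if pselect (mu (open_box (map_mx ratr (c : 'rV[rat]_d)) (k : nat) `\` A) = 0%E)
    then open_box (map_mx ratr c) k else set0 else set0).

Lemma open_essential_interior A : open (essential_interior A).
Proof.
apply: bigcup_open => n _; case: (unpickle n) => [[c k]|]; last exact: open0.
by case: pselect => ? /=; [exact: open_open_box|exact: open0].
Qed.

Lemma measurable_essential_interior A : measurable (essential_interior A).
Proof.
apply: bigcupT_measurable => n; case: (unpickle n) => [[c k]|]; last exact: measurable0.
by case: pselect => ? /=; [exact: measurable_open_box|exact: measurable0].
Qed.

Lemma essential_interior_negligible A : measurable A ->
  mu.-negligible (essential_interior A `\` A).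
Proof.
move=> mA; rewrite /essential_interior setDE setI_bigcupl.
apply: negligible_bigcup => n; case: (unpickle n) => [[c k]|]; last first.
  by rewrite set0I; exact: negligible_set0.
case: pselect => h /=; last by rewrite set0I; exact: negligible_set0.
rewrite -setDE; apply/negligibleP => //.
by apply: measurableD => //; exact: measurable_open_box.
Qed.

Lemma essential_interiorN A y (w : R) : measurable A -> ~ essential_interior A y ->
  0 < w -> (0 < mu ([set x | cube w (x - y)%R] `&` ~` A))%E.
Proof.
move=> mA nU w0; have [c [k [ky kw]]] := rational_box y w0.
have mD : measurable (open_box (map_mx ratr c) k `\` A).
  by apply: measurableD => //; exact: measurable_open_box.
apply: (@lt_le_trans _ _ (mu (open_box (map_mx ratr c) k `\` A))).
  rewrite lt0e measure_ge0 andbT; apply/eqP => h; apply: nU.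
  by exists (pickle (c, k)) => //; rewrite pickleK; case: pselect.
apply: le_measure; rewrite ?inE//; last by apply: setSI.
apply: measurableI; last exact: measurableC.
by apply: measurable_shift_preimage; exact: measurable_cube.
Qed.

(** The set A is a Borel part of X that exhausts it up to the null set N; the
    patterns are read on A, whose sections are measurable. *)
Lemma not_open_pattern (X : set E) (I hs : seq int) : lebesgue_measurable X ->
  (forall U : set E, open U -> ~ lebesgue_equiv X U) ->
  exists A N w t (r : R), [/\ measurable A /\ measurable N,
    mu N = 0%E /\ A `<=` X /\ X `<=` A `|` N,
    measurable w /\ (0 < mu w)%E,
    0 < r /\ w `<=` cube r &
    forall a i, w a -> i \in I ->
      (i \in hs -> ~ A (a + i%:~R *: t)) /\ (i \notin hs -> A (a + i%:~R *: t))].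
Proof.
move=> [A mA [M [N [mN N0 MN]] AMX]] nX.
have sAX : A `<=` X by rewrite -AMX => x; left.
have sXN : X `<=` A `|` N by rewrite -AMX => x [?|/MN ?]; [left|right].
pose U := essential_interior A; pose F := A `\` U.
have mU : measurable U by exact: measurable_essential_interior.
have mF : measurable F by exact: measurableD.
have F0 : (0 < mu F)%E.
  rewrite lt0e measure_ge0 andbT; apply/eqP => h.
  apply: (nX U); first exact: open_essential_interior.
  have nF : mu.-negligible F by apply/negligibleP.
  have nN : mu.-negligible N by apply/negligibleP.
  apply: (negligibleS _ (negligibleU (negligibleU nF nN)
    (essential_interior_negligible mA))).
  move=> x [[Xx nUx]|[Ux nXx]].
    by left; have [Ax|Nx] := sXN _ Xx; [left|right].
  by right; split => // Ax; apply: nXx; exact: sAX.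
have FH y : F y -> forall w : R, 0 < w -> (0 < mu ([set x | cube w (x - y)%R] `&` ~` A))%E.
  by move=> [Ay nUy] w w0; exact: essential_interiorN.
have mS i : measurable (if i \in hs then ~` A else F).
  by case: ifP => _ //; exact: measurableC.
have := prescribed_pattern I hs mF (measurableC mA) F0 FH.
rewrite product_measure_ysection; last exact: measurable_patset.
move=> /integral_gt0_ex[//|t tP].
have mt := measurable_ysec t (measurable_patset I intr mS).
have [r r0 rP] := measure_gt0_cube mt tP.
pose w := cube r `&` [set a | pat I (fun i => if i \in hs then ~` A else F) intr (a, t)].
exists A, N, w, t, r; split => //.
- by split => //; apply: measurableI => //; exact: measurable_cube.
- by split => //; exact: subIsetl.
- move=> a i [_ ha] iI; move: (ha i iI) => /=.
  by case: ifPn => // _ [].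
Qed.

End not_open.

(** * A multiplicative family of trigonometric polynomials *)

Section digits.

(** The lowest digit is a multiple of 10 of absolute value at most 4, hence 0; the
    base 10 leaves room for combinations of four digits among -1, 0, 1. *)
Lemma digits_eq0 D (n : 'I_D -> int) : (forall j, `|n j| <= 4) ->
  \sum_(j < D) n j * 10 ^+ j = 0 -> forall j, n j = 0.
Proof.
elim: D n => [|D ih] n nle; first by move=> _ [].
rewrite big_ord_recl expr0 mulr1.
have -> : \sum_(i < D) n (lift ord0 i) * 10 ^+ lift ord0 i =
    10 * \sum_(i < D) n (lift ord0 i) * 10 ^+ i.
  by rewrite mulr_sumr; apply: eq_bigr => i _; rewrite exprS mulrCA.
move=> e.
have := nle ord0; set s := \sum_(_ < _) _ in e *.
have n0 : n ord0 = - (10 * s) by apply/eqP; rewrite -addr_eq0 e.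
rewrite n0 normrN => s4.
have s0 : s = 0 by lia.
move=> j; have [i ->|->] := unliftP ord0 j; last by rewrite n0 s0 mulr0 oppr0.
by apply: (ih (fun i => n (lift ord0 i))).
Qed.

Variable D : nat.
Local Notation K := {ffun 'I_D -> 'I_3}.
Local Notation M := {ffun 'I_D -> 'I_5}.

(** The entries of k encode the digits -1, 0, 1. *)
Definition freq (k : K) : int := \sum_(j < D) ((k j : nat)%:Z - 1) * 10 ^+ j.
(** The entries of m encode the digits -2, ..., 2 of a sum of two frequencies. *)
Definition freq2 (m : M) : int := \sum_(j < D) ((m j : nat)%:Z - 2) * 10 ^+ j.

(** The two digits are opposite and nonzero. *)
Definition spread (a b : 'I_3) : bool := `|(a : nat)%:Z - (b : nat)%:Z| == 2.

Definition even_spread (k l : K) : bool :=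
  ~~ odd (\sum_(j < D) spread (k j) (l j)).

Lemma ord3_bound (a : 'I_3) : 0 <= (a : nat)%:Z <= 2.
Proof. by case: a => -[|[|[|]]]. Qed.

(** The pattern is prescribed in terms of the difference of two frequencies;
    the digitwise differences can be recovered from it. *)
Lemma freqB_inj (k l k' l' : K) : freq k - freq l = freq k' - freq l' ->
  forall j, (k j : nat)%:Z - (l j : nat)%:Z = (k' j : nat)%:Z - (l' j : nat)%:Z.
Proof.
move=> e j; apply/eqP; rewrite -subr_eq0; apply/eqP.
apply: (digits_eq0 (n := fun j => ((k j : nat)%:Z - (l j : nat)%:Z) -
   ((k' j : nat)%:Z - (l' j : nat)%:Z))).
  move=> i; have := ord3_bound (k i); have := ord3_bound (l i).
  have := ord3_bound (k' i); have := ord3_bound (l' i); lia.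
transitivity ((freq k - freq l) - (freq k' - freq l')); last by rewrite e subrr.
rewrite /freq -!sumrB; apply: eq_bigr => i _; ring.
Qed.

Lemma freqD_eq (k l : K) (m : M) :
  (freq k + freq l - freq2 m == 0) = [forall j, ((k j + l j)%N == m j)].
Proof.
apply/eqP/forallP => [e j|h].
  have := digits_eq0 (n := fun j => (k j : nat)%:Z + (l j : nat)%:Z - (m j : nat)%:Z).
  move=> /(_ _ _ j) h.
  have : (k j : nat)%:Z + (l j : nat)%:Z - (m j : nat)%:Z = 0.
    apply: h.
      move=> i; have := ord3_bound (k i); have := ord3_bound (l i).
      have := ltn_ord (m i); lia.
    rewrite -[RHS]e /freq /freq2 -big_split -sumrB; apply: eq_bigr => i _ /=; ring.
  by move=> ?; apply/eqP; lia.
rewrite /freq /freq2 -big_split -sumrB big1// => i _ /=.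
by have /eqP <- := h i; rewrite PoszD; ring.
Qed.

Definition all_diffs : seq int := [seq freq p.1 - freq p.2 | p <- enum {: K * K}].
Definition odd_diffs : seq int :=
  [seq freq p.1 - freq p.2 | p <- enum {: K * K} & ~~ even_spread p.1 p.2].

Lemma mem_all_diffs k l : freq k - freq l \in all_diffs.
Proof. by apply/mapP; exists (k, l) => //; rewrite mem_enum. Qed.

Lemma mem_odd_diffs k l : (freq k - freq l \in odd_diffs) = ~~ even_spread k l.
Proof.
apply/mapP/idP => [[[k' l']]|h]; last first.
  by exists (k, l) => //; rewrite mem_filter h mem_enum.
rewrite mem_filter => /andP[/= h _] e.
suff -> : even_spread k l = even_spread k' l' by [].
rewrite /even_spread; congr (~~ odd _); apply: eq_bigr => j _.
by rewrite /spread (freqB_inj e).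
Qed.

End digits.

Section trig_polynomials.
Variable (R : realType).
Implicit Types (x y t : R).

(** Coefficients of 1 + i cos. *)
Definition fcoef (a : 'I_3) : R[i] := if a == 1 :> nat then 1 else 0 +i* 2^-1.
(** Coefficients of 1 + i cos - cos (2 .) / 4. *)
Definition hcoef (a : 'I_5) : R[i] :=
  if a == 2 :> nat then 1 else
  if odd a then 0 +i* 2^-1 else (- 8^-1)%:C.

Definition ftrig t : R[i] := \sum_(a < 3) fcoef a * cis (((a : nat)%:R - 1) * t).
Definition htrig t : R[i] := \sum_(a < 5) hcoef a * cis (((a : nat)%:R - 2) * t).

Lemma ftrigE t : ftrig t = 1 +i* cos t.
Proof.
rewrite /ftrig !big_ord_recl big_ord0 /fcoef /= addr0.
rewrite /bump /= subrr mul0r cis0 sub0r mulN1r (_ : 2%:R - 1 = 1 :> R) ?mul1r; last by ring.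
apply/eqP; rewrite eq_complex; apply/andP; split; apply/eqP;
  rewrite !(cReD, cImD, cReM, cImM) /= cosN sinN; by field.
Qed.

Lemma htrigE t : htrig t = (1 - cos (2 * t) / 4) +i* cos t.
Proof.
rewrite /htrig !big_ord_recl big_ord0 /hcoef /= addr0 /bump /=.
rewrite subrr mul0r cis0 sub0r.
rewrite (_ : 1%:R - 2 = -1 :> R); last by ring.
rewrite (_ : 3%:R - 2 = 1 :> R); last by ring.
rewrite (_ : 4%:R - 2 = 2 :> R); last by ring.
rewrite mul1r mulN1r mulNr.
apply/eqP; rewrite eq_complex; apply/andP; split; apply/eqP;
  rewrite !(cReD, cImD, cReM, cImM) /= !cosN !sinN ?mul1r; by field.
Qed.

Lemma cnorm_ftrig t : cnorm (ftrig t) <= Num.sqrt 2.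
Proof.
rewrite ftrigE /= ler_wsqrtr// expr1n.
have := cos2Dsin2 t; have := sqr_ge0 (sin t); lra.
Qed.

(** With [c = cos t], the square of the norm is [(5/4 - c^2 / 2)^2 + c^2], that
    is [25/16 - c^2 / 4 + c^4 / 4], and [c^4 <= c^2]. *)
Lemma cnorm_htrig t : cnorm (htrig t) <= 5 / 4.
Proof.
rewrite htrigE -(@ler_pXn2r _ 2)// ?nnegrE ?cnorm_ge0//.
rewrite cnorm_sqr /= mulr_natl cos_mulr2n.
have := cos2Dsin2 t; have := sqr_ge0 (sin t); have := sqr_ge0 (cos t).
by move: (cos t) (sin t) => c s; nra.
Qed.

Variable D : nat.
Local Notation K := {ffun 'I_D -> 'I_3}.
Local Notation M := {ffun 'I_D -> 'I_5}.

Definition alpha (k : K) : R[i] := \prod_(j < D) fcoef (k j).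
Definition beta (m : M) : R[i] := \prod_(j < D) hcoef (m j).

(** Factoring over the digits makes the uniform norm multiplicative in D. *)
Lemma sum_alphaE t : \sum_k alpha k * cis (2 * pi * ((freq k)%:~R * t)) =
  \prod_(j < D) ftrig (2 * pi * (10 ^+ j * t)).
Proof.
rewrite /ftrig bigA_distr_bigA; apply: eq_bigr => k _.
rewrite big_split /= -cis_sum; congr (_ * cis _).
rewrite /freq rmorph_sum /= mulr_suml mulr_sumr; apply: eq_bigr => j _.
by rewrite rmorphM rmorphB rmorphXn /= -!pmulrn; ring.
Qed.

Lemma sum_betaE t : \sum_m beta m * cis (2 * pi * ((freq2 m)%:~R * t)) =
  \prod_(j < D) htrig (2 * pi * (10 ^+ j * t)).
Proof.
rewrite /htrig bigA_distr_bigA; apply: eq_bigr => k _.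
rewrite big_split /= -cis_sum; congr (_ * cis _).
rewrite /freq2 rmorph_sum /= mulr_suml mulr_sumr; apply: eq_bigr => j _.
by rewrite rmorphM rmorphB rmorphXn /= -!pmulrn; ring.
Qed.

Lemma cnorm_sum_alpha t :
  cnorm (\sum_k alpha k * cis (2 * pi * ((freq k)%:~R * t))) <= Num.sqrt 2 ^+ D.
Proof.
rewrite sum_alphaE cnorm_prod -[D in leRHS]card_ord -prodr_const.
by apply: ler_prod => j _; rewrite cnorm_ge0 cnorm_ftrig.
Qed.

Lemma cnorm_sum_beta t :
  cnorm (\sum_m beta m * cis (2 * pi * ((freq2 m)%:~R * t))) <= (5 / 4) ^+ D.
Proof.
rewrite sum_betaE cnorm_prod -[D in leRHS]card_ord -prodr_const.
by apply: ler_prod => j _; rewrite cnorm_ge0 cnorm_htrig.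
Qed.

Lemma triple_prod (g : 'I_3 -> 'I_3 -> 'I_5 -> R[i]) :
  \sum_(k : K) \sum_(l : K) \sum_(m : M) \prod_(j < D) g (k j) (l j) (m j) =
  (\sum_a \sum_b \sum_c g a b c) ^+ D.
Proof.
rewrite -[D in RHS]card_ord -prodr_const.
rewrite (bigA_distr_bigA (fun (j : 'I_D) a => \sum_b \sum_c g a b c)).
apply: eq_bigr => k _.
rewrite (bigA_distr_bigA (fun (j : 'I_D) b => \sum_c g (k j) b c)).
apply: eq_bigr => l _.
by rewrite (bigA_distr_bigA (fun (j : 'I_D) c => g (k j) (l j) c)).
Qed.

(** The indicator of an even number of opposite digits is half the sum of 1
    and of a product of signs, and each half factors over the digits. *)
Lemma diagonal_sum : \sum_(k : K) \sum_(l : K) \sum_(m : M)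
    (if (freq k + freq l - freq2 m == 0) && even_spread k l
     then alpha k * alpha l * (beta m)^* else 0) =
  (((25 / 16) ^+ D + (41 / 16) ^+ D) / 2)%:C.
Proof.
pose g (a b : 'I_3) (c : 'I_5) : R[i] := if (a + b)%N == c then fcoef a * fcoef b * (hcoef c)^* else 0.
pose h (a b : 'I_3) (c : 'I_5) : R[i] := if spread a b then - g a b c else g a b c.
have gE : \sum_a \sum_b \sum_c g a b c = (25 / 16)%:C.
  rewrite !big_ord_recl !big_ord0 /g /fcoef /hcoef /= /bump /=.
  apply/eqP; rewrite eq_complex; apply/andP; split; apply/eqP;
    rewrite !(cReD, cImD, cReM, cImM) /=; by field.
have hE : \sum_a \sum_b \sum_c h a b c = (41 / 16)%:C.
  rewrite !big_ord_recl !big_ord0 /h /g /spread /fcoef /hcoef /= /bump /=.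
  apply/eqP; rewrite eq_complex; apply/andP; split; apply/eqP;
    rewrite !(cReD, cImD, cReM, cImM) /=; by field.
transitivity ((\sum_(k : K) \sum_(l : K) \sum_(m : M) \prod_(j < D) g (k j) (l j) (m j)
  + \sum_(k : K) \sum_(l : K) \sum_(m : M) \prod_(j < D) h (k j) (l j) (m j)) / 2).
  rewrite -[in RHS]big_split/= mulr_suml; apply: eq_bigr => k _.
  rewrite -[in RHS]big_split/= mulr_suml; apply: eq_bigr => l _.
    rewrite -[in RHS]big_split/= mulr_suml; apply: eq_bigr => m _.
  have -> : \prod_(j < D) h (k j) (l j) (m j) =
      (-1) ^+ (\sum_(j < D) spread (k j) (l j)) * \prod_(j < D) g (k j) (l j) (m j).
    rewrite -prodrXr -big_split/=; apply: eq_bigr => j _.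
    by rewrite /h; case: spread; rewrite ?expr1 ?mulN1r ?expr0 ?mul1r.
  have -> : \prod_(j < D) g (k j) (l j) (m j) =
      if freq k + freq l - freq2 m == 0 then alpha k * alpha l * (beta m)^* else 0.
    rewrite freqD_eq; case: ifPn => [/forallP klm|].
      rewrite /alpha /beta rmorph_prod/= -!big_split/=; apply: eq_bigr => j _.
      by rewrite /g klm.
    rewrite negb_forall => /existsP[j jn].
    by rewrite (bigD1 j)//= /g (negbTE jn) mul0r.
  rewrite -signr_odd /even_spread.
  case: (_ == 0) => /=; last by rewrite mulr0 addr0 mul0r.
  case: (odd _); rewrite /= ?expr1 ?mulN1r ?subrr ?mul0r//.
  have two : (2 : R[i]) != 0 by rewrite pnatr_eq0.
  by rewrite expr0 mul1r; set x := _ * _; rewrite -mulr2n -[x *+ 2]mulr_natr mulfK.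
rewrite (triple_prod g) (triple_prod h) gE hE -!rmorphXn -rmorphD/=.
rewrite (_ : 2 = (2%:R)%:C); last by rewrite rmorph_nat.
by rewrite -fmorphV -rmorphM.
Qed.

End trig_polynomials.

(** * Integrals and norms of nonmeasurable functions *)

Section null_insensitive.
Context d (T : measurableType d) (R : realType) (mu : {measure set T -> \bar R}).
Local Open Scope ereal_scope.

Lemma ge0_le_integral_any (f g : T -> \bar R) : (forall x, 0 <= f x) ->
  (forall x, f x <= g x) -> \int[mu]_x f x <= \int[mu]_x g x.
Proof.
move=> f0 fg; have g0 x : 0 <= g x by exact: le_trans (f0 x) (fg x).
rewrite !ge0_integralTE//; apply: ge_ereal_sup => _ [h hf <-].
by apply: ereal_sup_ubound; exists h => // x; exact: le_trans (hf x) (fg x).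
Qed.

Lemma ge0_integral_off_null (N : set T) (f g : T -> \bar R) : measurable N -> mu N = 0 ->
  (forall x, 0 <= f x) -> (forall x, 0 <= g x) -> measurable_fun setT g ->
  (forall x, ~ N x -> f x = g x) -> \int[mu]_x f x = \int[mu]_x g x.
Proof.
move=> mN N0 f0 g0 mg fg.
pose g1 x := if x \in N then +oo else g x.
pose g2 x := if x \in N then 0 else g x.
have mN' : measurable_fun setT (fun x => x \in N).
    apply: (@measurable_fun_bool _ _ _ _ true); rewrite setTI (_ : _ @^-1` _ = N)//.
    by apply/seteqP; split => x /=; [move/set_mem|move/mem_set].
have m1 : measurable_fun setT g1 by apply: measurable_fun_ifT => //; exact: measurable_cst.
have m2 : measurable_fun setT g2 by apply: measurable_fun_ifT => //; exact: measurable_cst.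
have p1 x : 0 <= g1 x by rewrite /g1; case: ifP.
have p2 x : 0 <= g2 x by rewrite /g2; case: ifP.
have E (h : T -> \bar R) : measurable_fun setT h -> (forall x, 0 <= h x) ->
    (forall x, x \notin N -> h x = g x) -> \int[mu]_x h x = \int[mu]_x g x.
  move=> mh h0 hg; apply: ge0_ae_eq_integral => //.
  exists N; split => // x /= nx; apply: contrapT => xN; apply: nx => _.
  by apply: hg; rewrite notin_setE.
apply/eqP; rewrite eq_le; apply/andP; split.
  rewrite -(E g1) //; last by move=> x /negbTE; rewrite /g1 => ->.
  apply: ge0_le_integral_any => // x; rewrite /g1; case: ifPn => [_|]; first exact: leey.
  by rewrite notin_setE => /fg ->.
rewrite -(E g2) //; last by move=> x /negbTE; rewrite /g2 => ->.
apply: ge0_le_integral_any => // x; rewrite /g2; case: ifPn => // .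
by rewrite notin_setE => /fg ->.
Qed.

Lemma Rintegral_off_null (N : set T) (f g : T -> R) : measurable N -> mu N = 0 ->
  measurable_fun setT g -> (forall x, ~ N x -> f x = g x) ->
  Rintegral mu setT f = Rintegral mu setT g.
Proof.
move=> mN N0 /measurable_EFinP mg fg; rewrite /Rintegral integralE [in RHS]integralE.
congr (fine (_ - _)); apply: (ge0_integral_off_null mN N0) => //.
- exact: measurable_funepos.
- by move=> x /fg; rewrite !funeposE => ->.
- exact: measurable_funeneg.
- by move=> x /fg; rewrite !funenegE => ->.
Qed.

(** The integrand f may fail to be measurable: it is compared with g through
    simple functions, in the supremum that defines the integral. *)
Lemma cint_off_null (N : set T) (f g : T -> R[i]) : measurable N -> mu N = 0 ->
  cmeasurable g -> (forall x, ~ N x -> f x = g x) -> cint mu f = cint mu g.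
Proof.
by move=> mN N0 [g1 g2] fg; rewrite /cint; congr (_ +i* _);
  apply: (Rintegral_off_null mN N0) => // x /fg ->.
Qed.

Lemma le_Lnorm_any (p : \bar R) (f g : T -> R) : 1 <= p ->
  (forall x, `|f x| <= `|g x|)%R ->
  'N[mu]_p[EFin \o f] <= 'N[mu]_p[EFin \o g].
Proof.
move=> p1 fg; rewrite unlock; case: p p1 => [p|_|//].
- rewrite lee_fin => p1.
  have p0 : (0 <= p)%R by exact: le_trans p1.
  apply: gt0_ler_poweR; rewrite ?invr_ge0// ?in_itv/= ?andbT ?leey ?integral_ge0//.
  apply: ge0_le_integral_any => x /=; first by rewrite lee_fin powR_ge0.
  by rewrite lee_fin ge0_ler_powR.
- by case: ifP => // _; apply: le_ess_sup; apply: aeW => x /=; rewrite lee_fin.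
Qed.

End null_insensitive.

Section gaussian_norms.
Context (R : realType) (d : nat).
Local Notation E := 'rV[R]_d.
Local Notation mu := (lebesgue_rV R d).
Local Open Scope ereal_scope.

(** The value is 0 at +oo, so that powers with this exponent cover all norms. *)
Definition inv_exponent (p : \bar R) : R := fine (p^-1).

Lemma lebesgue_rVT_gt0 : 0 < mu setT.
Proof.
rewrite lt0e measure_ge0 andbT; apply/eqP => h0.
have := Rintegral_gaussian (0 : E)%R (ltr01 : (0 < 1 :> R)%R).
rewrite /Rintegral (_ : \int[mu]_x _ = 0); last first.
  by apply: null_set_integral => //; apply/measurable_EFinP; exact: measurable_gaussian.
by rewrite expr1n invr1 => /esym/eqP; rewrite oner_eq0.
Qed.

(** Since a Gaussian is at most 1, its p-th power is at most itself. *)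
Lemma Lnorm_gaussian_le (p : \bar R) (e b : R) (u : E -> R) : 1 <= p -> (0 < e)%R -> (0 <= b)%R ->
  (forall x, `|u x| <= b * gaussian e 0 x)%R ->
  'N[mu]_p[EFin \o u] <= (b * (e ^- d) `^ inv_exponent p)%:E.
Proof.
move=> p1 e0 b0 ub.
have g0 x := gaussian_ge0 e (0 : E)%R x.
have : 'N[mu]_p[EFin \o u] <= 'N[mu]_p[EFin \o (fun x => b * gaussian e 0 x)%R].
  by apply: le_Lnorm_any => // x; rewrite (le_trans (ub x))// ler_norm.
move=> /le_trans; apply.
rewrite unlock; case: p p1 => [p|_|//].
- rewrite lee_fin => p1.
  have p0 : (0 < p)%R by exact: lt_le_trans p1.
  have V0 : (0 <= e ^- d)%R by rewrite invr_ge0 exprn_ge0// ltW.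
  have -> : inv_exponent p%:E = p^-1%R.
    by rewrite /inv_exponent inver gt_eqF.
  apply: (@le_trans _ _ ((b `^ p * e ^- d)%:E `^ p^-1)); last first.
    rewrite poweR_EFin lee_fin powRM ?powR_ge0//.
    by rewrite -powRrM mulfV ?gt_eqF// powRr1.
  apply: gt0_ler_poweR; rewrite ?invr_ge0 ?(ltW p0)// ?in_itv/= ?andbT ?leey ?integral_ge0//.
    by rewrite lee_fin mulr_ge0// powR_ge0.
  apply: (@le_trans _ _ (\int[mu]_x (b `^ p * gaussian e 0 x)%:E)).
    apply: ge0_le_integral_any => x /=; first by rewrite lee_fin powR_ge0.
    rewrite lee_fin ger0_norm ?mulr_ge0// powRM//.
    apply: ler_wpM2l; first exact: powR_ge0.
    have [->|gx] := eqVneq (gaussian e 0 x) 0%R; first by rewrite powR0// gt_eqF.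
    by apply: ge1r_powR => //; rewrite lt0r gx g0 gaussian_le1.
  rewrite le_eqVlt; apply/orP; left; apply/eqP.
  have ig := integrable_gaussian (0 : E)%R e0.
  rewrite -(Rintegral_gaussian (0 : E)%R e0) -RintegralZl// /Rintegral fineK//.
  by apply: integrable_fin_num => //; exact: integrableZl_EFin.
- rewrite lebesgue_rVT_gt0 /inv_exponent invey/= powRr0 mulr1.
  apply/ess_supP; apply: aeW => x /=; rewrite lee_fin ger0_norm ?mulr_ge0//.
  by rewrite ler_piMr// gaussian_le1.
Qed.

(** Hoelder against a Gaussian, with the conjugate norm of the Gaussian
    estimated as above. *)
Lemma integral_mul_gaussian_le (r : \bar R) (s L : R) (u : E -> R) : 1 <= r -> (0 < s)%R ->
  measurable_fun setT u -> (forall x, 0 <= u x)%R -> 'N[mu]_r[EFin \o u] <= L%:E ->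
  \int[mu]_x (u x * gaussian s 0 x)%:E <=
    (L * (s ^- d) `^ (1 - inv_exponent r))%:E.
Proof.
move=> r1 s0 mu_ u0 uL.
have g0 x := gaussian_ge0 s (0 : E)%R x.
have mg := measurable_gaussian s (0 : E)%R.
have mug : measurable_fun setT (fun x => u x * gaussian s 0 x)%R by exact: measurable_funM.
case: r r1 uL => [r|_|//].
  rewrite lee_fin le_eqVlt => /predU1P[<-|r1] uL.
    rewrite /inv_exponent inve1/= subrr powRr0 mulr1; apply: le_trans uL.
    rewrite Lnorm1; apply: ge0_le_integral_any => x; rewrite lee_fin ?mulr_ge0//.
    by rewrite ger0_norm// ler_piMr// gaussian_le1.
  have r0 : (0 < r)%R by exact: lt_trans r1.
  pose q := (r / (r - 1))%R.
  have rm : (0 < r - 1)%R by rewrite subr_gt0.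
  have q0 : (0 < q)%R by rewrite divr_gt0.
  have qE : (q^-1 = 1 - r^-1)%R by rewrite /q; field; rewrite !gt_eqF.
  have q1 : (1 <= q)%R by rewrite /q ler_pdivlMr// mul1r gerBl.
  have -> : inv_exponent r%:E = r^-1%R by rewrite /inv_exponent inver gt_eqF.
  have := @hoelder _ _ _ mu u (gaussian s 0%R) r q mu_ mg r0 q0.
  rewrite qE addrC subrK => /(_ erefl) h.
  apply: (@le_trans _ _ ('N[mu]_1[EFin \o (u \* gaussian s 0)%R])).
    rewrite Lnorm1; apply: ge0_le_integral_any => x; rewrite lee_fin ?mulr_ge0//.
    by rewrite ler_norm.
  apply: (le_trans h); clearbody q; rewrite EFinM; apply: lee_pmul => //; try exact: Lnorm_ge0.
  have := @Lnorm_gaussian_le q%:E s 1 (gaussian s 0%R) _ s0 ler01.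
  rewrite mul1r /inv_exponent inver gt_eqF//= qE; apply => //.
  by move=> x; rewrite mul1r ger0_norm.
rewrite unlock lebesgue_rVT_gt0 => /ess_supP[N [mN N0 uN]].
rewrite /inv_exponent invey/= subr0 powRr1 ?invr_ge0 ?exprn_ge0 ?(ltW s0)//.
have ig := integrable_gaussian (0 : E)%R s0.
apply: (@le_trans _ _ (\int[mu]_x (L * gaussian s 0 x)%:E)); last first.
  rewrite le_eqVlt; apply/orP; left; apply/eqP.
  rewrite -(Rintegral_gaussian (0 : E)%R s0) -RintegralZl// /Rintegral fineK//.
  by apply: integrable_fin_num => //; exact: integrableZl_EFin.
apply: ae_ge0_le_integral => //.
- by move=> x _; rewrite lee_fin mulr_ge0.
- exact/measurable_EFinP.
- move=> x _; rewrite lee_fin mulr_ge0//.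
  have [y Ny] : exists y, ~ N y.
    apply: contrapT => hN; have := lebesgue_rVT_gt0.
    rewrite (_ : setT = N) ?N0 ?ltxx//.
    by apply/seteqP; split => // y _; apply: contrapT => Ny; apply: hN; exists y.
  have : `|u y|%:E <= L%:E by apply: contrapT => ny; apply: Ny; exact: uN.
  by rewrite lee_fin; apply: le_trans.
- by apply/measurable_EFinP; exact: measurable_funM.
exists N; split => // x /= nx; apply: uN => /= uxL; apply: nx => _.
by rewrite lee_fin ler_wpM2r//; move: uxL; rewrite lee_fin; apply: le_trans; exact: ler_norm.
Qed.

End gaussian_norms.

(** * The bilinear operator on modulated Gaussians *)

Section gaussian_waves.
Context (R : realType) (d : nat).
Local Notation E := 'rV[R]_d.
Local Notation mu := (lebesgue_rV R d).
Local Notation mu2 := (mu \x mu)%E.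
Implicit Types (e : R) (u v x y a : E).

(** Modulations become translations of the heat kernel. *)
Lemma fourier_gauss_waves (I : Type) (r : seq I) (al : I -> R[i]) (w : I -> E) e xi :
  0 < e ->
  fourier (fun x => (gaussian e 0 x)%:C *
    \sum_(k <- r) al k * cis (2 * pi * dotrV x (w k))) xi =
  \sum_(k <- r) al k * (heat e (w k) xi)%:C.
Proof.
move=> e0; have H k := fourier_gaussian (0 : E) (w k - xi) e0.
transitivity (cint mu (fun x => \sum_(k <- r) al k *
    ((gaussian e 0 x)%:C * cis (2 * pi * dotrV x (w k - xi))))).
  apply: eq_cint => x; rewrite mulrAC mulr_sumr; apply: eq_bigr => k _.
  rewrite dotrVDr (mulrDr (2 * pi)) cisD (dotrVC x (- xi)) dotrVNl (dotrVC xi) mulrN.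
  by rewrite mulrCA -!mulrA; congr (_ * _); congr (_ * _); rewrite mulrC.
rewrite cint_sum; last by move=> k; apply: cintegrableZ; have [] := H k.
apply: eq_bigr => k _; have [i ck] := H k; rewrite cintZ// ck.
have -> : dotrV (0 : E) (w k - xi) = 0 by rewrite /dotrV big1// => j _; rewrite mxE mul0r.
by rewrite mulr0 cis0 mulr1 gaussian_shift gaussianC.
Qed.

(** Contribution of a pair of frequencies to the integrand of the bilinear
    operator with constant symbol. *)
Definition pair_wave e u v x (z : E * E) : R[i] :=
  (heat e u z.1 * heat e v z.2)%:C * cis (2 * pi * dotrV x (z.1 + z.2)).

Lemma integrable_heat e u : 0 < e -> mu.-integrable setT (EFin \o heat e u).
Proof.
by move=> e0; apply: integrableZl_EFin; apply: integrable_gaussian; rewrite invr_gt0.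
Qed.

Lemma cint_heat_wave e u x : 0 < e ->
  let f y := (heat e u y)%:C * cis (2 * pi * dotrV x y) in
  cintegrable mu f /\ cint mu f = (gaussian e 0 x)%:C * cis (2 * pi * dotrV x u).
Proof.
move=> e0 f; have e10 : 0 < e^-1 by rewrite invr_gt0.
have [i1 i2] := fourier_gaussian u x e10.
have fE : f = fun y => (e ^- d)%:C * ((gaussian e^-1 u y)%:C * cis (2 * pi * dotrV y x)).
  by apply/funext => y; rewrite /f /heat rmorphM/= mulrA (dotrVC x).
rewrite fE; split; first exact: cintegrableZ.
rewrite cintZ// i2 invrK mulrA -rmorphM (dotrVC u) /=; congr (_%:C * _).
by rewrite mulrA exprVn invrK mulVf ?mul1r// gt_eqF// exprn_gt0.
Qed.

(** The constant symbol gives the pointwise product of the two waves. *)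
Lemma cint_pair_wave e u v x : 0 < e ->
  cintegrable mu2 (pair_wave e u v x) /\
  cint mu2 (pair_wave e u v x) =
  (gaussian e 0 x ^+ 2)%:C * cis (2 * pi * dotrV x (u + v)).
Proof.
move=> e0; have [i1 c1] := cint_heat_wave u x e0; have [i2 c2] := cint_heat_wave v x e0.
have pE : pair_wave e u v x = fun z =>
    ((heat e u z.1)%:C * cis (2 * pi * dotrV x z.1)) *
    ((heat e v z.2)%:C * cis (2 * pi * dotrV x z.2)).
  by apply/funext => z; rewrite /pair_wave dotrVDr mulrDr cisD rmorphM/= mulrACA.
rewrite pE; split; first exact: (cintegrable_prodM i1 i2).
by rewrite (cint_prodM i1 i2) c1 c2 mulrACA -rmorphM -expr2 -cisD -mulrDr -dotrVDr.
Qed.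

Lemma integrable_heat_pair e u v : 0 < e ->
  mu2.-integrable setT (EFin \o (fun z : E * E => heat e u z.1 * heat e v z.2)).
Proof. by move=> e0; apply: integrable_prodM; exact: integrable_heat. Qed.

Lemma measurable_indic_diff (A : set E) a : measurable A ->
  measurable_fun setT (fun z : E * E => \1_A (a + z.1 - z.2) : R).
Proof.
by move=> mA; exact: (measurableT_comp (measurable_indic mA) (measurable_shear a)).
Qed.

Lemma ge0_integral_pair_translate (F : E * E -> \bar R) u v :
  measurable_fun setT F -> (forall z, (0 <= F z)%E) ->
  (\int[mu2]_z F (z.1 + u, z.2 + v)%R = \int[mu2]_z F z)%E.
Proof.
move=> mF F0.
have mF' : measurable_fun setT (fun z : E * E => F (z.1 + u, z.2 + v)%R).
  apply: (measurableT_comp mF); apply: measurable_fun_pair.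
    exact: (measurableT_comp (measurable_fun_shift u) measurable_fst).
  exact: (measurableT_comp (measurable_fun_shift v) measurable_snd).
rewrite (fubini_tonelli1 _ mF')// (fubini_tonelli1 _ mF)//.
have mI := measurable_fun_fubini_tonelli_F (m2 := mu) F mF F0.
rewrite -(ge0_integral_translate u mI); last by move=> x; exact: integral_ge0.
apply: eq_integral => x _; rewrite /fubini_F/=.
have ms : measurable_fun setT (fun y : E => (x + u, y)) by exact: measurable_fun_pair.
by apply: (ge0_integral_translate v (measurableT_comp mF ms)) => y; exact: F0.
Qed.

(** Recentring both Gaussians turns the difference of the variables into a
    step from a, up to the difference of the two frequencies. *)
Lemma integral_heat_pair_leak (w : set E) e a c1 c2 : measurable w -> 0 < e ->
  (\int[mu2]_z (heat e (a + c1) z.1 * heat e c2 z.2 *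
     \1_(~` w) (c2 - c1 + z.1 - z.2))%:E = leak w e a)%E.
Proof.
move=> mw e0; rewrite /leak integral_lebesgue_pair.
rewrite -[LHS](ge0_integral_pair_translate (a + c1) c2); last 2 first.
- apply/measurable_EFinP; apply: measurable_funM; first exact: measurable_heat2.
  by apply: measurable_indic_diff; exact: measurableC.
- by move=> z; rewrite lee_fin; apply: mulr_ge0; rewrite ?indicE//; apply: mulr_ge0; exact: heat_ge0.
apply: eq_integral => z _ /=.
rewrite -[in heat e (a + c1)](add0r (a + c1)) -[in heat e c2](add0r c2) !heat_shift.
congr (_ * \1__ _)%:E.
apply/rowP => i; rewrite !mxE; ring.
Qed.

(** Replacing a set by the constant value that it prescribes near the
    frequency difference costs the mass leaking out of the pattern set. *)
Lemma cnorm_pair_wave_pattern (A w : set E) e a c1 c2 (dl : R) (b : bool) x :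
  measurable A -> measurable w -> 0 < e -> (leak w e a <= dl%:E)%E ->
  (forall y, w y -> (y + (c1 - c2) \in A) = b) ->
  let F z := pair_wave e (a + c1) c2 x z in
  cintegrable mu2 (fun z => F z * (\1_A (z.1 - z.2))%:C) /\
  cnorm (cint mu2 (fun z => F z * (\1_A (z.1 - z.2))%:C) - b%:R * cint mu2 F)
    <= 2 * dl.
Proof.
move=> mA mw e0 lk Ab F.
have [iF _] := cint_pair_wave (a + c1) c2 x e0; rewrite -/F in iF.
have mI : measurable_fun setT (fun z : E * E => \1_A (z.1 - z.2) : R).
  have := measurable_indic_diff 0 mA.
  by congr (measurable_fun _ _); apply/funext => z; rewrite add0r.
have iFA : cintegrable mu2 (fun z => F z * (\1_A (z.1 - z.2))%:C).
  apply: (le_cintegrable (u := fun z => heat e (a + c1) z.1 * heat e c2 z.2)).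
  - apply: cmeasurableM; first exact: cintegrable_measurable iF.
    exact: cmeasurable_real.
  - move=> z; rewrite !Normc.normcM cnorm_cis mulr1 !cnorm_real.
    rewrite ger0_norm; last by apply: mulr_ge0; exact: heat_ge0.
    by apply: ler_piMr; [apply: mulr_ge0; exact: heat_ge0|rewrite indicE; case: (_ \in _); rewrite /= ?normr1 ?normr0].
  - exact: integrable_heat_pair.
split => //.
pose u (z : E * E) : R := heat e (a + c1) z.1 * heat e c2 z.2 *
     \1_(~` w) (c2 - c1 + z.1 - z.2).
have u0 z : 0 <= u z.
  by apply: mulr_ge0; rewrite ?indicE//; apply: mulr_ge0; exact: heat_ge0.
have mu_ : measurable_fun setT u.
  apply: measurable_funM; first exact: measurable_heat2.
  by apply: measurable_indic_diff; exact: measurableC.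
have iu : mu2.-integrable setT (EFin \o u).
  apply: le_integrable (integrable_heat_pair (a + c1) c2 e0) => //.
    exact/measurable_EFinP.
  move=> z _ /=; rewrite lee_fin !ger0_norm//; last by apply: mulr_ge0; exact: heat_ge0.
  by apply: ler_piMr; [apply: mulr_ge0; exact: heat_ge0|rewrite indicE; case: (_ \in _)].
rewrite -mulN1r mulrA -cintZ// -cintD//; last exact: cintegrableZ.
apply: (le_trans (cnorm_cint_le (u := u) _ iu _)).
- by apply: cintegrableD => //; exact: cintegrableZ.
- move=> z; rewrite mulrC -mulrDl Normc.normcM mulrC /u.
  have -> : cnorm (F z) = heat e (a + c1) z.1 * heat e c2 z.2.
    rewrite Normc.normcM cnorm_cis mulr1 cnorm_real ger0_norm//.
    by apply: mulr_ge0; exact: heat_ge0.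
  apply: ler_wpM2l; first by apply: mulr_ge0; exact: heat_ge0.
  rewrite !indicE in_setC; case: (boolP (_ \in w)) => [/set_mem/Ab|_] /=.
    rewrite (_ : c2 - c1 + z.1 - z.2 + (c1 - c2) = z.1 - z.2); last first.
      by apply/rowP => i; rewrite !mxE; ring.
    by move=> ->; rewrite mulN1r rmorph_nat subrr Normc.normc0.
  rewrite mulN1r rmorph_nat; case: (_ \in A); case: (b).
  + by rewrite subrr Normc.normc0.
  + by rewrite subr0 Normc.normc1.
  + by rewrite sub0r cnormN Normc.normc1.
  + by rewrite subr0 Normc.normc0.
rewrite ler_pM2l// /Rintegral -lee_fin fineK; last exact: integrable_fin_num.
by rewrite integral_heat_pair_leak.
Qed.

End gaussian_waves.

Section bilinear_gauss_waves.
Context (R : realType) (d : nat).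
Local Notation E := 'rV[R]_d.
Local Notation mu := (lebesgue_rV R d).
Local Notation mu2 := (mu \x mu)%E.

Lemma cintegrable_pair_wave_section (A : set E) e (u v x eta : E) : measurable A -> 0 < e ->
  cintegrable mu (fun xi => pair_wave e u v x (xi, eta) * (\1_A (xi - eta))%:C).
Proof.
move=> mA e0.
have ms : measurable_fun setT (fun xi : E => (xi, eta)) by exact: measurable_fun_pair.
have [iF _] := cint_pair_wave u v x e0.
apply: (le_cintegrable (u := fun xi => heat e v eta * heat e u xi)).
- apply: cmeasurableM.
    exact: (cmeasurable_comp (cintegrable_measurable iF) ms).
  apply: cmeasurable_real.
  exact: (measurableT_comp (measurable_indic mA) (measurable_fun_shift (- eta))).
- move=> z; rewrite !Normc.normcM cnorm_cis mulr1 !cnorm_real [leRHS]mulrC.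
  have h : 0 <= heat e u z * heat e v eta by apply: mulr_ge0; exact: heat_ge0.
  rewrite ger0_norm//=; apply: ler_piMr => //.
  by rewrite indicE; case: (_ \in _); rewrite /= ?normr1 ?normr0.
- by apply: integrableZl_EFin; exact: integrable_heat.
Qed.

Variables (K : finType) (al : K -> R[i]) (c : K -> E) (X A N w : set E).
Variables (M : K -> K -> bool) (e dl : R) (a : E).
Hypotheses (mA : measurable A) (mN : measurable N) (N0 : mu N = 0%E).
Hypotheses (AX : A `<=` X) (XA : X `<=` A `|` N) (mw : measurable w).
Hypotheses (e0 : 0 < e) (lk : (leak w e a <= dl%:E)%E).
Hypothesis wA : forall k l y, w y -> (y + (c k - c l) \in A) = M k l.

Definition gauss_waves (b : E) (x : E) : R[i] :=
  (gaussian e 0 x)%:C * \sum_k al k * cis (2 * pi * dotrV x (b + c k)).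

(** For fixed eta, the set X differs from A only when xi - eta is in the null
    set N, which the inner integral ignores; the symbol being measurable after
    this replacement, Fubini applies. *)
Lemma bilinear_gauss_wavesE x :
  bilinear_op (cindic X) (gauss_waves a) (gauss_waves 0) x =
  \sum_(p : K * K) al p.1 * al p.2 *
    cint mu2 (fun z => pair_wave e (a + c p.1) (c p.2) x z * (\1_A (z.1 - z.2))%:C).
Proof.
pose F (z : E * E) := \sum_(p : K * K) al p.1 * al p.2 *
    (pair_wave e (a + c p.1) (c p.2) x z * (\1_A (z.1 - z.2))%:C).
have iP (p : K * K) := (cnorm_pair_wave_pattern x mA mw e0 lk (@wA p.1 p.2)).1.
have iF eta : cintegrable mu (fun xi => F (xi, eta)).
  by apply: cintegrable_sum => p; apply: cintegrableZ; exact: cintegrable_pair_wave_section.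
transitivity (cint mu (fun eta => cint mu (fun xi => F (xi, eta)))).
  apply: eq_cint => eta.
  have mNe : measurable [set xi : E | N (xi - eta)] by exact: measurable_shift_preimage.
  apply: (cint_off_null (N := [set xi : E | N (xi - eta)]) mNe).
  - by rewrite -[RHS]N0; exact: lebesgue_rV_translate.
  - exact: cintegrable_measurable (iF eta).
  move=> xi nN /=.
  have -> : cindic X (xi - eta) = (\1_A (xi - eta))%:C.
    rewrite /cindic !indicE; congr (_%:R)%:C; congr nat_of_bool.
    by apply/idP/idP => /set_mem h; apply/mem_set; [have [] := XA h|exact: AX].
  rewrite !fourier_gauss_waves// /F mulr_suml.
  rewrite -(pair_bigA _ (fun k l => al k * al l *
    (pair_wave e (a + c k) (c l) x (xi, eta) * (\1_A (xi - eta))%:C)))/=.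
  rewrite mulr_suml mulr_suml; apply: eq_bigr => k _.
  rewrite mulr_sumr mulr_suml mulr_suml; apply: eq_bigr => l _.
  rewrite add0r /pair_wave /= (rmorphM _ (heat e (a + c k) xi)) /=.
  move: (al k) (al l) (_%:C) (_%:C) (_%:C) (cis _) => z1 z2 z3 z4 z5 z6; ring.
rewrite (cint_fubini (f := F))//; last first.
  by apply: cintegrable_sum => p; apply: cintegrableZ; exact: iP.
rewrite cint_sum; last by move=> p; apply: cintegrableZ; exact: iP.
by apply: eq_bigr => p _; rewrite cintZ//; exact: iP.
Qed.

Lemma bilinear_gauss_waves_approx x :
  cnorm (bilinear_op (cindic X) (gauss_waves a) (gauss_waves 0) x -
    (gaussian e 0 x ^+ 2)%:C * \sum_(p : K * K) al p.1 * al p.2 * (M p.1 p.2)%:R *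
      cis (2 * pi * dotrV x (a + c p.1 + c p.2))) <=
  \sum_(p : K * K) cnorm (al p.1) * cnorm (al p.2) * (2 * dl).
Proof.
rewrite bilinear_gauss_wavesE mulr_sumr -sumrB.
apply: (le_trans (cnorm_sum _ _ _)); apply: ler_sum => p _.
have [_ h] := cnorm_pair_wave_pattern x mA mw e0 lk (@wA p.1 p.2).
have [_ wE] := cint_pair_wave (a + c p.1) (c p.2) x e0.
move: h; rewrite wE; set I := cint _ _ => h.
set z := _%:C; set y := cis _.
have -> : al p.1 * al p.2 * I - z * (al p.1 * al p.2 * (M p.1 p.2)%:R * y) =
    al p.1 * al p.2 * (I - (M p.1 p.2)%:R * (z * y)) by ring.
by rewrite !Normc.normcM; apply: ler_wpM2l => //; apply: mulr_ge0; exact: cnorm_ge0.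
Qed.

End bilinear_gauss_waves.

(** * Correlation of the waves with the dual polynomial *)

Section correlation.
Context (R : realType) (d D : nat).
Local Notation E := 'rV[R]_d.
Local Notation mu := (lebesgue_rV R d).
Local Notation K := {ffun 'I_D -> 'I_3}.
Local Notation M5 := {ffun 'I_D -> 'I_5}.
Variables (t a : E).

Definition wave_freq (k : K) : E := (freq k)%:~R *: t.

(** The main term of the bilinear operator, without its Gaussian factor. *)
Definition product_wave (x : E) : R[i] :=
  \sum_(p : K * K) alpha R p.1 * alpha R p.2 * (even_spread p.1 p.2)%:R *
    cis (2 * pi * dotrV x (a + wave_freq p.1 + wave_freq p.2)).

Definition dual_wave (x : E) : R[i] :=
  \sum_(m : M5) beta R m * cis (2 * pi * dotrV x (a + (freq2 m)%:~R *: t)).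

Definition coef_mass : R :=
  \sum_(p : K * K * M5) cnorm (alpha R p.1.1) * cnorm (alpha R p.1.2) * cnorm (beta R p.2).

(** A nonzero multiple of t is at least as long as t, and a Gaussian decays at
    least like the inverse square. *)
Lemma gaussian_far (s : R) (n : int) : 0 < s -> n != 0 -> t != 0 ->
  gaussian s^-1 0 (n%:~R *: t) <= s ^+ 2 / (pi * \sum_i t 0 i ^+ 2).
Proof.
move=> s0 n0 t0; set Q := \sum_i _.
have Q0 : 0 < Q.
  have [i ti] : exists i, t 0 i != 0.
    apply: contrapT => h; move/eqP: t0; apply; apply/rowP => i; rewrite mxE.
    by apply: contrapT => /eqP ti; apply: h; exists i.
  rewrite /Q (bigD1 i)//= ltr_pwDl// ?lt0r ?sqrf_eq0 ?ti ?sqr_ge0//.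
  by apply: sumr_ge0 => j _; exact: sqr_ge0.
have pi0 := pi_gt0 R.
have y0 : 0 < pi * Q / s ^+ 2 by rewrite divr_gt0 ?mulr_gt0// exprn_gt0.
have -> : s ^+ 2 / (pi * Q) = (pi * Q / s ^+ 2)^-1 by rewrite invf_div.
rewrite /gaussian expRN lef_pV2 ?posrE ?expR_gt0//.
apply: (@le_trans _ _ (expR (pi * Q / s ^+ 2))).
  by rewrite (le_trans _ (expR_ge1Dx _))// lerDr.
rewrite ler_expR exprVn mulrAC ler_wpM2l//.
  by rewrite mulr_ge0 ?pi_ge0// invr_ge0 sqr_ge0.
rewrite /Q; apply: ler_sum => i _.
rewrite !mxE subr0 exprMn ler_peMl ?sqr_ge0// sqr_intr_ge1 ?intr_int ?intr_eq0//.
Qed.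

Lemma measurable_product_wave : cmeasurable product_wave.
Proof.
apply: cmeasurable_sum => p _; apply: cmeasurableM; first exact: cmeasurable_cst.
apply: cmeasurable_cis; apply: measurable_funM => //.
rewrite (_ : (fun x => _) = fun x : E => dotrV x (a + wave_freq p.1 + wave_freq p.2))//.
exact: measurable_dotrV.
Qed.

Lemma cnorm_dual_wave x : cnorm (dual_wave x) <= (5 / 4) ^+ D.
Proof.
rewrite (_ : dual_wave x = cis (2 * pi * dotrV x a) *
  \sum_(m : M5) beta R m * cis (2 * pi * ((freq2 m)%:~R * dotrV x t))).
  by rewrite Normc.normcM cnorm_cis mul1r cnorm_sum_beta.
rewrite mulr_sumr; apply: eq_bigr => m _.
by rewrite mulrCA -cisD -mulrDr dotrVDr dotrVZr.
Qed.

Lemma cnorm_gauss_waves e b x :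
  cnorm (gauss_waves (@alpha R D) wave_freq e b x) <= Num.sqrt 2 ^+ D * gaussian e 0 x.
Proof.
rewrite /gauss_waves (_ : \sum_k _ = cis (2 * pi * dotrV x b) *
  \sum_(k : K) alpha R k * cis (2 * pi * ((freq k)%:~R * dotrV x t))); last first.
  rewrite mulr_sumr; apply: eq_bigr => m _.
  by rewrite mulrCA -cisD -mulrDr dotrVDr dotrVZr.
rewrite !Normc.normcM cnorm_cis mul1r cnorm_real ger0_norm ?gaussian_ge0// mulrC.
by apply: ler_wpM2r; [exact: gaussian_ge0|exact: cnorm_sum_alpha].
Qed.

Lemma cnorm_product_wave x : cnorm (product_wave x) <=
  \sum_(p : K * K) cnorm (alpha R p.1) * cnorm (alpha R p.2).
Proof.
apply: (le_trans (cnorm_sum _ _ _)); apply: ler_sum => p _.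
rewrite !Normc.normcM cnorm_cis mulr1; apply: ler_piMr.
  by apply: mulr_ge0; exact: cnorm_ge0.
by case: even_spread; rewrite (mulr1n, mulr0n) ?Normc.normc1// Normc.normc0.
Qed.

Definition triple_coef (p : K * K * M5) : R[i] :=
  alpha R p.1.1 * alpha R p.1.2 * (even_spread p.1.1 p.1.2)%:R * (beta R p.2)^*.
Definition triple_freq (p : K * K * M5) : int :=
  freq p.1.1 + freq p.1.2 - freq2 p.2.

Lemma cnorm_conj (z : R[i]) : cnorm (z^*)%R = cnorm z.
Proof. by case: z => x y /=; rewrite sqrrN. Qed.

Lemma conjM (z1 z2 : R[i]) : ((z1 * z2)^* = z1^* * z2^*)%R.
Proof. exact: rmorphM. Qed.

Lemma conj_sum (I : finType) (F : I -> R[i]) : ((\sum_i F i)^* = \sum_i (F i)^*)%R.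
Proof. exact: rmorph_sum. Qed.

Lemma conj_cis (y : R) : ((cis y)^* = cis (- y))%R.
Proof. by rewrite /cis cosN sinN. Qed.

(** The base frequency a cancels. *)
Lemma product_dual_wave x : product_wave x * (dual_wave x)^* =
  \sum_(p : K * K * M5) triple_coef p *
    cis (2 * pi * dotrV x ((triple_freq p)%:~R *: t)).
Proof.
rewrite -(pair_bigA _ (fun p m => triple_coef (p, m) *
    cis (2 * pi * dotrV x ((triple_freq (p, m))%:~R *: t))))/=.
rewrite mulr_suml; apply: eq_bigr => p _; rewrite /dual_wave conj_sum mulr_sumr.
apply: eq_bigr => m _; rewrite conjM conj_cis mulrACA -cisD /triple_coef /triple_freq /=.
congr (_ * cis _).
rewrite !dotrVDr !dotrVZr rmorphB rmorphD /=; ring.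
Qed.

Lemma cint_correlation s : 0 < s ->
  let f x := (gaussian s 0 x)%:C * (product_wave x * (dual_wave x)^*) in
  cintegrable mu f /\
  cint mu f = \sum_(p : K * K * M5) triple_coef p *
    (s ^- d * gaussian s^-1 0 ((triple_freq p)%:~R *: t))%:C.
Proof.
move=> s0 f; have H p := fourier_gaussian (0 : E) ((triple_freq p)%:~R *: t) s0.
have fE : f = fun x => \sum_(p : K * K * M5) triple_coef p *
    ((gaussian s 0 x)%:C * cis (2 * pi * dotrV x ((triple_freq p)%:~R *: t))).
  apply/funext => x; rewrite /f product_dual_wave mulr_sumr.
  by apply: eq_bigr => p _; rewrite mulrCA.
have iF p : cintegrable mu (fun x => triple_coef p *
    ((gaussian s 0 x)%:C * cis (2 * pi * dotrV x ((triple_freq p)%:~R *: t)))).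
  by apply: cintegrableZ; have [] := H p.
rewrite fE; split; first exact: cintegrable_sum.
rewrite cint_sum//; apply: eq_bigr => p _.
have [i ck] := H p; rewrite cintZ// ck.
have -> : dotrV (0 : E) ((triple_freq p)%:~R *: t) = 0.
  by rewrite /dotrV big1// => j _; rewrite mxE mul0r.
by rewrite mulr0 cis0 mulr1.
Qed.

(** The zero frequencies give the diagonal sum; the other ones are damped by
    the Gaussian and together cost at most 1/2, which is absorbed by the
    first half [(25/16) ^ D >= 1] of the diagonal sum. *)
Lemma correlation_ge s eta : 0 < s ->
  (forall n : int, n != 0 -> gaussian s^-1 0 (n%:~R *: t) <= eta) ->
  0 <= eta -> coef_mass * eta <= 2^-1 ->
  s ^- d * ((41 / 16) ^+ D / 2) <=
  cnorm (cint mu (fun x => (gaussian s 0 x)%:C * (product_wave x * (dual_wave x)^*))).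
Proof.
move=> s0 far eta0 Ceta; have [_ ->] := cint_correlation s0.
have sd0 : 0 <= s ^- d by rewrite invr_ge0 exprn_ge0// ltW.
set J := \sum_p _.
pose diag : R := ((25 / 16) ^+ D + (41 / 16) ^+ D) / 2.
pose Off := \sum_(p : K * K * M5) (if triple_freq p == 0 then 0 else
  triple_coef p * (gaussian s^-1 0 ((triple_freq p)%:~R *: t))%:C).
have JE : J = (s ^- d)%:C * (diag%:C + Off).
  rewrite /diag -diagonal_sum (pair_bigA _ (fun k l => \sum_m _))/=.
  rewrite (pair_bigA _ (fun (p : K * K) (m : M5) => if _ then _ else _))/=.
  rewrite -big_split mulr_sumr; apply: eq_bigr => p _ /=.
  rewrite rmorphM mulrCA; congr (_ * _).
  rewrite -/(triple_freq p) /triple_coef; case: eqP => [->|_]/=; last by rewrite add0r.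
  rewrite scale0r; have -> : gaussian s^-1 (0 : E) 0 = 1.
    by rewrite /gaussian big1 ?mulr0 ?oppr0 ?expR0// => i _; rewrite subrr expr0n.
  by case: even_spread; rewrite /= ?mulr1 ?addr0// mulr0 mul0r.
have Off_le : cnorm Off <= 2^-1.
  apply: le_trans Ceta; apply: (le_trans (cnorm_sum _ _ _)).
  rewrite /coef_mass mulr_suml; apply: ler_sum => p _.
  have c0 : 0 <= cnorm (alpha R p.1.1) * cnorm (alpha R p.1.2) * cnorm (beta R p.2).
    by apply: mulr_ge0; [apply: mulr_ge0|]; exact: cnorm_ge0.
  case: ifPn => [_|/far n0]; first by rewrite Normc.normc0 mulr_ge0.
  rewrite /triple_coef !Normc.normcM cnorm_real ger0_norm ?gaussian_ge0//.
  apply: ler_pM => //; first 2 last.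
  - case: even_spread; rewrite (mulr1n, mulr0n) ?Normc.normc1 ?Normc.normc0 ?mulr1 ?mulr0 ?mul0r//.
    by rewrite cnorm_conj.
  - by apply: mulr_ge0; [apply: mulr_ge0; [apply: mulr_ge0|]|]; exact: cnorm_ge0.
  - exact: gaussian_ge0.
rewrite JE Normc.normcM cnorm_real ger0_norm//; apply: ler_wpM2l => //.
have le1 : 1 <= (25 / 16 : R) ^+ D by apply: exprn_ege1; lra.
have : diag <= cnorm (diag%:C + Off) + cnorm Off.
  have d0 : 0 <= diag by rewrite divr_ge0// addr_ge0// exprn_ge0.
  rewrite -{1}(ger0_norm d0) -cnorm_real -{1}[_%:C](addrK Off).
  rewrite (le_trans (le_normcD _ _))// lerD2l.
  by rewrite cnormN.
rewrite /diag; move: Off_le le1; lra.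
Qed.

End correlation.

(** * Testing the multiplier *)

Section testing.
Context (R : realType) (d D : nat).
Local Notation E := 'rV[R]_d.
Local Notation mu := (lebesgue_rV R d).
Local Notation K := {ffun 'I_D -> 'I_3}.
Variables (t a : E) (e : R).
Hypothesis e0 : 0 < e.

(** The width e / 2 of the weight is chosen so that [2 + 1 / 4 = (3 / 2) ^ 2]. *)
Lemma gaussian_mul3 (x : E) :
  gaussian e 0 x ^+ 2 * gaussian (e / 2) 0 x = gaussian (3 * e / 2) 0 x.
Proof.
rewrite /gaussian expr2 -!expRD; congr expR; set S := \sum_i _; by field.
Qed.

Local Notation B := (product_wave D t a).

Lemma integrable_weighted_wave :
  mu.-integrable setT (EFin \o (fun x => gaussian (3 * e / 2) 0 x * cnorm (B x))).
Proof.
have s0 : 0 < 3 * e / 2 by rewrite divr_gt0// mulr_gt0.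
set C := \sum_(p : K * K) cnorm (alpha R p.1) * cnorm (alpha R p.2).
have iC : mu.-integrable setT (EFin \o (fun x => C * gaussian (3 * e / 2) 0 x)).
  by apply: integrableZl_EFin; exact: integrable_gaussian.
apply: le_integrable iC => //.
  apply/measurable_EFinP; apply: measurable_funM; first exact: measurable_gaussian.
  exact: measurable_cnorm (measurable_product_wave _ _ _).
move=> x _; rewrite /= lee_fin !normrM [leRHS]mulrC; apply: ler_wpM2l => //.
rewrite ger0_norm ?cnorm_ge0// (le_trans (cnorm_product_wave _ _ _ _))//; exact: ler_norm.
Qed.

(** Duality: pairing with the dual polynomial, bounded by [(5 / 4) ^ D]. *)
Lemma weighted_wave_ge eta :
  (forall n : int, n != 0 -> gaussian (3 * e / 2)^-1 0 (n%:~R *: t) <= eta) ->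
  0 <= eta -> coef_mass R D * eta <= 2^-1 ->
  (3 * e / 2) ^- d * ((41 / 16) ^+ D / 2) <=
  2 * (5 / 4) ^+ D *
    Rintegral mu setT (fun x => gaussian (3 * e / 2) 0 x * cnorm (B x)).
Proof.
move=> far eta0 Ceta; have s0 : 0 < 3 * e / 2 by rewrite divr_gt0// mulr_gt0.
apply: (le_trans (correlation_ge a s0 far eta0 Ceta)).
have [ii _] := cint_correlation D t a s0.
rewrite -(mulrA 2) -RintegralZl//; last exact: integrable_weighted_wave.
apply: cnorm_cint_le => //.
  by apply: integrableZl_EFin; exact: integrable_weighted_wave.
move=> x; rewrite !Normc.normcM cnorm_conj cnorm_real ger0_norm ?gaussian_ge0//.
rewrite [leRHS]mulrC -[leRHS]mulrA; apply: ler_wpM2l; first exact: gaussian_ge0.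
by apply: ler_wpM2l; [exact: cnorm_ge0|exact: cnorm_dual_wave].
Qed.

(** The image h is only known to be uniformly close to the main term, and may
    be nonmeasurable; the measurable minorant [max 0 (K ^ 2 |B| - 1)] of its
    modulus is integrated against the weight in its place. *)
Lemma weighted_wave_le (h : E -> R[i]) (r : \bar R) (L : R) : (1 <= r)%E -> 0 <= L ->
  (cLnorm r h <= L%:E)%E ->
  (forall x, cnorm (h x - (gaussian e 0 x ^+ 2)%:C * B x) <= 1) ->
  Rintegral mu setT (fun x => gaussian (3 * e / 2) 0 x * cnorm (B x)) <=
  L * ((e / 2) ^- d) `^ (1 - inv_exponent r) + (e / 2) ^- d.
Proof.
move=> r1 L0 hL hB; have s0 : 0 < e / 2 by rewrite divr_gt0.
pose v x : R := gaussian e 0 x ^+ 2 * cnorm (B x) - 1.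
pose u x : R := Num.max 0 (v x).
have mu_ : measurable_fun setT u.
  apply: measurable_maxr; first exact: measurable_cst.
  apply: measurable_funB; last exact: measurable_cst.
  apply: measurable_funM; first by apply: measurable_funX; exact: measurable_gaussian.
  exact: measurable_cnorm (measurable_product_wave _ _ _).
have u0 x : 0 <= u x by rewrite le_max lexx.
have uh x : `|u x| <= `|cnorm (h x)|.
  rewrite !ger0_norm ?cnorm_ge0// ge_max cnorm_ge0/= /v lerBlDr.
  have -> : gaussian e 0 x ^+ 2 * cnorm (B x) = cnorm ((gaussian e 0 x ^+ 2)%:C * B x).
    by rewrite Normc.normcM cnorm_real ger0_norm// exprn_ge0// gaussian_ge0.
  set z := _ * B x; rewrite -[z in leLHS](subrK (h x)) addrC.
  rewrite (le_trans (le_normcD _ _))// lerD2l -cnormN opprB; exact: hB.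
have uL := le_trans (le_Lnorm_any mu r1 uh) hL.
have H := integral_mul_gaussian_le r1 s0 mu_ u0 uL.
have ig := integrable_gaussian (0 : E) s0.
have iw := integrable_weighted_wave.
rewrite -lee_fin /Rintegral fineK; last exact: integrable_fin_num.
rewrite EFinD; apply: le_trans (leeD2r _ H).
rewrite -(Rintegral_gaussian (0 : E) s0) /Rintegral fineK; last exact: integrable_fin_num.
rewrite -ge0_integralD//=; first last.
- by apply/measurable_EFinP; exact: measurable_gaussian.
- by move=> x _; rewrite lee_fin gaussian_ge0.
- apply/measurable_EFinP; apply: measurable_funM => //; exact: measurable_gaussian.
- by move=> x _; rewrite lee_fin mulr_ge0// gaussian_ge0.
apply: ge0_le_integral_any => x /=; rewrite ?lee_fin.
  by rewrite mulr_ge0 ?gaussian_ge0 ?cnorm_ge0.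
rewrite -gaussian_mul3 mulrAC -[X in _ <= _ + X]mul1r -mulrDl.
by apply: ler_wpM2r; [exact: gaussian_ge0|rewrite -lerBlDr le_max lexx orbT].
Qed.

End testing.

(** * The contradiction *)

Section growth.
Context (R : realType).

Lemma bernoulli (x : R) n : 0 <= x -> 1 + n%:R * x <= (1 + x) ^+ n.
Proof.
move=> x0; elim: n => [|n ih]; first by rewrite mul0r addr0.
rewrite exprS; apply: le_trans (ler_wpM2l _ ih); last by rewrite addr_ge0.
rewrite mulrDr mulrDl !mul1r mulr1 -natr1.
have : 0 <= n%:R * x * x by rewrite mulr_ge0// mulr_ge0.
lra.
Qed.

Lemma exp_growth (b : R) : exists D : nat, (0 < D)%N /\ b < (41 / 40) ^+ D.
Proof.
(* The step 1/40 of the Bernoulli inequality decides how large D has to be. *)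
pose D := (Num.truncn (40 * `|b|)).+1.
exists D; split => //; have x0 : 0 <= 40^-1 :> R by rewrite invr_ge0.
have := bernoulli D x0; have -> : 1 + 40^-1 = 41 / 40 :> R by field.
have bD : 40 * `|b| < D%:R by rewrite truncnS_gt.
have := ler_norm b; move: bD; set z : R := D%:R; set y := _ ^+ D; lra.
Qed.

(** Here V is the volume scale e ^ - d, which drops out. The last factor is
    [41 / 40 = (41 / 16) / (2 * (5 / 4))]. *)
Lemma growth_bound (d D : nat) (C V L X : R) : 0 < V -> 0 < C ->
  L <= 2 ^+ d * V * (C * 2 ^+ D + 1) ->
  (2 / 3) ^+ d * V * ((41 / 16) ^+ D / 2) <= 2 * (5 / 4) ^+ D * X -> X <= L ->
  (41 / 40) ^+ D <= 4 * 3 ^+ d * (C + 1) :> R.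
Proof.
move=> V0 C0 hL h1 h2.
have Y0 : 0 < (5 / 4 : R) ^+ D by rewrite exprn_gt0.
have D2 : 1 <= (2 : R) ^+ D by apply: exprn_ege1; lra.
have d0 : 0 < (2 / 3 : R) ^+ d by rewrite exprn_gt0.
have E1 : (41 / 16 : R) ^+ D = (41 / 40) ^+ D * ((5 / 4) ^+ D * 2 ^+ D).
  by rewrite -!exprMn; congr (_ ^+ _); field.
have E2 : (2 : R) ^+ d = (2 / 3) ^+ d * 3 ^+ d.
  by rewrite -exprMn; congr (_ ^+ _); field.
have K0 : 0 < (2 / 3) ^+ d * V * ((5 / 4) ^+ D * 2 ^+ D / 2) :> R.
  by rewrite !mulr_gt0// ?invr_gt0//; lra.
rewrite -(ler_pM2l K0).
have -> : (2 / 3) ^+ d * V * ((5 / 4) ^+ D * 2 ^+ D / 2) * (41 / 40) ^+ D =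
  (2 / 3) ^+ d * V * ((41 / 16) ^+ D / 2) by rewrite E1; ring.
apply: (le_trans h1); apply: (@le_trans _ _ (2 * (5 / 4) ^+ D * (2 ^+ d * V * (C * 2 ^+ D + 1)))).
  by apply: ler_wpM2l; [rewrite mulr_ge0// ltW|exact: le_trans h2 hL].
rewrite E2.
have -> : (2 / 3) ^+ d * V * ((5 / 4) ^+ D * 2 ^+ D / 2) * (4 * 3 ^+ d * (C + 1)) =
  2 * (5 / 4) ^+ D * ((2 / 3) ^+ d * 3 ^+ d * V * (C * 2 ^+ D + 2 ^+ D)) by field.
apply: ler_wpM2l; first by rewrite mulr_ge0// ltW.
by apply: ler_wpM2l; [rewrite !mulr_ge0// ltW|rewrite lerD2l].
Qed.

Lemma fine_inv_exponent (p : \bar R) : (1 <= p)%E ->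
  (inv_exponent p)%:E = p^-1%E /\ 0 <= inv_exponent p <= 1.
Proof.
case: p => [p|_|//]; rewrite /inv_exponent.
  rewrite lee_fin => p1; have p0 : 0 < p by exact: lt_le_trans p1.
  by rewrite inver gt_eqF//= invr_ge0 ltW//= invf_le1.
by rewrite invey/= lexx ler01.
Qed.

(** The powers of e from p and q combine with the one from the conjugate of r
    to the single factor V. *)
Lemma gaussian_scale_bound (d D : nat) (p q r : \bar R) (C e b : R) :
  (1 <= p)%E -> (1 <= q)%E -> (1 <= r)%E -> (p^-1 + q^-1 = r^-1)%E ->
  0 < C -> 0 < e -> b * b = 2 ^+ D ->
  let V := e ^- d in
  C * ((b * V `^ inv_exponent p) * (b * V `^ inv_exponent q)) *
    ((e / 2) ^- d) `^ (1 - inv_exponent r) + (e / 2) ^- d <=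
  2 ^+ d * V * (C * 2 ^+ D + 1).
Proof.
move=> p1 q1 r1 pqr C0 e0 bb; rewrite /=; set V := e ^- d.
have [pE _] := fine_inv_exponent p1; have [qE _] := fine_inv_exponent q1.
have [rE /andP[ir0 ir1]] := fine_inv_exponent r1.
have V0 : 0 < V by rewrite invr_gt0 exprn_gt0.
have pqE : inv_exponent p + inv_exponent q = inv_exponent r.
  by apply: EFin_inj; rewrite EFinD pE qE rE.
have -> : (e / 2) ^- d = 2 ^+ d * V by rewrite exprMn exprVn invfM invrK mulrC.
have -> : C * ((b * V `^ inv_exponent p) * (b * V `^ inv_exponent q)) =
    C * 2 ^+ D * V `^ inv_exponent r.
  rewrite mulrACA bb -powRD ?pqE ?mulrA//.
  by apply/implyP => _; rewrite gt_eqF.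
have d2 : 1 <= (2 : R) ^+ d by apply: exprn_ege1; lra.
rewrite powRM ?(ltW V0) ?exprn_ge0//.
have -> : C * 2 ^+ D * V `^ inv_exponent r *
   ((2 ^+ d) `^ (1 - inv_exponent r) * V `^ (1 - inv_exponent r)) =
   C * 2 ^+ D * ((2 ^+ d) `^ (1 - inv_exponent r) *
     (V `^ inv_exponent r * V `^ (1 - inv_exponent r))) by ring.
rewrite -powRD; last by apply/implyP => _; rewrite gt_eqF.
rewrite [inv_exponent r + _]addrC subrK powRr1 ?(ltW V0)//.
have le2 : (2 ^+ d) `^ (1 - inv_exponent r) <= (2 : R) ^+ d.
  by apply: ler1_powR => //; rewrite lerBlDr lerDl.
have -> : 2 ^+ d * V * (C * 2 ^+ D + 1) = C * 2 ^+ D * (2 ^+ d * V) + 2 ^+ d * V by ring.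
rewrite lerD2r; apply: ler_wpM2l.
  by rewrite mulr_ge0 ?exprn_ge0// ltW.
by apply: ler_wpM2r => //; exact: ltW.
Qed.

End growth.

Section contradiction.
Context (R : realType) (d : nat).
Local Notation E := 'rV[R]_d.
Local Notation mu := (lebesgue_rV R d).

(** The pattern treats two differences of frequencies differently, hence
    cannot be read on a constant progression. *)
Lemma pattern_nontrivial D (A w : set E) (t : E) : (0 < D)%N -> w !=set0 ->
  (forall k l y, w y -> (y + (wave_freq t k - wave_freq t l) \in A) = @even_spread D k l) ->
  t != 0.
Proof.
case: D => // D _ [y wy] wA; apply/eqP => t0.
(* These frequencies have exactly one pair of opposite digits. *)
pose k : {ffun 'I_D.+1 -> 'I_3} := [ffun j => if j == ord0 then ord_max else ord0].
pose l : {ffun 'I_D.+1 -> 'I_3} := [ffun=> ord0].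
have h := wA k l y wy; have h' := wA l l y wy; move: h h'.
rewrite /wave_freq t0 !scaler0 => ->.
rewrite /even_spread !big_ord_recl !big1/=; last 2 first.
- by move=> j _; rewrite /spread !ffunE /=.
- by move=> j _; rewrite /spread !ffunE /=.
by rewrite /spread !ffunE /=.
Qed.

Lemma small_width (Q cm e1 : R) : 0 < Q -> 0 <= cm -> 0 < e1 ->
  exists e, [/\ 0 < e, e <= e1 & cm * ((3 * e / 2) ^+ 2 / Q) <= 2^-1].
Proof.
move=> Q0 cm0 e10; pose k := 2 * Q / (9 * (cm + 1)).
have cm1 : 0 < cm + 1 by rewrite ltr_wpDl.
have k0 : 0 < k by rewrite divr_gt0 ?mulr_gt0.
pose e := Num.min e1 (Num.min 1 k).
have e0 : 0 < e by rewrite !lt_min e10 ltr01.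
have e1' : e <= 1 by rewrite !ge_min lexx orbT.
have ek : e <= k by rewrite !ge_min lexx !orbT.
exists e; split => //; first by rewrite ge_min lexx.
have ee : e ^+ 2 <= k by apply: le_trans ek; rewrite expr2 ler_piMr// ltW.
have -> : cm * ((3 * e / 2) ^+ 2 / Q) = cm * (9 / 4 / Q) * e ^+ 2.
  by field; rewrite gt_eqF.
apply: (@le_trans _ _ (cm * (9 / 4 / Q) * k)).
  by apply: ler_wpM2l => //; rewrite mulr_ge0// !divr_ge0// ltW.
have -> : cm * (9 / 4 / Q) * k = 2^-1 * (cm / (cm + 1)).
  by rewrite /k; field; rewrite !gt_eqF.
by rewrite ler_piMr// ler_pdivrMr// mul1r lerDl.
Qed.

(** The constants are chosen in this order: the number D of digits against
    the norm of the operator, then the step t of a progression realizing the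
    pattern, then the width e, and last the base point a. *)
Lemma not_open_not_multiplier (X : set E) (p q r : \bar R) :
  lebesgue_measurable X -> (1 <= p)%E -> (1 <= q)%E -> (1 <= r)%E ->
  (p^-1 + q^-1 = r^-1)%E ->
  (forall U : set E, open U -> ~ lebesgue_equiv X U) ->
  ~ bilinear_multiplier_symbol p q r (cindic X).
Proof.
move=> mX p1 q1 r1 pqr noU [C [C0 hC]].
have [D [D0 big]] := exp_growth (4 * 3 ^+ d * (C + 1)).
have [A [N [w [t [r0 [[mA mN] [N0 [AX XA]] [mw w0] [r00 wr] pat]]]]]] :=
  not_open_pattern (all_diffs D) (odd_diffs D) mX noU.
have wA (k l : {ffun 'I_D -> 'I_3}) y : w y ->
    (y + (wave_freq t k - wave_freq t l) \in A) = even_spread k l.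
  move=> wy; have [h1 h2] := pat y _ wy (mem_all_diffs k l).
  rewrite mem_odd_diffs in h1 h2.
  have e : (freq k - freq l)%:~R *: t = wave_freq t k - wave_freq t l.
    by rewrite rmorphB scalerBl.
  rewrite e in h1 h2; case: (boolP (even_spread k l)) => kl.
    by apply/mem_set/h2; rewrite kl.
  by apply/negbTE; rewrite notin_setE; exact: h1.
have t0 : t != 0.
  apply: (pattern_nontrivial (w := w) D0 _ wA).
  by apply/set0P; apply: contraTneq w0 => ->; rewrite measure0 ltxx.
pose Q := pi * \sum_i t 0 i ^+ 2.
have Q0 : 0 < Q.
  rewrite mulr_gt0 ?pi_gt0// lt0r sumr_ge0 ?andbT => [|i _]; last exact: sqr_ge0.
  apply: contra t0 => /eqP /psumr_eq0P h; apply/eqP/rowP => i; rewrite mxE.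
  by apply/eqP; rewrite -sqrf_eq0 h// => j _; exact: sqr_ge0.
pose S := \sum_(p : {ffun 'I_D -> 'I_3} * {ffun 'I_D -> 'I_3})
  cnorm (alpha R p.1) * cnorm (alpha R p.2).
have S0 : 0 <= S by apply: sumr_ge0 => k _; apply: mulr_ge0; exact: cnorm_ge0.
(* The error in the main term is at most S times 2 dl, hence at most 1. *)
pose dl := (2 * (S + 1))^-1.
have S1 : 0 < S + 1 by rewrite ltr_wpDl.
have dl0 : 0 < dl by rewrite invr_gt0 mulr_gt0.
have [e1 e10 good] := good_point mw r00 wr w0 dl0.
have cm0 : 0 <= coef_mass R D.
  by apply: sumr_ge0 => k _; apply: mulr_ge0; [apply: mulr_ge0|]; exact: cnorm_ge0.
have [e [e0 ee1 small]] := small_width Q0 cm0 e10.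
have [a wa lk] := good e e0 ee1.
set eta := _ / Q in small.
have s0 : 0 < 3 * e / 2 by rewrite divr_gt0// mulr_gt0.
have far (n : int) : n != 0 -> gaussian (3 * e / 2)^-1 0 (n%:~R *: t) <= eta.
  by move=> n0; exact: gaussian_far.
have eta0 : 0 <= eta by rewrite divr_ge0 ?sqr_ge0// ltW.
have lower := weighted_wave_ge a e0 far eta0 small.
pose F b := gauss_waves (@alpha R D) (wave_freq t) e b.
have sF b : schwartz (F b) by exact: schwartz_gauss_trig.
pose b2 : R := Num.sqrt 2 ^+ D.
have b20 : 0 <= b2 by rewrite exprn_ge0// sqrtr_ge0.
have bb : b2 * b2 = 2 ^+ D by rewrite /b2 -exprMn -expr2 sqr_sqrtr.
have nF s b : (1 <= s)%E -> (cLnorm s (F b) <= (b2 * (e ^- d) `^ inv_exponent s)%:E)%E.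
  move=> s1; apply: Lnorm_gaussian_le => // x.
  by rewrite ger0_norm ?cnorm_ge0//; exact: cnorm_gauss_waves.
pose h := bilinear_op (cindic X) (F a) (F 0).
pose L := C * ((b2 * (e ^- d) `^ inv_exponent p) * (b2 * (e ^- d) `^ inv_exponent q)).
have hL : (cLnorm r h <= L%:E)%E.
  apply: (le_trans (hC _ _ (sF a) (sF 0))); rewrite /L EFinM.
  apply: lee_wpmul2l; first by rewrite lee_fin ltW.
  by rewrite EFinM; apply: lee_pmul; rewrite ?Lnorm_ge0//; exact: nF.
have L0 : 0 <= L.
  by rewrite /L; apply: mulr_ge0; [exact: ltW|apply: mulr_ge0; apply: mulr_ge0 => //; exact: powR_ge0].
have hB x : cnorm (h x - (gaussian e 0 x ^+ 2)%:C * product_wave D t a x) <= 1.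
  apply: (le_trans (bilinear_gauss_waves_approx (@alpha R D) mA mN N0 AX XA mw e0 lk wA x)).
  rewrite -mulr_suml -/S (_ : 2 * dl = (S + 1)^-1); last first.
    by rewrite /dl; field; rewrite gt_eqF.
  by rewrite ler_pdivrMr// mul1r lerDl.
have upper := weighted_wave_le e0 r1 L0 hL hB.
have bound := gaussian_scale_bound d p1 q1 r1 pqr C0 e0 bb.
have V0 : 0 < e ^- d by rewrite invr_gt0 exprn_gt0.
have := growth_bound V0 C0 bound _ upper.
have sE : (3 * e / 2) ^- d = (2 / 3) ^+ d * e ^- d.
  by rewrite -!exprVn -exprMn; congr (_ ^+ _); field; rewrite gt_eqF.
rewrite -sE => /(_ lower) le41.
by have := lt_le_trans big le41; rewrite ltxx.
Qed.

End contradiction.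

Theorem theorem1p7 (R : realType) (d : nat) (E : set 'rV[R]_d)
    (p q r : \bar R) :
  (1 <= d)%N ->
  E !=set0 ->
  lebesgue_measurable E ->
  (1 <= p)%E -> (1 <= q)%E -> (1 <= r)%E ->
  (p^-1 + q^-1 = r^-1)%E ->
  count (fun s : \bar R => (s < 2%:E)%E) [:: p; q; hoelder_conjugate r] = 1%N ->
  bilinear_multiplier_symbol p q r (cindic E) ->
  exists U : set 'rV[R]_d, open U /\ lebesgue_equiv E U.
Proof.
move=> _ _ mE p1 q1 r1 pqr _ hE; apply: contrapT => noU.
apply: (not_open_not_multiplier mE p1 q1 r1 pqr _ hE) => U oU EU.
by apply: noU; exists U.
Qed.
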